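(* Let $P$ be a simple polygon. Then the human can catch the puppy on $P$, starting from any initial configuration.
   Context: The track is the boundary of $P$. A human and a puppy are points on the track. The human walks along the track at bounded speed and may change direction. The puppy, with unbounded speed and while the human is stationary, runs along the track in a direction in which its Euclidean straight-line distance to the human decreases, until it reaches a point where this distance is locally minimal (if both directions decrease the distance it picks either); when at such a point, the puppy stays until the human moves, and then moves along the track so as to remain at a local minimum until forced to run again. (At a vertex the puppy's direction of motion is tracked: a puppy at a vertex faces along one of the incident edges or turns between them.) The human catches the puppy when their positions coincide. *)

(* Defs.v *)
From Stdlib Require Import Reals Lra.
Open Scope R_scope.

Definition pt := (R * R)%type.

Definition edist (a b : pt) : R :=
  sqrt ((fst a - fst b) ^ 2 + (snd a - snd b) ^ 2).

Definition lerp (a b : pt) (s : R) : pt :=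
  (fst a + s * (fst b - fst a), snd a + s * (snd b - snd a)).

Definition on_seg (a b x : pt) : Prop :=
  exists s, 0 <= s <= 1 /\ x = lerp a b s.

Definition vert (n : nat) (V : nat -> pt) (i : nat) : pt := V (Nat.modulo i n).

Definition simple_polygon (n : nat) (V : nat -> pt) : Prop :=
  (3 <= n)%nat /\
  (forall i j, (i < n)%nat -> (j < n)%nat -> V i = V j -> i = j) /\
  (forall i j x, (i < n)%nat -> (j < n)%nat -> i <> j ->
     on_seg (vert n V i) (vert n V (S i)) x ->
     on_seg (vert n V j) (vert n V (S j)) x ->
     (Nat.modulo (S i) n = j /\ x = V j) \/ (Nat.modulo (S j) n = i /\ x = V i)).

Definition edge_len (n : nat) (V : nat -> pt) (i : nat) : R :=
  edist (vert n V i) (vert n V (S i)).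

Fixpoint sum_len (n : nat) (V : nat -> pt) (k : nat) : R :=
  match k with O => 0 | S k' => sum_len n V k' + edge_len n V k' end.

Definition perimeter (n : nat) (V : nat -> pt) : R := sum_len n V n.

Fixpoint locate (n : nat) (V : nat -> pt) (i m : nat) (u : R) : pt :=
  match m with
  | O => vert n V i
  | S m' =>
      if Rlt_dec u (edge_len n V i)
      then lerp (vert n V i) (vert n V (S i)) (u / edge_len n V i)
      else locate n V (S i) m' (u - edge_len n V i)
  end.

Definition fl (x : R) : R := IZR (up x) - 1.

(* The track: the boundary of P parametrized by arc length, as a
   perimeter-periodic map R -> R^2 (positions on the track are given by
   "lifted" real coordinates; s and s + perimeter are the same point). *)
Definition track (n : nat) (V : nat -> pt) (s : R) : pt :=
  let L := perimeter n V in locate n V O n (s - L * fl (s / L)).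

Definition tdist (n : nat) (V : nat -> pt) (a b : R) : R :=
  edist (track n V a) (track n V b).

Definition IsLocMin (f : R -> R) (x : R) : Prop :=
  exists eps, 0 < eps /\ forall y, Rabs (y - x) < eps -> f x <= f y.

Definition descent (f : R -> R) (q r : R) : Prop :=
  (q < r /\ forall x y, q <= x -> x < y -> y <= r -> f y < f x) \/
  (r < q /\ forall x y, r <= y -> y < x -> x <= q -> f y < f x).

(* From puppy position p, with distance function f, the puppy settles at q:
   it stays if p is a local minimum, otherwise runs in a decreasing direction
   until it first reaches a local minimum q. *)
Definition settle (f : R -> R) (p q : R) : Prop :=
  (IsLocMin f p /\ q = p) \/ (~ IsLocMin f p /\ descent f p q /\ IsLocMin f q).

Definition hpath (h0 h1 t : R) : R := if Rle_dec h0 h1 then h0 + t else h0 - t.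

Definition left_lim (p : R -> R) (t q : R) : Prop :=
  forall eps, 0 < eps -> exists del, 0 < del /\
    forall s, 0 <= s -> t - del < s < t -> Rabs (p s - q) < eps.

Definition right_cont (p : R -> R) (T t : R) : Prop :=
  forall eps, 0 < eps -> exists del, 0 < del /\
    forall s, t <= s <= T -> s < t + del -> Rabs (p s - p t) < eps.

(* p : [0, |h1-h0|] -> R is a puppy trajectory consistent with the rules
   while the human walks from h0 to h1, the puppy starting at p0:
   it is always at a local minimum, it moves continuously (tracking a local
   minimum) except at instants where the tracked point stops being a local
   minimum, where it runs (instantaneously, the human being at hpath t)
   along a strictly decreasing path to the next local minimum. *)
Definition valid_response (n : nat) (V : nat -> pt) (h0 h1 p0 : R)
    (p : R -> R) : Prop :=
  let T := Rabs (h1 - h0) in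
  let f := fun t y => tdist n V (hpath h0 h1 t) y in
  p 0 = p0 /\
  (forall t, 0 <= t <= T -> IsLocMin (f t) (p t)) /\
  (forall t, 0 <= t < T -> right_cont p T t) /\
  (forall t, 0 < t <= T -> exists q, left_lim p t q /\
       (q = p t \/ (~ IsLocMin (f t) q /\ descent (f t) q (p t)))).

Definition caught (n : nat) (V : nat -> pt) (a b : R) : Prop :=
  track n V a = track n V b.

(* The human (at h) can catch the puppy (at p): either already caught, or
   there is a walk after which, whatever the puppy does according to the
   rules, it is caught during the walk or the human can catch it from the
   resulting configuration. Inductive: every play ends after finitely many
   walks. *)
Inductive can_catch (n : nat) (V : nat -> pt) : R -> R -> Prop :=
| cc_now h p : caught n V h p -> can_catch n V h p
| cc_move h p h1 :
    IsLocMin (fun y => tdist n V h y) p ->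
    (forall pp, valid_response n V h h1 p pp ->
       (exists t, 0 <= t <= Rabs (h1 - h) /\ caught n V (hpath h h1 t) (pp t))
       \/ can_catch n V h1 (pp (Rabs (h1 - h)))) ->
    can_catch n V h p.

(* Main.v *)
(* Write g for the track, L for its length, and suppose that the puppy is never
   caught from some stable position. By lifting, the pairs (h, p) with
   h < p < h + L from which the human cannot win ("escaping" pairs) satisfy: every
   walk of the human has a response of the puppy that ends in an escaping pair. For
   each h consider the lowest escaping p. There is a point c, locally independent of
   h on either side, from which the puppy would run up to that p; by compactness
   finitely many such points c_0, ..., c_k serve all h in [v, v + L], and where c_j
   is replaced by c_(j+1), all points between them have this property. Reversing
   the orientation, points d_0, ..., d_m from which the puppy would run down to the
   highest escaping p serve all h in [v - L, v], and c_0 < d_m.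

   These two staircases contradict each other. Let phi(a, b), a < b < a + L, be a
   continuous angle of the chord from g(a) to g(b); exchanging its ends adds an odd
   multiple sigma of PI. The staircase condition is a sign condition on the cosine
   of the angle between a chord and a tangent, so that angle remains in one interval
   of length PI along a staircase. The interval is determined by taking v to be a
   point of the track farthest from the origin, because the chords from g(v) then
   fill less than a half plane of directions. In the grid of pairs (d_i, c_j), each
   edge between c_j < d_i and its negation carries a point q that the puppy would
   leave downwards for a human at a and upwards for a human at b; then the angle
   between the chord from a to b and the tangent at q is confined to one interval as
   well, constantly along each curve formed by such edges. Its values at a = v and
   at b = v differ, whereas an odd number of these curves has to start at b = v
   and they cannot end anywhere. *)

Require Import Defs.
From Stdlib Require Import Reals Lra Lia ZArith Bool Classical ClassicalEpsilon.
Open Scope R_scope.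

(** * Continuity on an interval *)

(** Strategies never appear. The set of losing pairs is used only through a closure property, the
    contrapositive of [cc_move]: every walk has a legal response that avoids capture and ends in a
    losing pair. An uncaught puppy cannot pass the human, so its lift stays in the strip h < p < h +
    L; there chords do not degenerate, because the polygon is simple, and their angle has a
    continuous lift. The angle argument rests on the shape of the set where the cosine is
    nonnegative: closed intervals of length PI, called sheets, separated by gaps of length PI. A
    continuous angle with nonnegative cosine cannot change its sheet. The obstacle is the vertices,
    where the tangent angle jumps. The jump is less than PI since the track does not fold back, and
    the sign conditions hold for both one-sided tangents, so the sheet survives. The staircases may
    go up and down, so the sign changes of d_i - c_j can form complicated curves in the grid; hence
    they are counted modulo 2. The values at a = v and b = v are separated by |sigma| >= PI, a
    consequence of [cos sigma = -1]. *)

Lemma real_induction (P : R -> Prop) (a b : R) :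
  a <= b -> P a ->
  (forall x, a <= x < b -> P x ->
     exists e, 0 < e /\ forall y, x < y < x + e -> y <= b -> P y) ->
  (forall x, a < x <= b -> (forall y, a <= y < x -> P y) -> P x) ->
  forall x, a <= x <= b -> P x.
Proof.
  intros Hab Pa Hr Hl.
  set (E := fun x => a <= x <= b /\ forall y, a <= y <= x -> P y).
  assert (Ea : E a).
  { split; [lra|]. intros y Hy. replace y with a by lra. exact Pa. }
  assert (Hbd : bound E) by (exists b; intros x [Hx _]; lra).
  destruct (completeness E Hbd (ex_intro _ a Ea)) as [s [Hub Hlub]].
  assert (Has : a <= s) by (apply Hub; exact Ea).
  assert (Hsb : s <= b) by (apply Hlub; intros x [Hx _]; lra).
  assert (Hbelow : forall y, a <= y < s -> P y).
  { intros y Hy. apply NNPP. intros Hn.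
    assert (s <= y); [|lra]. apply Hlub. intros x [Hx Hx2].
    destruct (Rle_dec x y); auto. exfalso. apply Hn, Hx2. lra. }
  assert (Ps : P s).
  { destruct (Req_dec a s) as [<-|Hne]; auto. apply Hl; auto. lra. }
  assert (Es : E s).
  { split; [lra|]. intros y Hy. destruct (Req_dec y s) as [->|Hne]; auto.
    apply Hbelow. lra. }
  destruct (Rlt_le_dec s b) as [Hlt|Hge].
  - destruct (Hr s ltac:(lra) Ps) as [e [He Hright]].
    exfalso. set (z := Rmin b (s + e / 2)).
    assert (Hz : s < z /\ z <= b /\ z < s + e).
    { unfold z, Rmin. destruct (Rle_dec b (s + e / 2)); lra. }
    assert (E z).
    { split; [lra|]. intros y Hy. destruct (Rle_dec y s).
      - apply Es. lra.
      - apply Hright; lra. }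
    pose proof (Hub z H). lra.
  - intros x Hx. apply Es. lra.
Qed.

(** Connectedness of the interval. Every transport of an angle condition from one place to another
    goes through this form. *)
Lemma clopen_interval (B : R -> Prop) (x y : R) :
  x <= y ->
  (forall q, x <= q <= y -> exists e, 0 < e /\
     forall q', x <= q' <= y -> Rabs (q' - q) < e -> (B q' <-> B q)) ->
  (B x <-> B y).
Proof.
  intros Hxy Hloc.
  apply (real_induction (fun q => B x <-> B q) x y); try tauto; try lra.
  - intros q Hq HB. destruct (Hloc q) as [e [He H]]; [lra|].
    exists e. split; auto. intros z Hz Hzy. rewrite HB. symmetry. apply H; [lra|].
    rewrite Rabs_pos_eq; lra.
  - intros q Hq HB. destruct (Hloc q) as [e [He H]]; [lra|].
    set (z := Rmax x (q - e / 2)).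
    assert (Hz : x <= z < q /\ q - e < z).
    { unfold z, Rmax. destruct (Rle_dec x (q - e / 2)); lra. }
    rewrite (HB z) by lra. apply H; [lra|].
    rewrite Rabs_left; lra.
Qed.

(** Continuity relative to the interval: lifts of angles are built by gluing and carry no
    information outside their range. *)
Definition cont_on (g : R -> R) (x y : R) : Prop :=
  forall q, x <= q <= y -> forall eps, 0 < eps -> exists del, 0 < del /\
    forall q', x <= q' <= y -> Rabs (q' - q) < del -> Rabs (g q' - g q) < eps.

Lemma cont_on_pt (g : R -> R) (x y : R) :
  (forall q, x <= q <= y -> continuity_pt g q) -> cont_on g x y.
Proof.
  intros H q Hq eps He. destruct (H q Hq eps He) as [d [Hd H2]].
  exists d. split; auto. intros q' _ Hq'.
  destruct (Req_dec q q') as [->|Hne].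
  - replace (g q' - g q') with 0 by ring. rewrite Rabs_R0. exact He.
  - apply H2. split; [split; [exact I|auto]|exact Hq'].
Qed.

Lemma cont_on_sub (g : R -> R) (x y x' y' : R) :
  cont_on g x y -> x <= x' -> y' <= y -> cont_on g x' y'.
Proof.
  intros H H1 H2 q Hq eps He. destruct (H q) with (eps := eps) as [d [Hd H3]]; auto; [lra|].
  exists d. split; auto. intros. apply H3; auto; lra.
Qed.

Lemma cont_on_ext (f g : R -> R) (x y : R) :
  (forall s, x <= s <= y -> f s = g s) -> cont_on f x y -> cont_on g x y.
Proof.
  intros Hfg H q Hq eps He. destruct (H q) with (eps := eps) as [d [Hd H3]]; auto.
  exists d. split; auto. intros. rewrite <- !Hfg by auto. auto.
Qed.

Lemma cont_on_const (k x y : R) : cont_on (fun _ => k) x y.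
Proof.
  intros q _ eps He. exists 1. split; [lra|]. intros.
  rewrite Rminus_diag, Rabs_R0. exact He.
Qed.

Lemma cont_on_plus (f g : R -> R) (x y : R) :
  cont_on f x y -> cont_on g x y -> cont_on (fun s => f s + g s) x y.
Proof.
  intros Hf Hg q Hq eps He.
  destruct (Hf q Hq (eps / 2)) as [d1 [Hd1 H1]]; [lra|].
  destruct (Hg q Hq (eps / 2)) as [d2 [Hd2 H2]]; [lra|].
  exists (Rmin d1 d2). split; [apply Rmin_pos; auto|]. intros q' Hq' Hd.
  pose proof (Rmin_l d1 d2). pose proof (Rmin_r d1 d2).
  specialize (H1 q' Hq' ltac:(lra)). specialize (H2 q' Hq' ltac:(lra)).
  replace (f q' + g q' - (f q + g q)) with ((f q' - f q) + (g q' - g q)) by ring.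
  pose proof (Rabs_triang (f q' - f q) (g q' - g q)). lra.
Qed.

Lemma cont_on_opp (f : R -> R) (x y : R) :
  cont_on f x y -> cont_on (fun s => - f s) x y.
Proof.
  intros Hf q Hq eps He. destruct (Hf q Hq eps He) as [d [Hd H]].
  exists d. split; auto. intros q' Hq' Hd'.
  replace (- f q' - - f q) with (- (f q' - f q)) by ring. rewrite Rabs_Ropp. auto.
Qed.

Lemma cont_on_glue (f g : R -> R) (x z y : R) :
  x <= z <= y -> cont_on f x z -> cont_on g z y -> f z = g z ->
  cont_on (fun s => if Rle_dec s z then f s else g s) x y.
Proof.
  intros Hz Hf Hg Hfg q Hq eps He.
  destruct (Rtotal_order q z) as [Hlt|[->|Hgt]].
  - destruct (Hf q) with (eps := eps) as [d [Hd H]]; auto; [lra|].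
    exists (Rmin d (z - q)). split; [apply Rmin_pos; lra|]. intros q' Hq' Hd'.
    pose proof (Rmin_l d (z - q)). pose proof (Rmin_r d (z - q)).
    assert (q' < z) by (pose proof (Rle_abs (q' - q)); lra).
    destruct (Rle_dec q' z); [|lra]. destruct (Rle_dec q z); [|lra].
    apply H; lra.
  - destruct (Hf z) with (eps := eps) as [d1 [Hd1 H1]]; auto; [lra|].
    destruct (Hg z) with (eps := eps) as [d2 [Hd2 H2]]; auto; [lra|].
    exists (Rmin d1 d2). split; [apply Rmin_pos; lra|]. intros q' Hq' Hd'.
    pose proof (Rmin_l d1 d2). pose proof (Rmin_r d1 d2).
    destruct (Rle_dec z z); [|lra]. destruct (Rle_dec q' z).
    + apply H1; lra.
    + rewrite Hfg. apply H2; lra.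
  - destruct (Hg q) with (eps := eps) as [d [Hd H]]; auto; [lra|].
    exists (Rmin d (q - z)). split; [apply Rmin_pos; lra|]. intros q' Hq' Hd'.
    pose proof (Rmin_l d (q - z)). pose proof (Rmin_r d (q - z)).
    assert (z < q') by (pose proof (Rle_abs (- (q' - q))); rewrite Rabs_Ropp in *; lra).
    destruct (Rle_dec q' z); [lra|]. destruct (Rle_dec q z); [lra|].
    apply H; lra.
Qed.

(** The neighbouring sheets begin at distance 3 PI / 2 from 0, so a bound below that value already
    singles out the central sheet. *)
Lemma cos_nonneg_small (x : R) :
  0 <= cos x -> Rabs x < 3 * (PI / 2) -> Rabs x <= PI / 2.
Proof.
  intros Hc Hx. destruct (Rle_dec (Rabs x) (PI / 2)) as [|Hn]; auto. exfalso.
  assert (cos (Rabs x) < 0) by (apply cos_lt_0; lra).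
  unfold Rabs in *. destruct (Rcase_abs x); [rewrite cos_neg in *|]; lra.
Qed.

(** An oscillation below PI / 2 cannot cross a gap between sheets: from |g q| <= PI / 2 it leads to
    |g q'| < PI, which is still short of the next sheet. *)
Lemma sheet_const (g : R -> R) (x y : R) :
  x <= y -> cont_on g x y -> (forall s, x <= s <= y -> 0 <= cos (g s)) ->
  (Rabs (g x) <= PI / 2 <-> Rabs (g y) <= PI / 2).
Proof.
  intros Hxy Hg Hc.
  apply (clopen_interval (fun s => Rabs (g s) <= PI / 2)); auto.
  intros q Hq. pose proof PI_RGT_0 as HPI.
  destruct (Hg q Hq (PI / 2)) as [d [Hd H]]; [lra|].
  exists d. split; auto. intros q' Hq' Hd'. specialize (H q' Hq' Hd').
  assert (T1 := Rabs_triang (g q' - g q) (g q)).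
  assert (T2 := Rabs_triang (- (g q' - g q)) (g q')).
  rewrite Rabs_Ropp in T2.
  replace (g q' - g q + g q) with (g q') in T1 by ring.
  replace (- (g q' - g q) + g q') with (g q) in T2 by ring.
  split; intros; apply cos_nonneg_small; auto; lra.
Qed.

Lemma cos_eq_1_small (x : R) : cos x = 1 -> Rabs x <= PI / 2 -> x = 0.
Proof.
  intros Hc Hx.
  assert (Hs : sin x = 0).
  { pose proof (sin2_cos2 x). rewrite Hc in H. unfold Rsqr in H. nra. }
  pose proof PI_RGT_0.
  assert (- (PI/2) <= x <= PI/2).
  { revert Hx. unfold Rabs. destruct (Rcase_abs x); lra. }
  destruct (Rtotal_order x 0) as [H1|[H1|H1]]; auto; exfalso.
  - assert (0 < sin (- x)) by (apply sin_gt_0; lra). rewrite sin_neg in *. lra.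
  - assert (0 < sin x) by (apply sin_gt_0; lra). lra.
Qed.

(** The multiples of 2 PI are discrete. Applied to differences of two lifts, this yields uniqueness
    of lifts. *)
Lemma cos_1_const (g : R -> R) (x y : R) :
  x <= y -> cont_on g x y -> (forall s, x <= s <= y -> cos (g s) = 1) ->
  (g x = 0 <-> g y = 0).
Proof.
  intros Hxy Hg Hc. pose proof PI_RGT_0.
  pose proof (sheet_const g x y Hxy Hg) as Hs.
  assert (H0 : forall s, x <= s <= y -> 0 <= cos (g s)) by (intros s Hs'; rewrite Hc; lra).
  specialize (Hs H0).
  split; intros E; rewrite E, Rabs_R0 in Hs; apply cos_eq_1_small; try apply Hc; try lra;
    apply Hs; lra.
Qed.

(** * Angles of plane vectors and of paths *)

Definition dot (u v : pt) : R := fst u * fst v + snd u * snd v.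
Definition cross (u v : pt) : R := fst u * snd v - snd u * fst v.
Definition vsub (a b : pt) : pt := (fst a - fst b, snd a - snd b).
Definition vadd (a b : pt) : pt := (fst a + fst b, snd a + snd b).
Definition vscale (k : R) (a : pt) : pt := (k * fst a, k * snd a).

(** [theta] is an argument of [u] as a real number, not modulo 2 PI; the condition 0 < r excludes
    the zero vector. *)
Definition dir (theta : R) (u : pt) : Prop :=
  exists r, 0 < r /\ fst u = r * cos theta /\ snd u = r * sin theta.

Lemma dir_dot (a b : R) (u v : pt) :
  dir a u -> dir b v -> exists k, 0 < k /\ dot u v = k * cos (a - b).
Proof.
  intros [r [Hr [H1 H2]]] [s [Hs [H3 H4]]]. exists (r * s). split; [nra|].
  unfold dot. rewrite H1, H2, H3, H4, cos_minus. ring.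
Qed.

Lemma dir_dot_nonneg (a b : R) (u v : pt) :
  dir a u -> dir b v -> (0 <= dot u v <-> 0 <= cos (a - b)).
Proof.
  intros Hu Hv. destruct (dir_dot _ _ _ _ Hu Hv) as [k [Hk ->]]. split; intros; nra.
Qed.

(** Congruence modulo 2 PI is expressed by [cos (a - b) = 1] throughout, and a difference by an odd
    multiple of PI by the value -1. *)
Lemma dir_unique (a b : R) (u : pt) : dir a u -> dir b u -> cos (a - b) = 1.
Proof.
  intros [r [Hr [H1 H2]]] [s [Hs [H3 H4]]].
  assert (E1 : r * cos a = s * cos b) by lra.
  assert (E2 : r * sin a = s * sin b) by lra.
  pose proof (sin2_cos2 a) as Pa. pose proof (sin2_cos2 b) as Pb. unfold Rsqr in *.
  assert (r = s).
  { assert (r * r = s * s).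
    { replace (r * r) with ((r * cos a) * (r * cos a) + (r * sin a) * (r * sin a)) by nra.
      rewrite E1, E2. nra. }
    nra. }
  subst s. rewrite cos_minus.
  assert (cos a = cos b) by nra. assert (sin a = sin b) by nra.
  rewrite H, H0. nra.
Qed.

Lemma dir_shift (a b : R) (u : pt) : dir a u -> cos (b - a) = 1 -> dir b u.
Proof.
  intros [r [Hr [H1 H2]]] Hc. exists r. split; auto.
  assert (Hs : sin (b - a) = 0).
  { pose proof (sin2_cos2 (b - a)). rewrite Hc in H. unfold Rsqr in H. nra. }
  replace b with (a + (b - a)) by ring.
  rewrite cos_plus, sin_plus, Hc, Hs. split; nra.
Qed.

Lemma dir_scale (a k : R) (u : pt) : 0 < k -> dir a u -> dir a (vscale k u).
Proof.
  intros Hk [r [Hr [H1 H2]]]. exists (k * r). simpl. rewrite H1, H2. repeat split; nra.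
Qed.

Lemma dir_opp (a b : R) (u v : pt) :
  dir a u -> dir b v -> u = vscale (-1) v -> cos (a - b) = -1.
Proof.
  intros Hu [s [Hs [H3 H4]]] ->.
  assert (H : dir (b + PI) (vscale (-1) v)).
  { exists s. split; auto. rewrite neg_cos, neg_sin. simpl. rewrite H3, H4. lra. }
  pose proof (dir_unique _ _ _ Hu H) as E.
  replace (a - b) with (a - (b + PI) + PI) by ring. rewrite neg_cos. lra.
Qed.

(** The signed angle from [u] to [v] while [0 < dot u v]. It lies in (-PI/2, PI/2) and is continuous
    there, so it serves to extend lifts locally. *)
Definition turn (u v : pt) : R := atan (cross u v / dot u v).

Lemma dir_turn (a : R) (u v : pt) : dir a u -> 0 < dot u v -> dir (a + turn u v) v.
Proof.
  intros [r [Hr [H1 H2]]] Hd. unfold turn. set (z := cross u v / dot u v).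
  assert (Hsq : 0 < sqrt (1 + z ^ 2)) by (apply sqrt_lt_R0; nra).
  exists (dot u v / r * sqrt (1 + z ^ 2)). split.
  { apply Rmult_lt_0_compat; auto. apply Rdiv_lt_0_compat; auto. }
  rewrite cos_plus, sin_plus, cos_atan, sin_atan.
  replace (1 + z²) with (1 + z ^ 2) by (unfold Rsqr; ring).
  pose proof (sin2_cos2 a) as Pa. unfold Rsqr in Pa.
  assert (Hz : z * dot u v = cross u v) by (unfold z; field; lra).
  assert (E1 : fst v * r = dot u v * cos a - cross u v * sin a).
  { unfold dot, cross. rewrite H1, H2.
    replace (fst v * r) with (fst v * r * (sin a * sin a + cos a * cos a)) by (rewrite Pa; ring). ring. }
  assert (E2 : snd v * r = dot u v * sin a + cross u v * cos a).
  { unfold dot, cross. rewrite H1, H2.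
    replace (snd v * r) with (snd v * r * (sin a * sin a + cos a * cos a)) by (rewrite Pa; ring). ring. }
  split; apply (Rmult_eq_reg_r r); try lra.
  - rewrite E1, <- Hz. field. lra.
  - rewrite E2, <- Hz. field. lra.
Qed.

Lemma dir_exists (u : pt) : 0 < dot u u -> exists a, dir a u.
Proof.
  intros Hu. unfold dot in Hu.
  (* [turn] covers only an open half plane; every nonzero vector makes an acute angle with one of
     the four axis directions. *)
  assert (D1 : dir 0 (1, 0)) by (exists 1; rewrite cos_0, sin_0; simpl; lra).
  assert (D2 : dir (PI / 2) (0, 1)) by (exists 1; rewrite cos_PI2, sin_PI2; simpl; lra).
  assert (D3 : dir PI (-1, 0)) by (exists 1; rewrite cos_PI, sin_PI; simpl; lra).
  assert (D4 : dir (- (PI / 2)) (0, -1)).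
  { exists 1; rewrite cos_neg, sin_neg, cos_PI2, sin_PI2; simpl; lra. }
  destruct (Rtotal_order (fst u) 0) as [H|[H|H]].
  - exists (PI + turn (-1, 0) u). apply dir_turn; auto. unfold dot; simpl. lra.
  - destruct (Rtotal_order (snd u) 0) as [H'|[H'|H']].
    + exists (- (PI / 2) + turn (0, -1) u). apply dir_turn; auto. unfold dot; simpl. lra.
    + exfalso. rewrite H, H' in Hu. lra.
    + exists (PI / 2 + turn (0, 1) u). apply dir_turn; auto. unfold dot; simpl. lra.
  - exists (0 + turn (1, 0) u). apply dir_turn; auto. unfold dot; simpl. lra.
Qed.

Definition continuous_path (F : R -> pt) : Prop :=
  forall s, continuity_pt (fun x => fst (F x)) s /\ continuity_pt (fun x => snd (F x)) s.

Lemma continuity_pt_dot (F G : R -> pt) (s : R) :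
  continuous_path F -> continuous_path G -> continuity_pt (fun x => dot (F x) (G x)) s.
Proof.
  intros HF HG. destruct (HF s) as [H1 H2]. destruct (HG s) as [H3 H4]. unfold dot.
  apply (continuity_pt_plus (fun x => fst (F x) * fst (G x)) (fun x => snd (F x) * snd (G x))).
  - apply (continuity_pt_mult (fun x => fst (F x)) (fun x => fst (G x))); auto.
  - apply (continuity_pt_mult (fun x => snd (F x)) (fun x => snd (G x))); auto.
Qed.

Lemma continuity_pt_turn (F G : R -> pt) (s : R) :
  continuous_path F -> continuous_path G -> 0 < dot (F s) (G s) ->
  continuity_pt (fun x => turn (F x) (G x)) s.
Proof.
  intros HF HG Hd. destruct (HF s) as [H1 H2]. destruct (HG s) as [H3 H4]. unfold turn.
  apply (continuity_pt_comp (fun x => cross (F x) (G x) / dot (F x) (G x)) atan).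
  - apply (continuity_pt_div (fun x => cross (F x) (G x)) (fun x => dot (F x) (G x))).
    + unfold cross.
      apply (continuity_pt_minus (fun x => fst (F x) * snd (G x)) (fun x => snd (F x) * fst (G x))).
      * apply (continuity_pt_mult (fun x => fst (F x)) (fun x => snd (G x))); auto.
      * apply (continuity_pt_mult (fun x => snd (F x)) (fun x => fst (G x))); auto.
    + apply continuity_pt_dot; auto.
    + lra.
  - apply derivable_continuous_pt. apply derivable_pt_atan.
Qed.

Lemma continuous_path_const (u : pt) : continuous_path (fun _ => u).
Proof. intros s. split; apply continuity_pt_const; intros x y; reflexivity. Qed.

(** Both x and y vary because the limit step of [real_induction] extends a lift from a point to the
    left of s, across s. *)
Lemma path_local_dot (F : R -> pt) (s : R) :
  continuous_path F -> 0 < dot (F s) (F s) ->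
  exists d, 0 < d /\ forall x y, Rabs (x - s) < d -> Rabs (y - s) < d -> 0 < dot (F x) (F y).
Proof.
  intros HF Hd. destruct (HF s) as [H1 H2].
  set (m := dot (F s) (F s)) in *.
  (* If both values stay within e <= 1 of a coordinate c, their product exceeds c^2 - e (2 |c| + 1).
     The two losses add up to at most m / 4. *)
  set (e := Rmin 1 (m / (8 * (1 + Rabs (fst (F s)) + Rabs (snd (F s)))))).
  pose proof (Rabs_pos (fst (F s))) as A1. pose proof (Rabs_pos (snd (F s))) as A2.
  assert (Hq : 0 < m / (8 * (1 + Rabs (fst (F s)) + Rabs (snd (F s))))).
  { apply Rdiv_lt_0_compat; lra. }
  assert (He : 0 < e) by (apply Rmin_pos; lra).
  assert (He1 : e <= 1) by apply Rmin_l.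
  assert (He2 : e * (8 * (1 + Rabs (fst (F s)) + Rabs (snd (F s)))) <= m).
  { pose proof (Rmin_r 1 (m / (8 * (1 + Rabs (fst (F s)) + Rabs (snd (F s)))))) as Hr. fold e in Hr.
    apply (Rmult_le_compat_r (8 * (1 + Rabs (fst (F s)) + Rabs (snd (F s))))) in Hr; [|lra].
    replace (m / (8 * (1 + Rabs (fst (F s)) + Rabs (snd (F s)))) * (8 * (1 + Rabs (fst (F s)) + Rabs (snd (F s))))) with m in Hr by (field; lra).
    exact Hr. }
  destruct (cont_on_pt (fun x => fst (F x)) (s - 1) (s + 1)) with (q := s) (eps := e) as [d1 [Hd1 C1]];
    [intros; apply HF | lra | auto |].
  destruct (cont_on_pt (fun x => snd (F x)) (s - 1) (s + 1)) with (q := s) (eps := e) as [d2 [Hd2 C2]];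
    [intros; apply HF | lra | auto |].
  exists (Rmin 1 (Rmin d1 d2)). split; [repeat apply Rmin_pos; lra|].
  intros x y Hx Hy.
  pose proof (Rmin_l 1 (Rmin d1 d2)). pose proof (Rmin_r 1 (Rmin d1 d2)).
  pose proof (Rmin_l d1 d2). pose proof (Rmin_r d1 d2).
  assert (Bx : s - 1 <= x <= s + 1) by (apply Rabs_def2 in Hx; lra).
  assert (By : s - 1 <= y <= s + 1) by (apply Rabs_def2 in Hy; lra).
  pose proof (C1 x Bx ltac:(lra)) as X1. pose proof (C2 x Bx ltac:(lra)) as X2.
  pose proof (C1 y By ltac:(lra)) as Y1. pose proof (C2 y By ltac:(lra)) as Y2.
  assert (G : forall a b c, Rabs (a - c) < e -> Rabs (b - c) < e ->
     a * b > c * c - e * (2 * Rabs c + 1)).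
  { intros a b c Ha Hb.
    replace (a * b) with (c * c + (c * ((a - c) + (b - c)) + (a - c) * (b - c))) by ring.
    assert (T1 : Rabs (c * ((a - c) + (b - c)) + (a - c) * (b - c)) < e * (2 * Rabs c + 1)).
    { eapply Rle_lt_trans; [apply Rabs_triang|]. rewrite !Rabs_mult.
      pose proof (Rabs_triang (a - c) (b - c)). pose proof (Rabs_pos c).
      pose proof (Rabs_pos (a - c)). pose proof (Rabs_pos (b - c)).
      assert (Rabs (a - c) * Rabs (b - c) < e * 1).
      { nra. }
      assert (Rabs c * Rabs (a - c + (b - c)) <= Rabs c * (2 * e)).
      { apply Rmult_le_compat_l; lra. }
      nra. }
    apply Rabs_def2 in T1. lra. }
  pose proof (G _ _ _ X1 Y1). pose proof (G _ _ _ X2 Y2).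
  unfold dot. unfold m, dot in *. nra.
Qed.

Definition lifts (F : R -> pt) (x y : R) (theta : R -> R) : Prop :=
  cont_on theta x y /\ forall s, x <= s <= y -> dir (theta s) (F s).

Lemma lifts_unique (F : R -> pt) (x y : R) (f g : R -> R) (s0 s1 : R) :
  lifts F x y f -> lifts F x y g -> x <= s0 <= y -> x <= s1 <= y ->
  f s0 = g s0 -> f s1 = g s1.
Proof.
  intros [Cf Df] [Cg Dg] H0 H1 E.
  assert (K : forall a b, x <= a -> a <= b -> b <= y -> (f a - g a = 0 <-> f b - g b = 0)).
  { intros a b Ha Hab Hb.
    apply (cos_1_const (fun s => f s - g s) a b Hab).
    - apply (cont_on_plus f (fun s => - g s)).
      + eapply cont_on_sub; eauto.
      + apply cont_on_opp. eapply cont_on_sub; eauto.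
    - intros s Hs. apply (dir_unique _ _ (F s)); [apply Df|apply Dg]; lra. }
  destruct (Rle_dec s0 s1).
  - assert (f s1 - g s1 = 0) by (apply (K s0 s1); lra). lra.
  - assert (f s1 - g s1 = 0) by (apply (K s1 s0); lra). lra.
Qed.

Lemma lifts_extend (F : R -> pt) (x z y : R) (theta : R -> R) :
  continuous_path F -> x <= z <= y -> lifts F x z theta ->
  (forall s, z <= s <= y -> 0 < dot (F z) (F s)) ->
  exists theta', theta' x = theta x /\ lifts F x y theta'.
Proof.
  intros HF Hz [Ct Dt] Hd.
  exists (fun s => if Rle_dec s z then theta s else theta z + turn (F z) (F s)).
  assert (T0 : turn (F z) (F z) = 0).
  { unfold turn. replace (cross (F z) (F z)) with 0 by (unfold cross; ring).
    unfold Rdiv. rewrite Rmult_0_l. apply atan_0. }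
  split; [destruct (Rle_dec x z); lra|]. split.
  - apply cont_on_glue; auto.
    + apply (cont_on_plus (fun _ => theta z) (fun s => turn (F z) (F s))).
      * apply cont_on_const.
      * apply cont_on_pt. intros q Hq. apply (continuity_pt_turn (fun _ => F z) F); auto. apply continuous_path_const.
    + rewrite T0. ring.
  - intros s Hs. destruct (Rle_dec s z).
    + apply Dt. lra.
    + apply dir_turn; [apply Dt; lra|apply Hd; lra].
Qed.

Lemma lifts_exist_from_left (F : R -> pt) (x y t0 : R) :
  continuous_path F -> x <= y -> (forall s, x <= s <= y -> 0 < dot (F s) (F s)) ->
  dir t0 (F x) -> exists theta, theta x = t0 /\ lifts F x y theta.
Proof.
  intros HF Hxy Hnz H0.
  apply (real_induction (fun z => exists theta, theta x = t0 /\ lifts F x z theta) x y Hxy); try lra.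
  - exists (fun _ => t0). split; auto. split; [apply cont_on_const|].
    intros s Hs. replace s with x by lra. auto.
  - intros z Hz [th [Hx Hl]].
    destruct (path_local_dot F z HF) as [d [Hd Hdd]]; [apply Hnz; lra|].
    exists d. split; auto. intros w Hw Hwy.
    destruct (lifts_extend F x z w th HF) as [th' [E Hl']]; auto; try lra.
    + intros s Hs. apply Hdd; rewrite Rabs_pos_eq; lra.
    + exists th'. split; [lra|auto].
  - intros z Hz Hbel.
    destruct (path_local_dot F z HF) as [d [Hd Hdd]]; [apply Hnz; lra|].
    set (w := Rmax x (z - d / 2)).
    assert (Hw : x <= w < z /\ z - d < w).
    { unfold w, Rmax. destruct (Rle_dec x (z - d / 2)); lra. }
    destruct (Hbel w) as [th [Hx Hl]]; [lra|].
    destruct (lifts_extend F x w z th HF) as [th' [E Hl']]; auto; try lra.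
    + intros s Hs. apply Hdd; apply Rabs_def1; lra.
    + exists th'. split; [lra|auto].
Qed.

Lemma lifts_exist (F : R -> pt) (x y s0 t0 : R) :
  continuous_path F -> x <= s0 <= y -> (forall s, x <= s <= y -> 0 < dot (F s) (F s)) ->
  dir t0 (F s0) -> exists theta, theta s0 = t0 /\ lifts F x y theta.
Proof.
  intros HF Hs0 Hnz H0.
  destruct (dir_exists (F x)) as [a Ha]; [apply Hnz; lra|].
  destruct (lifts_exist_from_left F x y a HF) as [th [_ [Ct Dt]]]; auto; [lra|].
  exists (fun s => th s + (t0 - th s0)). split; [ring|]. split.
  - apply (cont_on_plus th (fun _ => t0 - th s0)); auto. apply cont_on_const.
  - intros s Hs. apply (dir_shift (th s)); [apply Dt; auto|].
    replace (th s + (t0 - th s0) - th s) with (t0 - th s0) by ring.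
    apply (dir_unique _ _ (F s0)); auto.
Qed.

Lemma turn_same (u : pt) : turn u u = 0.
Proof.
  unfold turn. replace (cross u u) with 0 by (unfold cross; ring).
  unfold Rdiv. rewrite Rmult_0_l. apply atan_0.
Qed.

Lemma lifts_sub (F : R -> pt) (x y x' y' : R) (f : R -> R) :
  lifts F x y f -> x <= x' -> y' <= y -> lifts F x' y' f.
Proof.
  intros [C D] H1 H2. split; [eapply cont_on_sub; eauto|].
  intros s Hs. apply D. lra.
Qed.

(** For a range that may be open or unbounded. The lifts over the compact intervals from s0 to s
    agree by uniqueness, so the lift chosen for s may be evaluated at s itself, giving one function
    on D. *)
Lemma lifts_interval (F : R -> pt) (D : R -> Prop) (s0 t0 : R) :
  continuous_path F -> (forall x y z, D x -> D y -> x <= z <= y -> D z) -> D s0 ->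
  (forall s, D s -> 0 < dot (F s) (F s)) -> dir t0 (F s0) ->
  exists theta, theta s0 = t0 /\ forall x y, D x -> D y -> lifts F x y theta.
Proof.
  intros HF Hconv H0 Hnz Hd.
  assert (Hex : forall s, exists th : R -> R, D s ->
     th s0 = t0 /\ lifts F (Rmin s s0) (Rmax s s0) th).
  { intros s. destruct (classic (D s)) as [Hs|Hs].
    - destruct (lifts_exist F (Rmin s s0) (Rmax s s0) s0 t0) as [th Hth]; auto.
      + split; [apply Rmin_r|apply Rmax_r].
      + intros z Hz. apply Hnz.
        unfold Rmin, Rmax in Hz. destruct (Rle_dec s s0).
        * apply (Hconv s s0); auto.
        * apply (Hconv s0 s); auto.
      + exists th. auto.
    - exists (fun _ => 0). tauto. }
  set (th := fun s => proj1_sig (constructive_indefinite_description _ (Hex s))).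
  assert (Hth : forall s, D s -> th s s0 = t0 /\ lifts F (Rmin s s0) (Rmax s s0) (th s)).
  { intros s. unfold th. exact (proj2_sig (constructive_indefinite_description _ (Hex s))). }
  exists (fun s => th s s). split; [apply Hth; auto|].
  assert (K : forall x y, D x -> D y -> x <= s0 <= y -> lifts F x y (fun s => th s s)).
  { intros x y Hx Hy Hxy.
    destruct (lifts_exist F x y s0 t0) as [T [HT0 HT]]; auto.
    { intros s Hs. apply Hnz. apply (Hconv x y); auto. }
    assert (E : forall s, x <= s <= y -> T s = th s s).
    { intros s Hs. destruct (Hth s) as [E0 HL]; [apply (Hconv x y); auto|].
      assert (Hm : x <= Rmin s s0 /\ Rmax s s0 <= y).
      { unfold Rmin, Rmax. destruct (Rle_dec s s0); lra. }
      apply (lifts_unique F (Rmin s s0) (Rmax s s0) T (th s) s0 s); auto.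
      - eapply lifts_sub; eauto; lra.
      - split; [apply Rmin_r|apply Rmax_r].
      - split; [apply Rmin_l|apply Rmax_l].
      - lra. }
    destruct HT as [C Dr]. split.
    - apply (cont_on_ext T); auto.
    - intros s Hs. rewrite <- E by auto. apply Dr; auto. }
  intros x y Hx Hy.
  apply (lifts_sub F (Rmin x s0) (Rmax y s0)); [|apply Rmin_l|apply Rmax_l].
  apply K.
  - unfold Rmin. destruct (Rle_dec x s0); auto.
  - unfold Rmax. destruct (Rle_dec y s0); auto.
  - split; [apply Rmin_r|apply Rmax_r].
Qed.

(** * Simple closed piecewise linear curves *)

(** Vertices are not listed: on each side of every point the curve is locally a straight segment at
    unit speed. Both tangents [tp] (right) and [tm] (left) point in the direction of increasing
    parameter, and they differ exactly at corners. This form is local and symmetric under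
    reversal. *)
Record pl_loop (g : R -> pt) (L : R) (tp tm : R -> pt) : Prop := {
  pl_pos : 0 < L;
  pl_per : forall s, g (s + L) = g s;
  pl_inj : forall a b, a < b < a + L -> g a <> g b;
  pl_tp : forall s, dot (tp s) (tp s) = 1;
  pl_tm : forall s, dot (tm s) (tm s) = 1;
  pl_lin : forall s, exists e, 0 < e /\ forall u, 0 <= u <= e ->
    g (s + u) = vadd (g s) (vscale u (tp s)) /\
    g (s - u) = vadd (g s) (vscale (- u) (tm s)) }.

Ltac vec := unfold vadd, vscale, vsub, dot, cross in *; simpl in *.

Lemma pt_eq (a b : pt) : fst a = fst b -> snd a = snd b -> a = b.
Proof. destruct a, b; simpl; intros -> ->; reflexivity. Qed.

Lemma dot_vsub_pos (a b : pt) : a <> b -> 0 < dot (vsub a b) (vsub a b).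
Proof.
  intros H. vec. destruct (Req_dec (fst a) (fst b)); destruct (Req_dec (snd a) (snd b)).
  - exfalso. apply H. apply pt_eq; auto.
  - nra.
  - nra.
  - nra.
Qed.

Lemma vadd_scale_cancel (a u v : pt) (k : R) :
  k <> 0 -> vadd a (vscale k u) = vadd a (vscale k v) -> u = v.
Proof.
  intros Hk H. vec. injection H as H1 H2.
  apply pt_eq; apply (Rmult_eq_reg_l k); lra.
Qed.

Section Loop.
Variables (g : R -> pt) (L : R) (tp tm : R -> pt).
Hypothesis HL : pl_loop g L tp tm.

(** A linear germ determines its tangent, so each point of the window off s inherits the tangent of
    its side. In the proof [w] is small enough to stay on that side of s and inside both linear
    ranges. *)
Lemma loop_window (s : R) : exists e, 0 < e < L / 4 /\
  (forall u, 0 <= u <= e ->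
     g (s + u) = vadd (g s) (vscale u (tp s)) /\ g (s - u) = vadd (g s) (vscale (- u) (tm s))) /\
  (forall u, 0 < u < e ->
     tp (s + u) = tp s /\ tm (s + u) = tp s /\ tp (s - u) = tm s /\ tm (s - u) = tm s).
Proof.
  destruct (pl_lin _ _ _ _ HL s) as [e [He H]]. pose proof (pl_pos _ _ _ _ HL) as HLp.
  exists (Rmin e (L / 5)). assert (Hm : 0 < Rmin e (L / 5)) by (apply Rmin_pos; lra).
  pose proof (Rmin_l e (L / 5)). pose proof (Rmin_r e (L / 5)).
  split; [lra|]. split; [intros u Hu; apply H; lra|].
  intros u Hu.
  destruct (pl_lin _ _ _ _ HL (s + u)) as [e1 [He1 H1']].
  destruct (pl_lin _ _ _ _ HL (s - u)) as [e2 [He2 H2']].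
  set (w := Rmin (Rmin e1 e2) (Rmin u (e - u))).
  assert (Hw : 0 < w) by (repeat apply Rmin_pos; lra).
  assert (w <= e1 /\ w <= e2 /\ w <= u /\ w <= e - u) as (W1 & W2 & W3 & W4).
  { unfold w. pose proof (Rmin_l (Rmin e1 e2) (Rmin u (e - u))).
    pose proof (Rmin_r (Rmin e1 e2) (Rmin u (e - u))).
    pose proof (Rmin_l e1 e2). pose proof (Rmin_r e1 e2).
    pose proof (Rmin_l u (e - u)). pose proof (Rmin_r u (e - u)). lra. }
  destruct (H1' w) as [A1 A2]; [lra|]. destruct (H2' w) as [A3 A4]; [lra|].
  destruct (H u) as [B1 B2]; [lra|].
  replace (s + u + w) with (s + (u + w)) in A1 by ring.
  replace (s + u - w) with (s + (u - w)) in A2 by ring.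
  replace (s - u + w) with (s - (u - w)) in A3 by ring.
  replace (s - u - w) with (s - (u + w)) in A4 by ring.
  rewrite (proj1 (H (u + w) ltac:(lra))), B1 in A1.
  rewrite (proj1 (H (u - w) ltac:(lra))), B1 in A2.
  rewrite (proj2 (H (u - w) ltac:(lra))), B2 in A3.
  rewrite (proj2 (H (u + w) ltac:(lra))), B2 in A4.
  repeat split; symmetry; apply (vadd_scale_cancel (0, 0) _ _ w); try lra;
    vec; [injection A1 as X Y | injection A2 as X Y | injection A3 as X Y | injection A4 as X Y];
    f_equal; lra.
Qed.

Lemma tangent_per (s : R) : tp (s + L) = tp s /\ tm (s + L) = tm s.
Proof.
  destruct (pl_lin _ _ _ _ HL s) as [e1 [He1 H1]].
  destruct (pl_lin _ _ _ _ HL (s + L)) as [e2 [He2 H2]].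
  set (w := Rmin e1 e2). assert (Hw : 0 < w) by (apply Rmin_pos; lra).
  pose proof (Rmin_l e1 e2) as M1. pose proof (Rmin_r e1 e2) as M2. fold w in M1, M2.
  destruct (H1 w) as [A1 A2]; [lra|]. destruct (H2 w) as [B1 B2]; [lra|].
  replace (s + L + w) with (s + w + L) in B1 by ring.
  replace (s + L - w) with (s - w + L) in B2 by ring.
  rewrite !(pl_per _ _ _ _ HL) in B1, B2. rewrite A1 in B1. rewrite A2 in B2.
  split; symmetry; [apply (vadd_scale_cancel (g s) _ _ w)|apply (vadd_scale_cancel (g s) _ _ (- w))];
    auto; lra.
Qed.

Lemma loop_neq (a b : R) : a < b < a + L -> 0 < dot (vsub (g b) (g a)) (vsub (g b) (g a)).
Proof.
  intros H. apply dot_vsub_pos. intros E. apply (pl_inj _ _ _ _ HL a b); auto.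
Qed.

(** Otherwise the track would retrace itself: [g (s - u) = g (s + u)] for small u. This keeps the
    turn at a vertex below PI. *)
Lemma tangents_not_opposite (s : R) : tm s <> vscale (-1) (tp s).
Proof.
  intros E. destruct (loop_window s) as [e [He [H _]]].
  destruct (H (e / 2)) as [A1 A2]; [lra|].
  apply (pl_inj _ _ _ _ HL (s - e / 2) (s + e / 2)); [lra|].
  rewrite A1, A2, E. vec. f_equal; lra.
Qed.

Lemma loop_lipschitz (x y : R) : x <= y ->
  Rabs (fst (g y) - fst (g x)) <= y - x /\ Rabs (snd (g y) - snd (g x)) <= y - x.
Proof.
  intros Hxy.
  assert (U : forall v : pt, dot v v = 1 -> Rabs (fst v) <= 1 /\ Rabs (snd v) <= 1).
  { intros v Hv. vec. split; apply Rabs_le; nra. }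
  assert (St : forall (a v : pt) k d, dot v v = 1 -> Rabs k <= d ->
     Rabs (fst (vadd a (vscale k v)) - fst a) <= d /\ Rabs (snd (vadd a (vscale k v)) - snd a) <= d).
  { intros a v k d Hv Hk. destruct (U v Hv) as [U1 U2]. simpl.
    pose proof (Rabs_pos k).
    split; [replace (fst a + k * fst v - fst a) with (k * fst v) by ring
           |replace (snd a + k * snd v - snd a) with (k * snd v) by ring];
      rewrite Rabs_mult; nra. }
  apply (real_induction (fun y => Rabs (fst (g y) - fst (g x)) <= y - x /\
                                  Rabs (snd (g y) - snd (g x)) <= y - x) x y Hxy); try lra.
  - rewrite !Rminus_diag, Rabs_R0. lra.
  - intros z Hz [I1 I2]. destruct (pl_lin _ _ _ _ HL z) as [e [He H]].
    exists e. split; auto. intros w Hw _.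
    destruct (H (w - z)) as [A1 _]; [lra|]. replace (z + (w - z)) with w in A1 by ring.
    destruct (St (g z) (tp z) (w - z) (w - z)) as [S1 S2];
      [apply (pl_tp _ _ _ _ HL) | rewrite Rabs_pos_eq; lra|].
    rewrite <- A1 in S1, S2.
    split.
    + replace (fst (g w) - fst (g x)) with ((fst (g w) - fst (g z)) + (fst (g z) - fst (g x))) by ring.
      eapply Rle_trans; [apply Rabs_triang|lra].
    + replace (snd (g w) - snd (g x)) with ((snd (g w) - snd (g z)) + (snd (g z) - snd (g x))) by ring.
      eapply Rle_trans; [apply Rabs_triang|lra].
  - intros z Hz Hb. destruct (pl_lin _ _ _ _ HL z) as [e [He H]].
    set (w := Rmax x (z - e)).
    assert (Hw : x <= w < z /\ z - e <= w).
    { unfold w, Rmax. destruct (Rle_dec x (z - e)); lra. }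
    destruct (Hb w) as [I1 I2]; [lra|].
    destruct (H (z - w)) as [_ A2]; [lra|]. replace (z - (z - w)) with w in A2 by ring.
    destruct (St (g z) (tm z) (- (z - w)) (z - w)) as [S1 S2];
      [apply (pl_tm _ _ _ _ HL) | rewrite Rabs_Ropp, Rabs_pos_eq; lra|].
    rewrite <- A2 in S1, S2. rewrite Rabs_minus_sym in S1. rewrite Rabs_minus_sym in S2.
    split.
    + replace (fst (g z) - fst (g x)) with ((fst (g z) - fst (g w)) + (fst (g w) - fst (g x))) by ring.
      eapply Rle_trans; [apply Rabs_triang|lra].
    + replace (snd (g z) - snd (g x)) with ((snd (g z) - snd (g w)) + (snd (g w) - snd (g x))) by ring.
      eapply Rle_trans; [apply Rabs_triang|lra].
Qed.

Lemma loop_lipschitz_abs (x y : R) :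
  Rabs (fst (g y) - fst (g x)) <= Rabs (y - x) /\ Rabs (snd (g y) - snd (g x)) <= Rabs (y - x).
Proof.
  destruct (Rle_dec x y).
  - rewrite (Rabs_pos_eq (y - x)) by lra. apply loop_lipschitz; auto.
  - rewrite (Rabs_minus_sym (fst (g y))), (Rabs_minus_sym (snd (g y))), (Rabs_minus_sym y).
    rewrite (Rabs_pos_eq (x - y)) by lra. apply loop_lipschitz; lra.
Qed.

Lemma loop_continuous : continuous_path g.
Proof.
  intros s. split; intros eps He; exists eps; split; auto; intros x [_ Hx]; simpl in *;
    unfold R_dist in *; destruct (loop_lipschitz_abs s x); lra.
Qed.

Lemma path_shift (c : R) : continuous_path (fun x => g (x + c)).
Proof.
  intros s. split; intros eps He; exists eps; split; auto; intros x [_ Hx]; simpl in *;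
    unfold R_dist in *; destruct (loop_lipschitz_abs (s + c) (x + c)) as [A1 A2];
    replace (x + c - (s + c)) with (x - s) in * by ring; lra.
Qed.

End Loop.

Lemma continuous_path_vsub (F G : R -> pt) :
  continuous_path F -> continuous_path G -> continuous_path (fun x => vsub (F x) (G x)).
Proof.
  intros HF HG s. destruct (HF s), (HG s). simpl. split.
  - apply (continuity_pt_minus (fun x => fst (F x)) (fun x => fst (G x))); auto.
  - apply (continuity_pt_minus (fun x => snd (F x)) (fun x => snd (G x))); auto.
Qed.

Lemma cont_on_shift (f : R -> R) (c x y : R) :
  cont_on f (x + c) (y + c) -> cont_on (fun s => f (s + c)) x y.
Proof.
  intros H q Hq eps He. destruct (H (q + c)) with (eps := eps) as [d [Hd K]]; [lra|auto|].
  exists d. split; auto. intros q' Hq' Hd'. apply K; [lra|].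
  replace (q' + c - (q + c)) with (q' - q) by ring. auto.
Qed.

Lemma path_min_norm (F : R -> pt) (x y : R) :
  continuous_path F -> x <= y -> (forall s, x <= s <= y -> 0 < dot (F s) (F s)) ->
  exists m, 0 < m /\ forall s, x <= s <= y -> m <= dot (F s) (F s).
Proof.
  intros HF Hxy Hp.
  destruct (continuity_ab_min (fun s => dot (F s) (F s)) x y Hxy) as [z [Hz1 Hz2]].
  - intros c _. apply continuity_pt_dot; auto.
  - exists (dot (F z) (F z)). split; auto.
Qed.

(** * The angle of a chord *)

Lemma cont_on_turn (F G : R -> pt) (x y : R) :
  continuous_path F -> continuous_path G ->
  (forall s, x <= s <= y -> 0 < dot (F s) (G s)) -> cont_on (fun s => turn (F s) (G s)) x y.
Proof.
  intros HF HG Hd. apply cont_on_pt. intros q Hq. apply continuity_pt_turn; auto.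
Qed.

Lemma dot_perturb (u w : pt) (m : R) :
  m <= dot u u -> dot w w < m -> 0 < dot u (vadd u w).
Proof.
  intros H1 H2. vec.
  pose proof (pow2_ge_0 (fst u + fst w)). pose proof (pow2_ge_0 (snd u + snd w)). nra.
Qed.

Section Angle.
Variables (g : R -> pt) (L : R) (tp tm : R -> pt).
Hypothesis HL : pl_loop g L tp tm.

Let F (a : R) : R -> pt := fun b => vsub (g b) (g a).

(** For each a the angle is lifted in b alone. The choices are made coherent by prescribing the
    value at b = a + L / 2 from one lift [A0] of the half-period chord. *)
Lemma angle_family_exists : exists (A0 : R -> R) (phi : R -> R -> R),
  (forall x y, lifts (fun a => vsub (g (a + L / 2)) (g a)) x y A0) /\
  (forall a, phi a (a + L / 2) = A0 a) /\
  (forall a x y, a < x -> x <= y -> y < a + L -> lifts (F a) x y (phi a)).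
Proof.
  pose proof (pl_pos _ _ _ _ HL) as HLp.
  destruct (dir_exists (vsub (g (0 + L / 2)) (g 0))) as [t0 Ht0].
  { apply (loop_neq g L tp tm HL). lra. }
  destruct (lifts_interval (fun a => vsub (g (a + L / 2)) (g a)) (fun _ => True) 0 t0)
    as [A0 [_ HA]]; auto.
  { apply continuous_path_vsub; [apply (path_shift g L tp tm HL)|apply (loop_continuous g L tp tm HL)]. }
  { intros s _. apply (loop_neq g L tp tm HL). lra. }
  assert (Hex : forall a, exists th : R -> R, th (a + L / 2) = A0 a /\
     forall x y, a < x < a + L -> a < y < a + L -> lifts (F a) x y th).
  { intros a.
    destruct (lifts_interval (F a) (fun b => a < b < a + L) (a + L / 2) (A0 a)) as [th Hth]; auto.
    - apply continuous_path_vsub; [apply (loop_continuous g L tp tm HL)|apply continuous_path_const].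
    - intros x y z Hx Hy Hz. lra.
    - lra.
    - intros s Hs. apply (loop_neq g L tp tm HL). auto.
    - destruct (HA a a I I) as [_ D0]. apply D0. lra.
    - exists th. exact Hth. }
  exists A0. exists (fun a => proj1_sig (constructive_indefinite_description _ (Hex a))).
  split; [intros; apply HA; auto|].
  split; intros a; destruct (constructive_indefinite_description _ (Hex a)) as [th [H1 H2]]; simpl; auto.
  intros x y H3 H4 H5. apply H2; lra.
Qed.

(** Continuity in the first end. Both sides are lifts of [F a'] on an interval containing b and the
    base point a' + L / 2; at the base point they agree because both continue [A0]. *)
Lemma angle_family_near (A0 : R -> R) (phi : R -> R -> R) :
  (forall x y, lifts (fun a => vsub (g (a + L / 2)) (g a)) x y A0) ->
  (forall a, phi a (a + L / 2) = A0 a) ->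
  (forall a x y, a < x -> x <= y -> y < a + L -> lifts (F a) x y (phi a)) ->
  forall a b, a < b < a + L -> exists r, 0 < r /\ forall a', Rabs (a' - a) < r ->
    0 < dot (F a b) (F a' b) /\ phi a' b = phi a b + turn (F a b) (F a' b).
Proof.
  intros HA Hbase Hphi a b Hb. pose proof (pl_pos _ _ _ _ HL) as HLp.
  pose proof (loop_continuous g L tp tm HL) as Cg.
  set (x := (a + Rmin b (a + L / 2)) / 2). set (y := (a + L + Rmax b (a + L / 2)) / 2).
  assert (Hxy : a < x /\ x < b < y /\ x < a + L / 2 < y /\ y < a + L).
  { unfold x, y, Rmin, Rmax. destruct (Rle_dec b (a + L / 2)); lra. }
  destruct (path_min_norm (F a) x y) as [m [Hm Hmin]].
  { apply continuous_path_vsub; auto. apply continuous_path_const. }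
  { lra. }
  { intros s Hs. apply (loop_neq g L tp tm HL). lra. }
  (* The bounds keep [x, y] inside the range of a', keep the base point inside [x, y], and make the
     squared displacement of [g a], below 2 r^2 <= m, too small to turn any chord by PI / 2. *)
  set (r := Rmin (Rmin (x - a) (a + L - y)) (Rmin (Rmin (a + L / 2 - x) (y - (a + L / 2))) (Rmin 1 (m / 2)))).
  assert (Hr : 0 < r) by (unfold r; repeat apply Rmin_pos; lra).
  assert (r <= x - a /\ r <= a + L - y /\ r <= a + L / 2 - x /\ r <= y - (a + L / 2) /\ r <= 1 /\ r <= m / 2)
    as (R1 & R2 & R3 & R4 & R5 & R6).
  { assert (Q1 := Rmin_l (Rmin (x - a) (a + L - y)) (Rmin (Rmin (a + L / 2 - x) (y - (a + L / 2))) (Rmin 1 (m / 2)))).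
    assert (Q2 := Rmin_r (Rmin (x - a) (a + L - y)) (Rmin (Rmin (a + L / 2 - x) (y - (a + L / 2))) (Rmin 1 (m / 2)))).
    fold r in Q1, Q2.
    pose proof (Rmin_l (x - a) (a + L - y)). pose proof (Rmin_r (x - a) (a + L - y)).
    pose proof (Rmin_l (Rmin (a + L / 2 - x) (y - (a + L / 2))) (Rmin 1 (m / 2))).
    pose proof (Rmin_r (Rmin (a + L / 2 - x) (y - (a + L / 2))) (Rmin 1 (m / 2))).
    pose proof (Rmin_l (a + L / 2 - x) (y - (a + L / 2))). pose proof (Rmin_r (a + L / 2 - x) (y - (a + L / 2))).
    pose proof (Rmin_l 1 (m / 2)). pose proof (Rmin_r 1 (m / 2)). lra. }
  assert (Hdot : forall a' s, Rabs (a' - a) < r -> x <= s <= y -> 0 < dot (F a s) (F a' s)).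
  { intros a' s Ha' Hs.
    replace (F a' s) with (vadd (F a s) (vsub (g a) (g a')))
      by (unfold F; apply pt_eq; vec; ring).
    apply (dot_perturb _ _ m); [apply Hmin; auto|].
    destruct (loop_lipschitz_abs g L tp tm HL a a') as [P1 P2].
    pose proof (Rabs_pos (a' - a)).
    assert (S1 : (fst (g a) - fst (g a')) ^ 2 < r * r).
    { rewrite <- pow2_abs, Rabs_minus_sym. pose proof (Rabs_pos (fst (g a') - fst (g a))). nra. }
    assert (S2 : (snd (g a) - snd (g a')) ^ 2 < r * r).
    { rewrite <- pow2_abs, Rabs_minus_sym. pose proof (Rabs_pos (snd (g a') - snd (g a))). nra. }
    vec. nra. }
  exists r. split; auto. intros a' Ha'. split; [apply Hdot; auto; lra|].
  apply Rabs_def2 in Ha' as Ha2.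
  assert (HG : lifts (F a') x y (fun s => phi a s + turn (F a s) (F a' s))).
  { destruct (Hphi a x y) as [C1 D1]; try lra. split.
    - apply (cont_on_plus (phi a) (fun s => turn (F a s) (F a' s))); auto.
      apply cont_on_turn; auto; apply continuous_path_vsub; auto; apply continuous_path_const.
    - intros s Hs. apply dir_turn; [apply D1; auto|apply Hdot; auto]. }
  symmetry.
  apply (lifts_unique (F a') x y (fun s => phi a s + turn (F a s) (F a' s)) (phi a') (a' + L / 2) b);
    auto; try lra.
  { apply Hphi; lra. }
  rewrite Hbase.
  set (lo := Rmin a a'). set (hi := Rmax a a').
  assert (Hlo : (lo <= a <= hi /\ lo <= a' <= hi) /\ a - r < lo /\ hi < a + r).
  { unfold lo, hi, Rmin, Rmax. destruct (Rle_dec a a'); lra. }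
  (* Uniqueness again, now for the half-period chord as its first end c runs from a to a'. *)
  apply (lifts_unique (fun c => vsub (g (c + L / 2)) (g c)) lo hi
    (fun c => phi a (c + L / 2) + turn (F a (c + L / 2)) (F c (c + L / 2))) A0 a a'); try tauto.
  - destruct (Hphi a x y) as [C1 D1]; try lra. split.
    + apply (cont_on_plus (fun c => phi a (c + L / 2)) (fun c => turn (F a (c + L / 2)) (F c (c + L / 2)))).
      * apply cont_on_shift. eapply cont_on_sub; eauto; lra.
      * apply (cont_on_turn (fun c => F a (c + L / 2)) (fun c => F c (c + L / 2))).
        -- apply continuous_path_vsub; [apply (path_shift g L tp tm HL)|apply continuous_path_const].
        -- apply continuous_path_vsub; [apply (path_shift g L tp tm HL)|auto].
        -- intros s Hs. apply Hdot; [apply Rabs_def1|]; lra.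
    + intros s Hs. apply dir_turn; [apply D1; lra|].
      apply (Hdot s (s + L / 2)); [apply Rabs_def1|]; lra.
  - apply HA.
  - cbv beta. rewrite turn_same, Hbase. ring.
Qed.

End Angle.

(* phi a b is a continuous angle of the chord from g a to g b; sigma is the odd
   multiple of PI gained when the two ends are exchanged. *)
Record lifted_angle (g : R -> pt) (L : R) (phi : R -> R -> R) (sigma : R) : Prop := {
  la_dir : forall a b, a < b < a + L -> dir (phi a b) (vsub (g b) (g a));
  la_snd : forall a x y, a < x -> y < a + L -> cont_on (phi a) x y;
  la_fst : forall b x y, b - L < x -> y < b -> cont_on (fun a => phi a b) x y;
  la_swap : forall a b, a < b < a + L -> phi b (a + L) = phi a b + sigma;
  la_cos : cos sigma = -1 }.

Lemma cos_diff_1 (x y : R) : cos x = -1 -> cos y = -1 -> cos (x - y) = 1.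
Proof.
  intros Hx Hy. rewrite cos_minus, Hx, Hy.
  pose proof (sin2_cos2 x) as P1. pose proof (sin2_cos2 y) as P2.
  rewrite Hx in P1. rewrite Hy in P2. unfold Rsqr in *.
  assert (sin x = 0) by nra. rewrite H. ring.
Qed.

Lemma const_of_cos (f : R -> R) (x y : R) :
  x <= y -> cont_on f x y -> (forall s, x <= s <= y -> cos (f s) = -1) -> f x = f y.
Proof.
  intros Hxy Hf Hc.
  destruct (cos_1_const (fun s => f s - f x) x y Hxy) as [H1 _].
  - apply (cont_on_plus f (fun _ => - f x)); auto. apply cont_on_const.
  - intros s Hs. apply cos_diff_1; apply Hc; lra.
  - assert (f y - f x = 0) by (apply H1; ring). lra.
Qed.

(** Exchanging the ends reverses the chord, so [phi b (a + L) - phi a b] is an odd multiple of PI.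
    It depends continuously on each end, hence it is one constant [sigma] on the connected strip a <
    b < a + L. *)
Lemma lifted_angle_exists (g : R -> pt) (L : R) (tp tm : R -> pt) :
  pl_loop g L tp tm -> exists phi sigma, lifted_angle g L phi sigma.
Proof.
  intros HL. pose proof (pl_pos _ _ _ _ HL) as HLp.
  destruct (angle_family_exists g L tp tm HL) as (A0 & phi & HA & Hbase & Hphi).
  pose proof (angle_family_near g L tp tm HL A0 phi HA Hbase Hphi) as Hnear.
  assert (Hdir : forall a b, a < b < a + L -> dir (phi a b) (vsub (g b) (g a))).
  { intros a b Hb. destruct (Hphi a b b) as [_ D0]; try lra. apply D0. lra. }
  assert (Hsnd : forall a x y, a < x -> y < a + L -> cont_on (phi a) x y).
  { intros a x y H1 H2. destruct (Rle_dec x y).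
    - destruct (Hphi a x y); auto.
    - intros q Hq. lra. }
  assert (Hfst : forall b x y, b - L < x -> y < b -> cont_on (fun a => phi a b) x y).
  { intros b x y H1 H2 q Hq eps He.
    destruct (Hnear q b) as [r [Hr Hn]]; [lra|].
    set (G := fun a' => vsub (g b) (g a')).
    assert (CG : continuous_path G).
    { apply continuous_path_vsub; [apply continuous_path_const|apply (loop_continuous g L tp tm HL)]. }
    assert (CT : continuity_pt (fun a' => turn (vsub (g b) (g q)) (G a')) q).
    { apply (continuity_pt_turn (fun _ => vsub (g b) (g q)) G); auto.
      - apply continuous_path_const.
      - apply (loop_neq g L tp tm HL). lra. }
    destruct (CT eps He) as [d [Hd Hc]].
    exists (Rmin r d). split; [apply Rmin_pos; auto|]. intros q' _ Hq'.
    pose proof (Rmin_l r d). pose proof (Rmin_r r d).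
    destruct (Hn q') as [_ ->]; [lra|].
    destruct (Req_dec q q') as [<-|Hne].
    - rewrite turn_same. replace (phi q b + 0 - phi q b) with 0 by ring. rewrite Rabs_R0. auto.
    - specialize (Hc q'). simpl in Hc. unfold R_dist, G in Hc. rewrite turn_same in Hc.
      match goal with |- Rabs (?p + ?t - ?p) < _ => replace (p + t - p) with (t - 0) by ring end.
      apply Hc. split; [split; [exact I|auto]|lra]. }
  assert (Hcos : forall a b, a < b < a + L -> cos (phi b (a + L) - phi a b) = -1).
  { intros a b Hb. apply (dir_opp _ _ (vsub (g (a + L)) (g b)) (vsub (g b) (g a))).
    - apply Hdir. lra.
    - apply Hdir. lra.
    - rewrite (pl_per _ _ _ _ HL). apply pt_eq; vec; ring. }
  assert (Kb : forall a b b', a < b <= b' -> b' < a + L ->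
     phi b (a + L) - phi a b = phi b' (a + L) - phi a b').
  { intros a b b' Hb Hb'. apply (const_of_cos (fun s => phi s (a + L) - phi a s)); try lra.
    - apply (cont_on_plus (fun s => phi s (a + L)) (fun s => - phi a s)).
      + apply Hfst; lra.
      + apply cont_on_opp. apply Hsnd; lra.
    - intros s Hs. apply Hcos. lra. }
  assert (Ka : forall a a' b, b - L < a -> a <= a' < b ->
     phi b (a + L) - phi a b = phi b (a' + L) - phi a' b).
  { intros a a' b Ha Ha'. apply (const_of_cos (fun s => phi b (s + L) - phi s b)); try lra.
    - apply (cont_on_plus (fun s => phi b (s + L)) (fun s => - phi s b)).
      + apply (cont_on_shift (phi b) L). apply Hsnd; lra.
      + apply cont_on_opp. apply Hfst; lra.
    - intros s Hs. apply Hcos. lra. }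
  set (S0 := fun a => phi (a + L / 2) (a + L) - phi a (a + L / 2)).
  assert (KS : forall a b, a < b < a + L -> phi b (a + L) - phi a b = S0 a).
  { intros a b Hb. unfold S0. destruct (Rle_dec b (a + L / 2)).
    - apply Kb; lra.
    - symmetry. apply Kb; lra. }
  assert (Kst : forall a a', a <= a' < a + L -> S0 a = S0 a').
  (* This b is admissible for both a and a', which works only over distances below L; arbitrary
     distances follow by connectedness. *)
  { intros a a' H. set (b := (a' + (a + L)) / 2).
    rewrite <- (KS a b) by (unfold b; lra). rewrite <- (KS a' b) by (unfold b; lra).
    apply Ka; unfold b; lra. }
  assert (Kall : forall x y, x <= y -> S0 x = S0 y).
  { intros x y Hxy.
    assert (H : S0 x = S0 x <-> S0 y = S0 x).
    { apply (clopen_interval (fun a => S0 a = S0 x) x y Hxy).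
      intros q Hq. exists L. split; auto. intros q' Hq' Hd. apply Rabs_def2 in Hd.
      destruct (Rle_dec q q').
      - rewrite (Kst q q') by lra. tauto.
      - rewrite (Kst q' q) by lra. tauto. }
    symmetry. tauto. }
  exists phi, (S0 0). split; auto.
  - intros a b Hb. pose proof (KS a b Hb).
    assert (S0 a = S0 0).
    { destruct (Rle_dec a 0); [apply Kall; auto|symmetry; apply Kall; lra]. }
    lra.
  - unfold S0. apply Hcos. lra.
Qed.

(** The odd multiple of PI is nonzero: for |s| < PI, cos (s / 2) > 0 and the double angle formula
    keep cos s above -1. *)
Lemma sigma_large (s : R) : cos s = -1 -> PI <= Rabs s.
Proof.
  intros H. apply Rnot_lt_le. intros Hs. apply Rabs_def2 in Hs.
  assert (0 < cos (s / 2)) by (apply cos_gt_0; lra).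
  assert (cos s = 2 * cos (s / 2) * cos (s / 2) - 1).
  { replace s with (2 * (s / 2)) at 1 by field. apply cos_2a_cos. }
  nra.
Qed.

(* ap and am are the limits of phi at the diagonal, from the right and from the left. *)
Record tangent_angles (L : R) (tp tm : R -> pt) (phi : R -> R -> R) (sigma : R)
    (ap am : R -> R) : Prop := {
  ta_phi : forall s, exists e, 0 < e /\ forall u1 u2, 0 <= u1 < u2 -> u2 <= e ->
    phi (s + u1) (s + u2) = ap s /\ phi (s - u2) (s - u1) = am s;
  ta_dirp : forall s, dir (ap s) (tp s);
  ta_dirm : forall s, dir (am s) (tm s);
  ta_near : forall s, exists e, 0 < e /\ forall u, 0 < u < e ->
    ap (s + u) = ap s /\ am (s + u) = ap s /\ ap (s - u) = am s /\ am (s - u) = am s;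
  ta_turn : forall s, Rabs (ap s - am s) < PI;
  ta_per : forall s, ap (s + L) = ap s + 2 * sigma /\ am (s + L) = am s + 2 * sigma }.

Lemma sum_sqr_eq_0 (a b : R) : a ^ 2 + b ^ 2 <= 0 -> a = 0 /\ b = 0.
Proof.
  intros H. pose proof (pow2_ge_0 a). pose proof (pow2_ge_0 b).
  split; apply Rsqr_0_uniq; unfold Rsqr; lra.
Qed.

Lemma unit_dir (a : R) (u : pt) : dir a u -> dot u u = 1 -> u = (cos a, sin a).
Proof.
  intros [r [Hr [H1 H2]]] Hu. vec. rewrite H1, H2 in Hu.
  pose proof (sin2_cos2 a) as P. unfold Rsqr in P.
  assert (r * r = 1) by (rewrite <- Hu; transitivity (r * r * (sin a * sin a + cos a * cos a)); [rewrite P|]; ring).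
  assert (r = 1) by nra. subst r. apply pt_eq; simpl; lra.
Qed.

Lemma unit_opposite (a b : R) (u v : pt) :
  dir a u -> dir b v -> dot u u = 1 -> dot v v = 1 -> cos (a - b) = -1 -> v = vscale (-1) u.
Proof.
  intros Hu Hv U1 U2 Hc.
  assert (Hu' : dir (b + PI) u).
  { apply (dir_shift a); auto.
    replace (b + PI - a) with (- (a - b) + PI) by ring. rewrite neg_cos, cos_neg, Hc. ring. }
  rewrite (unit_dir _ _ Hu' U1), (unit_dir _ _ Hv U2).
  rewrite neg_cos, neg_sin. apply pt_eq; simpl; ring.
Qed.

Lemma const_of_same_dir (f : R -> R) (h : R -> pt) (x y : R) (w : pt) :
  x <= y -> cont_on f x y -> (forall s, x <= s <= y -> dir (f s) (h s)) ->
  (forall s, x <= s <= y -> exists k, 0 < k /\ h s = vscale k w) -> f x = f y.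
Proof.
  intros Hxy Hf Hd Hw.
  destruct (cos_1_const (fun s => f s - f x) x y Hxy) as [H1 _].
  - apply (cont_on_plus f (fun _ => - f x)); auto. apply cont_on_const.
  - intros s Hs. destruct (Hw s Hs) as [k [Hk E]]. destruct (Hw x) as [k0 [Hk0 E0]]; [lra|].
    pose proof (Hd s Hs) as D1. pose proof (Hd x ltac:(lra)) as D2.
    apply (dir_unique _ _ (h s)); auto.
    replace (h s) with (vscale (k / k0) (h x)).
    + apply dir_scale; auto. apply Rdiv_lt_0_compat; auto.
    + rewrite E, E0. apply pt_eq; vec; field; lra.
  - assert (f y - f x = 0) by (apply H1; ring). lra.
Qed.

(** * Tangent angles as limits of chord angles *)

Section Tangent.
Variables (g : R -> pt) (L : R) (tp tm : R -> pt) (phi : R -> R -> R) (sigma : R).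
Hypothesis HL : pl_loop g L tp tm.
Hypothesis HP : lifted_angle g L phi sigma.

Lemma phi_const_on_piece (a b : R) (w : pt) :
  a < b < a + L -> (forall x y, a <= x < y -> y <= b -> exists k, 0 < k /\ vsub (g y) (g x) = vscale k w) ->
  forall x y, a <= x < y -> y <= b -> phi x y = phi a b.
Proof.
  intros Hb Hw x y Hx Hy.
  transitivity (phi a y).
  - destruct (Req_dec a x) as [->|Hne]; auto. symmetry.
    apply (const_of_same_dir (fun s => phi s y) (fun s => vsub (g y) (g s)) a x w); try lra.
    + apply (la_fst _ _ _ _ HP); lra.
    + intros s Hs. apply (la_dir _ _ _ _ HP). lra.
    + intros s Hs. apply Hw; lra.
  - apply (const_of_same_dir (phi a) (fun s => vsub (g s) (g a)) y b w); try lra.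
    + apply (la_snd _ _ _ _ HP); lra.
    + intros s Hs. apply (la_dir _ _ _ _ HP). lra.
    + intros s Hs. apply Hw; lra.
Qed.

Lemma tangent_angles_exist : exists ap am, tangent_angles L tp tm phi sigma ap am.
Proof.
  pose proof (pl_pos _ _ _ _ HL) as HLp.
  assert (Hloc : forall s, exists pq : R * R, exists e, 0 < e < L / 4 /\
    (forall u, 0 <= u <= e ->
     g (s + u) = vadd (g s) (vscale u (tp s)) /\ g (s - u) = vadd (g s) (vscale (- u) (tm s))) /\
    forall u1 u2, 0 <= u1 < u2 -> u2 <= e ->
    phi (s + u1) (s + u2) = fst pq /\ phi (s - u2) (s - u1) = snd pq).
  { intros s. destruct (loop_window g L tp tm HL s) as [e [He [H _]]].
    exists (phi s (s + e), phi (s - e) s), e. split; [auto|]. split; [auto|]. intros u1 u2 Hu He2. simpl.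
    split.
    - apply (phi_const_on_piece s (s + e) (tp s)); try lra.
      intros x y Hx Hy. exists (y - x). split; [lra|].
      destruct (H (x - s)) as [Ex _]; [lra|]. destruct (H (y - s)) as [Ey _]; [lra|].
      replace (s + (x - s)) with x in Ex by ring. replace (s + (y - s)) with y in Ey by ring.
      rewrite Ex, Ey. apply pt_eq; vec; ring.
    - apply (phi_const_on_piece (s - e) s (tm s)); try lra.
      intros x y Hx Hy. exists (y - x). split; [lra|].
      destruct (H (s - x)) as [_ Ex]; [lra|]. destruct (H (s - y)) as [_ Ey]; [lra|].
      replace (s - (s - x)) with x in Ex by ring. replace (s - (s - y)) with y in Ey by ring.
      rewrite Ex, Ey. apply pt_eq; vec; ring. }
  set (pq := fun s => proj1_sig (constructive_indefinite_description _ (Hloc s))).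
  assert (Hpq : forall s, exists e, 0 < e < L / 4 /\
    (forall u, 0 <= u <= e ->
     g (s + u) = vadd (g s) (vscale u (tp s)) /\ g (s - u) = vadd (g s) (vscale (- u) (tm s))) /\
    forall u1 u2, 0 <= u1 < u2 -> u2 <= e ->
    phi (s + u1) (s + u2) = fst (pq s) /\ phi (s - u2) (s - u1) = snd (pq s)).
  { intros s. exact (proj2_sig (constructive_indefinite_description _ (Hloc s))). }
  clearbody pq. clear Hloc.
  assert (Hdp : forall s, dir (fst (pq s)) (tp s)).
  { intros s. destruct (Hpq s) as [e [He [H1 H2]]].
    destruct (H2 0 e) as [E _]; [lra|lra|]. rewrite <- E.
    replace (tp s) with (vscale (/ e) (vsub (g (s + e)) (g (s + 0)))).
    - apply dir_scale; [apply Rinv_0_lt_compat; lra|]. apply (la_dir _ _ _ _ HP). lra.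
    - destruct (H1 e) as [-> _]; [lra|]. rewrite Rplus_0_r. apply pt_eq; vec; field; lra. }
  assert (Hdm : forall s, dir (snd (pq s)) (tm s)).
  { intros s. destruct (Hpq s) as [e [He [H1 H2]]].
    destruct (H2 0 e) as [_ E]; [lra|lra|]. rewrite <- E.
    replace (tm s) with (vscale (/ e) (vsub (g (s - 0)) (g (s - e)))).
    - apply dir_scale; [apply Rinv_0_lt_compat; lra|]. apply (la_dir _ _ _ _ HP). lra.
    - destruct (H1 e) as [_ ->]; [lra|]. rewrite Rminus_0_r. apply pt_eq; vec; field; lra. }
  exists (fun s => fst (pq s)), (fun s => snd (pq s)). split; auto.
  - intros s. destruct (Hpq s) as [e [He [_ H2]]]. exists e. split; [lra|auto].
  - intros s. destruct (Hpq s) as [e [He [_ H2]]]. exists e. split; [lra|]. intros u Hu.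
    destruct (Hpq (s + u)) as [e1 [He1 [_ H3]]]. destruct (Hpq (s - u)) as [e2 [He2 [_ H4]]].
    set (w := Rmin (Rmin e1 e2) (Rmin u (e - u))).
    assert (Hw : 0 < w) by (repeat apply Rmin_pos; lra).
    assert (w <= e1 /\ w <= e2 /\ w <= u /\ w <= e - u) as (W1 & W2 & W3 & W4).
    { unfold w. pose proof (Rmin_l (Rmin e1 e2) (Rmin u (e - u))).
      pose proof (Rmin_r (Rmin e1 e2) (Rmin u (e - u))).
      pose proof (Rmin_l e1 e2). pose proof (Rmin_r e1 e2).
      pose proof (Rmin_l u (e - u)). pose proof (Rmin_r u (e - u)). lra. }
    destruct (H3 0 w) as [A1 A2]; [lra|lra|]. destruct (H4 0 w) as [A3 A4]; [lra|lra|].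
    rewrite <- A1, <- A2, <- A3, <- A4.
    destruct (H2 u (u + w)) as [B1 B2]; [lra|lra|]. destruct (H2 (u - w) u) as [B3 B4]; [lra|lra|].
    repeat split.
    + rewrite <- B1. f_equal; ring.
    + rewrite <- B3. f_equal; ring.
    + rewrite <- B4. f_equal; ring.
    + rewrite <- B2. f_equal; ring.
  (* The chord from s - e to s + e has the direction of w = tp + tm. Sliding either of its ends to s
     keeps the scalar product with w nonnegative, so both tangent angles are within PI / 2 of its
     angle. A difference of exactly PI would make the tangents opposite. *)
  - intros s. destruct (Hpq s) as [e [He [H1 H2]]].
    destruct (H2 0 e) as [E1 E2]; [lra|lra|]. rewrite Rplus_0_r in E1. rewrite Rminus_0_r in E2.
    rewrite <- E1, <- E2. pose proof PI_RGT_0.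
    set (w := vadd (tp s) (tm s)).
    pose proof (pl_tp _ _ _ _ HL s) as U1. pose proof (pl_tm _ _ _ _ HL s) as U2.
    assert (Hw : 0 < 1 + dot (tp s) (tm s)).
    { destruct (Rle_dec (1 + dot (tp s) (tm s)) 0); [|lra]. exfalso.
      apply (tangents_not_opposite g L tp tm HL s).
      assert ((fst (tp s) + fst (tm s)) ^ 2 + (snd (tp s) + snd (tm s)) ^ 2 <= 0) by (vec; nra).
      destruct (sum_sqr_eq_0 _ _ H0) as [Z1 Z2].
      apply pt_eq; vec; lra. }
    assert (Dw : dir (phi (s - e) (s + e)) w).
    { replace w with (vscale (/ e) (vsub (g (s + e)) (g (s - e)))).
      - apply dir_scale; [apply Rinv_0_lt_compat; lra|]. apply (la_dir _ _ _ _ HP). lra.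
      - destruct (H1 e) as [-> ->]; [lra|]. unfold w. apply pt_eq; vec; field; lra. }
    assert (K1 : Rabs (phi s (s + e) - phi (s - e) (s + e)) <= PI / 2).
    { apply (sheet_const (fun a => phi a (s + e) - phi (s - e) (s + e)) (s - e) s); [lra| | |].
      - apply (cont_on_plus (fun a => phi a (s + e)) (fun _ => - phi (s - e) (s + e))).
        + apply (la_fst _ _ _ _ HP); lra.
        + apply cont_on_const.
      - intros a Ha. apply (dir_dot_nonneg _ _ (vsub (g (s + e)) (g a)) w); auto.
        + apply (la_dir _ _ _ _ HP); lra.
        + destruct (H1 (s - a)) as [_ Ea]; [lra|]. replace (s - (s - a)) with a in Ea by ring.
          destruct (H1 e) as [-> _]; [lra|]. rewrite Ea.
          replace (dot _ w) with ((e + (s - a)) * (1 + dot (tp s) (tm s))).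
          * apply Rmult_le_pos; lra.
          * transitivity (e * (dot (tp s) (tp s) + dot (tp s) (tm s)) + (s - a) * (dot (tp s) (tm s) + dot (tm s) (tm s)));
              [rewrite U1, U2; ring|unfold w; vec; ring].
      - rewrite Rminus_diag, Rabs_R0. lra. }
    assert (K2 : Rabs (phi (s - e) s - phi (s - e) (s + e)) <= PI / 2).
    { apply (sheet_const (fun b => phi (s - e) b - phi (s - e) (s + e)) s (s + e)); [lra| | |].
      - apply (cont_on_plus (phi (s - e)) (fun _ => - phi (s - e) (s + e))).
        + apply (la_snd _ _ _ _ HP); lra.
        + apply cont_on_const.
      - intros b Hb. apply (dir_dot_nonneg _ _ (vsub (g b) (g (s - e))) w); auto.
        + apply (la_dir _ _ _ _ HP); lra.
        + destruct (H1 (b - s)) as [Eb _]; [lra|]. replace (s + (b - s)) with b in Eb by ring.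
          destruct (H1 e) as [_ ->]; [lra|]. rewrite Eb.
          replace (dot _ w) with ((e + (b - s)) * (1 + dot (tp s) (tm s))).
          * apply Rmult_le_pos; lra.
          * transitivity ((b - s) * (dot (tp s) (tp s) + dot (tp s) (tm s)) + e * (dot (tp s) (tm s) + dot (tm s) (tm s)));
              [rewrite U1, U2; ring|unfold w; vec; ring].
      - rewrite Rminus_diag, Rabs_R0. lra. }
    set (c := phi (s - e) (s + e)) in *.
    assert (Hle : Rabs (phi s (s + e) - phi (s - e) s) <= PI).
    { replace (phi s (s + e) - phi (s - e) s) with ((phi s (s + e) - c) + - (phi (s - e) s - c)) by ring.
      eapply Rle_trans; [apply Rabs_triang|]. rewrite Rabs_Ropp. lra. }
    destruct Hle as [Hlt|Heq]; auto. exfalso.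
    assert (Hcos : cos (phi s (s + e) - phi (s - e) s) = -1).
    { revert Heq. unfold Rabs. destruct (Rcase_abs _); intros Heq.
      - rewrite <- cos_neg, Heq. apply cos_PI.
      - rewrite Heq. apply cos_PI. }
    apply (tangents_not_opposite g L tp tm HL s).
    apply (unit_opposite (phi s (s + e)) (phi (s - e) s)); auto.
    + rewrite E1. apply Hdp.
    + rewrite E2. apply Hdm.
  - intros s.
    (* Two exchanges of the ends move the whole chord forward by one period. *)
    assert (Hs2 : forall a b, a < b < a + L -> phi (a + L) (b + L) = phi a b + 2 * sigma).
    { intros a b Hab. rewrite (la_swap _ _ _ _ HP b (a + L)) by lra.
      rewrite (la_swap _ _ _ _ HP a b) by lra. ring. }
    destruct (Hpq s) as [e1 [He1 [_ H1]]]. destruct (Hpq (s + L)) as [e2 [He2 [_ H2]]].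
    set (w := Rmin e1 e2). assert (Hw : 0 < w) by (apply Rmin_pos; lra).
    pose proof (Rmin_l e1 e2) as M1. pose proof (Rmin_r e1 e2) as M2. fold w in M1, M2.
    destruct (H1 0 w) as [A1 A2]; [lra|lra|]. destruct (H2 0 w) as [B1 B2]; [lra|lra|].
    rewrite <- A1, <- A2, <- B1, <- B2. split.
    + rewrite <- Hs2 by lra. f_equal; ring.
    + rewrite <- Hs2 by lra. f_equal; ring.
Qed.

(** The chords from [g v] point into an open half plane. If their angles differed by PI or more, the
    intermediate value theorem would give two opposite chords there. *)
Lemma angle_window (v : R) :
  (forall x, v < x < v + L -> dot (vsub (g x) (g v)) (g v) < 0) ->
  forall x y, v < x < v + L -> v < y < v + L -> Rabs (phi v x - phi v y) < PI.
Proof.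
  intros Hv. pose proof PI_RGT_0 as HPI.
  assert (K : forall x y, v < x < v + L -> v < y < v + L -> phi v x - phi v y < PI).
  { intros x y Hx Hy. apply Rnot_le_lt. intros Hge.
    assert (Hz : exists z, v < z < v + L /\ phi v z = phi v y + PI).
    { set (lo := Rmin x y). set (hi := Rmax x y).
      assert (Hlo : v < lo /\ lo <= hi /\ hi < v + L /\ lo <= x <= hi /\ lo <= y <= hi).
      { unfold lo, hi, Rmin, Rmax. destruct (Rle_dec x y); lra. }
      apply NNPP. intros Hn.
      assert (B : (phi v lo <= phi v y + PI) <-> (phi v hi <= phi v y + PI)).
      { apply (clopen_interval (fun s => phi v s <= phi v y + PI)); [lra|].
        intros q Hq.
        assert (Hne : phi v q <> phi v y + PI) by (intros E; apply Hn; exists q; split; auto; lra).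
        destruct (la_snd _ _ _ _ HP v lo hi) with (q := q) (eps := Rabs (phi v q - (phi v y + PI)))
          as [d [Hd Hc]]; try lra.
        { apply Rabs_pos_lt. lra. }
        exists d. split; auto. intros q' Hq' Hd'. specialize (Hc q' Hq' Hd').
        revert Hc. unfold Rabs.
        destruct (Rcase_abs (phi v q' - phi v q)); destruct (Rcase_abs (phi v q - (phi v y + PI)));
          intros; split; lra. }
      assert (Hxy : x <> y) by (intros ->; lra).
      unfold lo, hi, Rmin, Rmax in B. destruct (Rle_dec x y).
      - assert (phi v x <= phi v y + PI) by (apply B; lra).
        apply Hn. exists x. split; [auto|lra].
      - assert (phi v x <= phi v y + PI) by (apply B; lra).
        apply Hn. exists x. split; [auto|lra]. }
    destruct Hz as [z [Hz Ez]].
    destruct (dir_exists (g v)) as [eta Heta].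
    { destruct (Req_dec (fst (g v)) 0) as [E1|E1]; destruct (Req_dec (snd (g v)) 0) as [E2|E2]; vec; try nra.
      pose proof (Hv x Hx). vec. rewrite E1, E2 in *. lra. }
    destruct (dir_dot _ _ _ _ (la_dir _ _ _ _ HP v z Hz) Heta) as [k1 [Hk1 E1]].
    destruct (dir_dot _ _ _ _ (la_dir _ _ _ _ HP v y Hy) Heta) as [k2 [Hk2 E2]].
    pose proof (Hv z Hz) as V1. pose proof (Hv y Hy) as V2.
    rewrite E1, Ez in V1. rewrite E2 in V2.
    replace (phi v y + PI - eta) with (phi v y - eta + PI) in V1 by ring.
    rewrite neg_cos in V1. nra. }
  intros x y Hx Hy. apply Rabs_def1; [apply K; auto|]. pose proof (K y x Hy Hx). lra.
Qed.

End Tangent.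

(** At q the central sheets for [ap] and [am] are equivalent: a point within PI / 2 of one angle is
    within 3 PI / 2 of the other. To the right of q the tangent angles equal [ap q] and to the left
    [am q], so [sheet_const] applies on each side. *)
Lemma sheet_along_track (L : R) (tp tm : R -> pt) (phi : R -> R -> R) (sigma : R)
    (ap am : R -> R) (f : R -> R) (x y : R) :
  tangent_angles L tp tm phi sigma ap am ->
  x <= y -> cont_on f x y ->
  (forall q, x <= q <= y -> 0 <= cos (f q - ap q) /\ 0 <= cos (f q - am q)) ->
  (Rabs (f x - ap x) <= PI / 2 <-> Rabs (f y - ap y) <= PI / 2).
Proof.
  intros HT Hxy Hf Hc. pose proof PI_RGT_0 as HPI.
  assert (HV : forall q, x <= q <= y ->
    (Rabs (f q - ap q) <= PI / 2 <-> Rabs (f q - am q) <= PI / 2)).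
  { intros q Hq. destruct (Hc q Hq) as [H1 H2]. pose proof (ta_turn _ _ _ _ _ _ _ HT q) as Ht.
    split; intros H; apply cos_nonneg_small; auto.
    - replace (f q - am q) with ((f q - ap q) + (ap q - am q)) by ring.
      eapply Rle_lt_trans; [apply Rabs_triang|lra].
    - replace (f q - ap q) with ((f q - am q) + - (ap q - am q)) by ring.
      eapply Rle_lt_trans; [apply Rabs_triang|]. rewrite Rabs_Ropp. lra. }
  apply (clopen_interval (fun q => Rabs (f q - ap q) <= PI / 2) x y Hxy).
  intros q Hq. destruct (ta_near _ _ _ _ _ _ _ HT q) as [e [He Hn]].
  exists e. split; auto. intros q' Hq' Hd. apply Rabs_def2 in Hd.
  destruct (Rtotal_order q q') as [Hlt|[<-|Hgt]]; [|tauto|].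
  - symmetry.
    assert (Ea : forall w, q <= w <= q' -> ap w = ap q).
    { intros w Hw. destruct (Req_dec w q) as [->|Hne]; auto.
      replace w with (q + (w - q)) by ring. apply Hn. lra. }
    rewrite (Ea q') by lra.
    apply (sheet_const (fun w => f w - ap q)); [lra| |].
    + apply (cont_on_plus f (fun _ => - ap q)); [eapply cont_on_sub; eauto; lra|apply cont_on_const].
    + intros w Hw. rewrite <- (Ea w Hw). apply Hc. lra.
  - rewrite (HV q) by auto. rewrite (HV q') by auto.
    assert (Ea : forall w, q' <= w <= q -> am w = am q).
    { intros w Hw. destruct (Req_dec w q) as [->|Hne]; auto.
      replace w with (q - (q - w)) by ring. apply Hn. lra. }
    rewrite (Ea q') by lra.
    apply (sheet_const (fun w => f w - am q)); [lra| |].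
    + apply (cont_on_plus f (fun _ => - am q)); [eapply cont_on_sub; eauto; lra|apply cont_on_const].
    + intros w Hw. rewrite <- (Ea w Hw). apply Hc. lra.
Qed.

(** * Two opposite staircases cannot coexist *)

(** An interval with unordered ends, since a staircase may jump up or down. *)
Definition between (a b q : R) : Prop := Rmin a b <= q <= Rmax a b.

Lemma between_l (a b : R) : between a b a.
Proof. split; [apply Rmin_l|apply Rmax_l]. Qed.

Lemma between_r (a b : R) : between a b b.
Proof. split; [apply Rmin_r|apply Rmax_r]. Qed.

Lemma between_trans (a b p q r : R) :
  between a b p -> between a b q -> between p q r -> between a b r.
Proof.
  unfold between, Rmin, Rmax. destruct (Rle_dec a b), (Rle_dec p q); lra.
Qed.

Lemma nat_crossing (f : nat -> R) (t : R) (n : nat) :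
  f O <= t -> t < f n -> exists j, (S j <= n)%nat /\ f j <= t < f (S j).
Proof.
  intros H0. induction n as [|n IH]; intros Hn; [lra|].
  destruct (Rle_dec (f n) t) as [H|H].
  - exists n. split; [lia|lra].
  - destruct IH as [j [Hj K]]; [lra|]. exists j. split; [lia|auto].
Qed.

(** The parity of the number of true values. *)
Fixpoint xsum (f : nat -> bool) (n : nat) : bool :=
  match n with O => false | S k => xorb (xsum f k) (f k) end.

Lemma xsum_ext (f h : nat -> bool) (n : nat) :
  (forall i, (i < n)%nat -> f i = h i) -> xsum f n = xsum h n.
Proof.
  intros H. induction n as [|n IH]; simpl; auto.
  rewrite IH, H by (intros; auto with arith). reflexivity.
Qed.

Lemma xsum_telescope (f : nat -> bool) (n : nat) :
  xsum (fun i => xorb (f i) (f (S i))) n = xorb (f O) (f n).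
Proof.
  induction n as [|n IH]; simpl; [destruct (f O); auto|].
  rewrite IH. destruct (f O), (f n), (f (S n)); auto.
Qed.

Lemma xsum_xorb (f h : nat -> bool) (n : nat) :
  xsum (fun i => xorb (f i) (h i)) n = xorb (xsum f n) (xsum h n).
Proof.
  induction n as [|n IH]; simpl; auto. rewrite IH.
  destruct (xsum f n), (xsum h n), (f n), (h n); auto.
Qed.

Lemma xsum_false (n : nat) : xsum (fun _ => false) n = false.
Proof. induction n as [|n IH]; simpl; auto. rewrite IH. auto. Qed.

Lemma cos_add_odd (s x : R) : cos s = -1 -> cos (x + s) = - cos x.
Proof.
  intros H. pose proof (sin2_cos2 s) as P. rewrite H in P. unfold Rsqr in P.
  assert (sin s = 0) by nra. rewrite cos_plus, H, H0. ring.
Qed.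

(** The scalar products are half the one-sided derivatives at q of the squared distance to [g h]: to
    first order the distance does not grow in the upward direction. The weak inequalities allow the
    ends of a descent. *)
Definition ahead (g : R -> pt) (L : R) (tp tm : R -> pt) (h q : R) : Prop :=
  h < q < h + L /\ dot (vsub (g q) (g h)) (tp q) <= 0 /\ dot (vsub (g q) (g h)) (tm q) <= 0.

Definition behind (g : R -> pt) (L : R) (tp tm : R -> pt) (h q : R) : Prop :=
  h < q < h + L /\ 0 <= dot (vsub (g q) (g h)) (tp q) /\ 0 <= dot (vsub (g q) (g h)) (tm q).

(* d i serves all human positions in [x i, x (S i)]. *)
Record staircase (rel : R -> R -> Prop) (lo hi : R) (n : nat) (x d : nat -> R) : Prop := {
  st_pos : (0 < n)%nat;
  st_lo : x O = lo;
  st_hi : x n = hi;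
  st_inc : forall i, (i < n)%nat -> x i < x (S i);
  st_flat : forall i h, (i < n)%nat -> x i <= h <= x (S i) -> rel h (d i);
  st_jump : forall i q, (S i < n)%nat -> between (d i) (d (S i)) q -> rel (x (S i)) q }.

Lemma staircase_mono (rel : R -> R -> Prop) (lo hi : R) (n : nat) (x d : nat -> R) :
  staircase rel lo hi n x d ->
  forall i, (i < n)%nat -> lo <= x i /\ x i < hi.
Proof.
  intros H i Hi. split.
  - induction i as [|i IH]; [rewrite (st_lo _ _ _ _ _ _ H); lra|].
    pose proof (st_inc _ _ _ _ _ _ H i ltac:(lia)). pose proof (IH ltac:(lia)). lra.
  - assert (K : forall k, (i + S k <= n)%nat -> x i < x (i + S k)%nat).
    { induction k as [|k IHk]; intros Hk.
      - replace (i + 1)%nat with (S i) by lia. apply (st_inc _ _ _ _ _ _ H). lia.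
      - pose proof (IHk ltac:(lia)). pose proof (st_inc _ _ _ _ _ _ H (i + S k)%nat ltac:(lia)).
        replace (i + S (S k))%nat with (S (i + S k)) by lia. lra. }
    rewrite <- (st_hi _ _ _ _ _ _ H).
    replace n with (i + S (n - S i))%nat by lia. apply K. lia.
Qed.

(** * Sheets along the staircases and the parity argument *)

Section NoTrap.
Variables (g : R -> pt) (L : R) (tp tm : R -> pt).
Hypothesis HL : pl_loop g L tp tm.
Variable v : R.
Hypothesis Hv : forall x, v < x < v + L -> dot (vsub (g x) (g v)) (g v) < 0.

Variables (phi : R -> R -> R) (sigma : R) (ap am : R -> R).
Hypothesis HP : lifted_angle g L phi sigma.
Hypothesis HT : tangent_angles L tp tm phi sigma ap am.

Let Ahead := ahead g L tp tm.
Let Behind := behind g L tp tm.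

(** Seen from q, the chord to the human has angle [phi h q + sigma] and makes at most a right angle
    with both tangents. *)
Lemma ahead_cos (h q : R) : Ahead h q ->
  0 <= cos (phi h q + sigma - ap q) /\ 0 <= cos (phi h q + sigma - am q).
Proof.
  intros [Hq [H1 H2]]. pose proof (la_cos _ _ _ _ HP) as Hs.
  pose proof (la_dir _ _ _ _ HP h q ltac:(lra)) as D.
  destruct (dir_dot _ _ _ _ D (ta_dirp _ _ _ _ _ _ _ HT q)) as [k1 [Hk1 E1]].
  destruct (dir_dot _ _ _ _ D (ta_dirm _ _ _ _ _ _ _ HT q)) as [k2 [Hk2 E2]].
  replace (phi h q + sigma - ap q) with (phi h q - ap q + sigma) by ring.
  replace (phi h q + sigma - am q) with (phi h q - am q + sigma) by ring.
  rewrite !cos_add_odd by auto. rewrite E1 in H1. rewrite E2 in H2. split; nra.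
Qed.

Lemma behind_cos (h q : R) : Behind h q ->
  0 <= cos (phi h q - ap q) /\ 0 <= cos (phi h q - am q).
Proof.
  intros [Hq [H1 H2]].
  pose proof (la_dir _ _ _ _ HP h q ltac:(lra)) as D.
  split.
  - apply (dir_dot_nonneg _ _ _ _ D (ta_dirp _ _ _ _ _ _ _ HT q)). auto.
  - apply (dir_dot_nonneg _ _ _ _ D (ta_dirm _ _ _ _ _ _ _ HT q)). auto.
Qed.

Let ahead_on_sheet (h q : R) : Prop := Rabs (phi h q + sigma - ap q) <= PI / 2.
Let behind_on_sheet (h q : R) : Prop := Rabs (phi h q - ap q) <= PI / 2.

Lemma shift_along_track (h k q1 q2 : R) :
  (forall q, between q1 q2 q -> h < q < h + L /\
     0 <= cos (phi h q + k - ap q) /\ 0 <= cos (phi h q + k - am q)) ->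
  (Rabs (phi h q1 + k - ap q1) <= PI / 2 <-> Rabs (phi h q2 + k - ap q2) <= PI / 2).
Proof.
  assert (K : forall a b, a <= b -> (forall q, a <= q <= b -> h < q < h + L /\
     0 <= cos (phi h q + k - ap q) /\ 0 <= cos (phi h q + k - am q)) ->
     (Rabs (phi h a + k - ap a) <= PI / 2 <-> Rabs (phi h b + k - ap b) <= PI / 2)).
  { intros a b Hab H.
    apply (sheet_along_track _ _ _ _ _ _ _ (fun q => phi h q + k) a b HT Hab).
    - apply (cont_on_plus (phi h) (fun _ => k)); [|apply cont_on_const].
      apply (la_snd _ _ _ _ HP); [apply (H a)|apply (H b)]; lra.
    - intros q Hq. apply H; auto. }
  intros H. unfold between, Rmin, Rmax in H. destruct (Rle_dec q1 q2).
  - apply K; auto.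
  - symmetry. apply K; auto; lra.
Qed.

Lemma shift_human (q k h1 h2 : R) :
  h1 <= h2 -> (forall h, h1 <= h <= h2 -> h < q < h + L /\ 0 <= cos (phi h q + k - ap q)) ->
  (Rabs (phi h1 q + k - ap q) <= PI / 2 <-> Rabs (phi h2 q + k - ap q) <= PI / 2).
Proof.
  intros Hh H.
  apply (sheet_const (fun h => phi h q + k - ap q)); auto.
  - apply (cont_on_plus (fun h => phi h q + k) (fun _ => - ap q)); [|apply cont_on_const].
    apply (cont_on_plus (fun h => phi h q) (fun _ => k)); [|apply cont_on_const].
    pose proof (H h1 ltac:(lra)). pose proof (H h2 ltac:(lra)).
    apply (la_fst _ _ _ _ HP); lra.
  - intros h Hh'. apply H; auto.
Qed.

(** After an exchange of ends, the chord and the tangent at v + L are both described by chords from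
    v, namely to h and to the nearby point v + u. By [angle_window] their angles differ by less than
    PI. *)
Lemma ahead_window_sheet (h : R) : Ahead h (v + L) -> ahead_on_sheet h (v + L).
Proof.
  intros H. pose proof PI_RGT_0. destruct (ahead_cos _ _ H) as [Hc _]. unfold ahead_on_sheet.
  apply cos_nonneg_small; auto.
  destruct H as [Hq _].
  destruct (ta_phi _ _ _ _ _ _ _ HT v) as [e [He Hphi]].
  pose proof (pl_pos _ _ _ _ HL).
  set (u := Rmin e (L / 2)). assert (0 < u) by (apply Rmin_pos; lra).
  pose proof (Rmin_l e (L / 2)) as M1. pose proof (Rmin_r e (L / 2)) as M2. fold u in M1, M2.
  destruct (Hphi 0 u) as [E _]; [lra|lra|]. rewrite Rplus_0_r in E.
  rewrite (la_swap _ _ _ _ HP v h) by lra. rewrite (proj1 (ta_per _ _ _ _ _ _ _ HT v)).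
  rewrite <- E.
  replace (phi v h + sigma + sigma - (phi v (v + u) + 2 * sigma)) with (phi v h - phi v (v + u)) by ring.
  eapply Rlt_trans; [apply (angle_window g L phi sigma HP v Hv); lra|lra].
Qed.

(** Here the nearby chord arrives at v from v - u, so the comparison is first with the left tangent;
    the turn at v, below PI, then carries it over to [ap]. *)
Lemma behind_window_sheet (h : R) : Behind h v -> behind_on_sheet h v.
Proof.
  intros H. pose proof PI_RGT_0. destruct (behind_cos _ _ H) as [Hc1 Hc2]. unfold behind_on_sheet.
  destruct H as [Hq _].
  destruct (ta_phi _ _ _ _ _ _ _ HT v) as [e [He Hphi]].
  pose proof (pl_pos _ _ _ _ HL).
  set (u := Rmin e (L / 2)). assert (0 < u) by (apply Rmin_pos; lra).
  pose proof (Rmin_l e (L / 2)) as M1. pose proof (Rmin_r e (L / 2)) as M2. fold u in M1, M2.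
  destruct (Hphi 0 u) as [_ E]; [lra|lra|]. rewrite Rminus_0_r in E.
  assert (K : Rabs (phi h v - am v) <= PI / 2).
  { apply cos_nonneg_small; auto.
    replace (phi h v - am v) with (phi v (h + L) - phi v (v - u + L)).
    - eapply Rlt_trans; [apply (angle_window g L phi sigma HP v Hv); lra|lra].
    - rewrite (la_swap _ _ _ _ HP h v) by lra. rewrite (la_swap _ _ _ _ HP (v - u) v) by lra.
      rewrite E. ring. }
  apply cos_nonneg_small; auto.
  pose proof (ta_turn _ _ _ _ _ _ _ HT v).
  replace (phi h v - ap v) with ((phi h v - am v) + - (ap v - am v)) by ring.
  eapply Rle_lt_trans; [apply Rabs_triang|]. rewrite Rabs_Ropp. lra.
Qed.

Variables (nA nB : nat) (x d y c : nat -> R).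
Hypothesis SA : staircase Behind (v - L) v nA x d.
Hypothesis SB : staircase Ahead v (v + L) nB y c.
Hypothesis Hcd : c O < d (nA - 1)%nat.

(** The steps start below v + L and end above it, being ahead of the human at v and at v + L. So
    some jump passes v + L, where the sheet is known, and it is transported back along the
    staircase. *)
Lemma ahead_sheet : ahead_on_sheet v (c O).
Proof.
  pose proof (st_pos _ _ _ _ _ _ SB) as Hn.
  assert (Step : forall j, (S j < nB)%nat -> (ahead_on_sheet (y j) (c j) <-> ahead_on_sheet (y (S j)) (c (S j)))).
  { intros j Hj. transitivity (ahead_on_sheet (y (S j)) (c j)).
    - apply shift_human.
      + pose proof (st_inc _ _ _ _ _ _ SB j ltac:(lia)). lra.
      + intros h Hh. pose proof (st_flat _ _ _ _ _ _ SB j h ltac:(lia) Hh) as Hr.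
        split; [apply Hr|apply ahead_cos; auto].
    - apply shift_along_track. intros q Hq.
      pose proof (st_jump _ _ _ _ _ _ SB j q Hj Hq) as Hr. split; [apply Hr|apply ahead_cos; auto]. }
  assert (All : forall j, (j < nB)%nat -> (ahead_on_sheet (y O) (c O) <-> ahead_on_sheet (y j) (c j))).
  { induction j as [|j IH]; intros Hj; [tauto|].
    rewrite IH by lia. apply Step. auto. }
  rewrite <- (st_lo _ _ _ _ _ _ SB) at 1.
  destruct (nat_crossing c (v + L) (nB - 1)) as [j [Hj Hc]].
  { pose proof (st_flat _ _ _ _ _ _ SB O v Hn) as [Hr _].
    - pose proof (st_inc _ _ _ _ _ _ SB O Hn). rewrite (st_lo _ _ _ _ _ _ SB) in *. lra.
    - lra. }
  { destruct (st_flat _ _ _ _ _ _ SB (nB - 1)%nat (v + L) ltac:(lia)) as [Hr _].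
    - pose proof (st_inc _ _ _ _ _ _ SB (nB - 1)%nat ltac:(lia)) as Hi.
      replace (S (nB - 1)) with nB in * by lia. rewrite (st_hi _ _ _ _ _ _ SB) in *. lra.
    - lra. }
  apply (All (S j)); [lia|].
  assert (Hb : between (c j) (c (S j)) (v + L)).
  { unfold between. rewrite Rmin_left, Rmax_right; lra. }
  apply (shift_along_track (y (S j)) sigma (v + L) (c (S j))).
  - intros q Hq.
    assert (Hq' : between (c j) (c (S j)) q) by (eapply between_trans; [exact Hb|apply between_r|exact Hq]).
    pose proof (st_jump _ _ _ _ _ _ SB j q ltac:(lia) Hq') as Hr. split; [apply Hr|apply ahead_cos; auto].
  - apply ahead_window_sheet. apply (st_jump _ _ _ _ _ _ SB j); auto. lia.
Qed.

(** Now some jump passes v, and the sheet known there is transported forward to the end of the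
    staircase, where the human is at v. *)
Lemma behind_sheet : behind_on_sheet v (d (nA - 1)%nat).
Proof.
  pose proof (st_pos _ _ _ _ _ _ SA) as Hn.
  assert (E0 : forall h q, behind_on_sheet h q <-> Rabs (phi h q + 0 - ap q) <= PI / 2).
  { intros h q. unfold behind_on_sheet. rewrite Rplus_0_r. tauto. }
  assert (B0 : forall h q, Behind h q -> h < q < h + L /\ 0 <= cos (phi h q + 0 - ap q) /\ 0 <= cos (phi h q + 0 - am q)).
  { intros h q Hr. rewrite Rplus_0_r. split; [apply Hr|apply behind_cos; auto]. }
  assert (Flat : forall i, (i < nA)%nat -> (behind_on_sheet (x i) (d i) <-> behind_on_sheet (x (S i)) (d i))).
  { intros i Hi. rewrite !E0. apply shift_human.
    - pose proof (st_inc _ _ _ _ _ _ SA i ltac:(lia)). lra.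
    - intros h Hh. destruct (B0 h (d i)) as [K1 [K2 _]]; auto.
      apply (st_flat _ _ _ _ _ _ SA i h); auto. }
  assert (Jump : forall i q1 q2, (S i < nA)%nat -> between (d i) (d (S i)) q1 -> between (d i) (d (S i)) q2 ->
     (behind_on_sheet (x (S i)) q1 <-> behind_on_sheet (x (S i)) q2)).
  { intros i q1 q2 Hi H1 H2. rewrite !E0. apply shift_along_track. intros q Hq. apply B0.
    apply (st_jump _ _ _ _ _ _ SA i); auto. eapply between_trans; [exact H1|exact H2|exact Hq]. }
  assert (All : forall k i, (i + k < nA)%nat -> (behind_on_sheet (x i) (d i) <-> behind_on_sheet (x (i + k)%nat) (d (i + k)%nat))).
  { induction k as [|k IH]; intros i Hi; [rewrite Nat.add_0_r; tauto|].
    rewrite (IH i) by lia. replace (i + S k)%nat with (S (i + k)) in * by lia.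
    rewrite Flat by lia. apply Jump; auto; [apply between_l|apply between_r]. }
  destruct (nat_crossing d v (nA - 1)) as [i [Hi Hc]].
  { destruct (st_flat _ _ _ _ _ _ SA O (v - L) Hn) as [Hr _]; [|lra].
    pose proof (st_inc _ _ _ _ _ _ SA O Hn). rewrite (st_lo _ _ _ _ _ _ SA) in *. lra. }
  { destruct (st_flat _ _ _ _ _ _ SA (nA - 1)%nat v ltac:(lia)) as [Hr _]; [|lra].
    pose proof (st_inc _ _ _ _ _ _ SA (nA - 1)%nat ltac:(lia)) as Hi.
    replace (S (nA - 1)) with nA in * by lia. rewrite (st_hi _ _ _ _ _ _ SA) in *. lra. }
  assert (Hb : between (d i) (d (S i)) v).
  { unfold between. rewrite Rmin_left, Rmax_right; lra. }
  assert (K : behind_on_sheet (x (S i)) (d (S i))).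
  { apply (Jump i v); auto; [lia|apply between_r|].
    apply behind_window_sheet. apply (st_jump _ _ _ _ _ _ SA i); auto. lia. }
  rewrite (All (nA - 1 - S i)%nat (S i)) in K by lia.
  replace (S i + (nA - 1 - S i))%nat with (nA - 1)%nat in K by lia.
  rewrite Flat in K by lia. replace (S (nA - 1)) with nA in K by lia.
  rewrite (st_hi _ _ _ _ _ _ SA) in K. exact K.
Qed.

(* The lift 2 * sigma makes this true for b = v and false for a = v. *)
Let chord_on_sheet (a b q : R) : Prop := Rabs (phi a b + 2 * sigma - ap q) <= PI / 2.

(** Subtracting the two sign conditions cancels [g q] and leaves one on the chord from a to b
    against the tangents at q. The chord is admissible because b < q < a + L. *)
Lemma chord_cos (a b q : R) : a < b -> Behind a q -> Ahead b q ->
  a < b < a + L /\ 0 <= cos (phi a b + 2 * sigma - ap q) /\ 0 <= cos (phi a b + 2 * sigma - am q).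
Proof.
  intros Hab [Ha [A1 A2]] [Hb [B1 B2]]. split; [lra|].
  pose proof (la_dir _ _ _ _ HP a b ltac:(lra)) as D.
  assert (Hcos : forall z, cos (phi a b + 2 * sigma - z) = cos (phi a b - z)).
  { intros z. replace (phi a b + 2 * sigma - z) with (phi a b - z + sigma + sigma) by ring.
    rewrite !cos_add_odd by apply (la_cos _ _ _ _ HP). ring. }
  rewrite !Hcos.
  split.
  - apply (dir_dot_nonneg _ _ _ _ D (ta_dirp _ _ _ _ _ _ _ HT q)). vec; lra.
  - apply (dir_dot_nonneg _ _ _ _ D (ta_dirm _ _ _ _ _ _ _ HT q)). vec; lra.
Qed.

Lemma chord_corner (a b q1 q2 : R) : a < b ->
  (forall q, between q1 q2 q -> Behind a q /\ Ahead b q) -> (chord_on_sheet a b q1 <-> chord_on_sheet a b q2).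
Proof.
  intros Hab H.
  assert (K : forall p r, p <= r -> (forall q, p <= q <= r -> Behind a q /\ Ahead b q) -> (chord_on_sheet a b p <-> chord_on_sheet a b r)).
  { intros p r Hpr H'.
    apply (sheet_along_track _ _ _ _ _ _ _ (fun _ => phi a b + 2 * sigma) p r HT Hpr).
    - apply cont_on_const.
    - intros q Hq. destruct (H' q Hq). apply chord_cos; auto. }
  unfold between, Rmin, Rmax in H. destruct (Rle_dec q1 q2).
  - apply K; auto.
  - symmetry. apply K; auto; lra.
Qed.

Lemma chord_move_snd (a b1 b2 q : R) : a < b1 -> b1 <= b2 -> Behind a q ->
  (forall b, b1 <= b <= b2 -> Ahead b q) -> (chord_on_sheet a b1 q <-> chord_on_sheet a b2 q).
Proof.
  intros Hab Hb Ha Hr.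
  apply (sheet_const (fun b => phi a b + 2 * sigma - ap q) b1 b2 Hb).
  - apply (cont_on_plus (fun b => phi a b + 2 * sigma) (fun _ => - ap q)); [|apply cont_on_const].
    apply (cont_on_plus (phi a) (fun _ => 2 * sigma)); [|apply cont_on_const].
    destruct (Hr b2 ltac:(lra)) as [K _]. destruct Ha as [K2 _].
    apply (la_snd _ _ _ _ HP); lra.
  - intros b Hb'. apply chord_cos; auto. lra.
Qed.

Lemma chord_move_fst (a1 a2 b q : R) : a2 < b -> a1 <= a2 -> Ahead b q ->
  (forall a, a1 <= a <= a2 -> Behind a q) -> (chord_on_sheet a1 b q <-> chord_on_sheet a2 b q).
Proof.
  intros Hab Ha Hb Hr.
  apply (sheet_const (fun a => phi a b + 2 * sigma - ap q) a1 a2 Ha).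
  - apply (cont_on_plus (fun a => phi a b + 2 * sigma) (fun _ => - ap q)); [|apply cont_on_const].
    apply (cont_on_plus (fun a => phi a b) (fun _ => 2 * sigma)); [|apply cont_on_const].
    destruct (Hr a1 ltac:(lra)) as [K _]. destruct Hb as [K2 _].
    apply (la_fst _ _ _ _ HP); lra.
  - intros a Ha'. apply chord_cos; auto. lra.
Qed.

(** [phi a v + sigma] is the angle of the chord from v to a + L, less than PI away from [phi v q];
    the sheet of q adds at most PI / 2, so the total stays below 3 PI / 2. *)
Lemma chord_from_hull (a q : R) : a < v -> Behind a q -> Ahead v q -> ahead_on_sheet v q -> chord_on_sheet a v q.
Proof.
  intros Hav Ha Hb HC. pose proof PI_RGT_0.
  destruct (chord_cos a v q Hav Ha Hb) as [Hr [Hc _]]. unfold chord_on_sheet.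
  apply cos_nonneg_small; auto.
  destruct Hb as [Hb _]. destruct Ha as [Ha _].
  pose proof (angle_window g L phi sigma HP v Hv (a + L) q ltac:(lra) ltac:(lra)) as W.
  rewrite (la_swap _ _ _ _ HP a v) in W by lra. unfold ahead_on_sheet in HC.
  replace (phi a v + 2 * sigma - ap q) with ((phi a v + sigma - phi v q) + (phi v q + sigma - ap q)) by ring.
  eapply Rle_lt_trans; [apply Rabs_triang|lra].
Qed.

(** Otherwise |2 sigma| < PI/2 + PI + PI/2, against [sigma_large]. *)
Lemma chord_to_hull (b q : R) : v < b -> Behind v q -> Ahead b q -> behind_on_sheet v q -> ~ chord_on_sheet v b q.
Proof.
  intros Hvb Ha Hb HB HTy. pose proof PI_RGT_0.
  destruct Hb as [Hb _]. destruct Ha as [Ha _].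
  pose proof (angle_window g L phi sigma HP v Hv b q ltac:(lra) ltac:(lra)) as W.
  unfold behind_on_sheet in HB. unfold chord_on_sheet in HTy.
  pose proof (sigma_large _ (la_cos _ _ _ _ HP)) as Hs.
  assert (K : Rabs (2 * sigma) < 2 * PI).
  { replace (2 * sigma) with ((phi v b + 2 * sigma - ap q) + - ((phi v b - phi v q) + (phi v q - ap q))) by ring.
    pose proof (Rabs_triang (phi v b + 2 * sigma - ap q) (- ((phi v b - phi v q) + (phi v q - ap q)))) as T1.
    rewrite Rabs_Ropp in T1.
    pose proof (Rabs_triang (phi v b - phi v q) (phi v q - ap q)) as T2. lra. }
  rewrite Rabs_mult, (Rabs_pos_eq 2) in K by lra. lra.
Qed.

Let chord_on_sheet_b (a b q : R) : bool := if excluded_middle_informative (chord_on_sheet a b q) then true else false.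

Lemma tyb_iff (a b q a' b' q' : R) : (chord_on_sheet a b q <-> chord_on_sheet a' b' q') -> chord_on_sheet_b a b q = chord_on_sheet_b a' b' q'.
Proof.
  intros H. unfold chord_on_sheet_b. destruct (excluded_middle_informative _), (excluded_middle_informative _); tauto.
Qed.

Let below (i j : nat) : bool := if Rlt_dec (c j) (d i) then true else false.

Lemma below_change_fst (i j : nat) : xorb (below i j) (below (S i) j) = true -> between (d i) (d (S i)) (c j).
Proof.
  unfold below, between, Rmin, Rmax.
  destruct (Rlt_dec (c j) (d i)), (Rlt_dec (c j) (d (S i))), (Rle_dec (d i) (d (S i)));
    simpl; intros H; try discriminate H; lra.
Qed.

Lemma below_change_snd (i j : nat) : xorb (below i j) (below i (S j)) = true -> between (c j) (c (S j)) (d i).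
Proof.
  unfold below, between, Rmin, Rmax.
  destruct (Rlt_dec (c j) (d i)), (Rlt_dec (c (S j)) (d i)), (Rle_dec (c j) (c (S j)));
    simpl; intros H; try discriminate H; lra.
Qed.

(** Grid edges where [below] changes, counted only if their chord is on the sheet. On such an edge
    one staircase jumps over a fixed step of the other, and that step ([c j] here, [d i] in
    [edge_snd]) is the point q. The jumping human stands at the jump, the other one at the start of
    the flat range of its step. *)
Let edge_fst (i j : nat) : bool := xorb (below i j) (below (S i) j) && chord_on_sheet_b (x (S i)) (y j) (c j).
Let edge_snd (j i : nat) : bool := xorb (below i j) (below i (S j)) && chord_on_sheet_b (x i) (y (S j)) (d i).

Lemma x_lt (i : nat) : (i < nA)%nat -> x i < v.
Proof. intros H. apply (staircase_mono _ _ _ _ _ _ SA i H). Qed.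

Lemma y_ge (j : nat) : (j < nB)%nat -> v <= y j.
Proof. intros H. apply (staircase_mono _ _ _ _ _ _ SB j H). Qed.

Lemma y_flat (j : nat) (b : R) : (j < nB)%nat -> y j <= b <= y (S j) -> Ahead b (c j).
Proof. intros. apply (st_flat _ _ _ _ _ _ SB j); auto. Qed.

Lemma x_flat (i : nat) (a : R) : (i < nA)%nat -> x i <= a <= x (S i) -> Behind a (d i).
Proof. intros. apply (st_flat _ _ _ _ _ _ SA i); auto. Qed.

(** Around a grid square [below] changes an even number of times. The crossing points of all changed
    edges lie in the intersection of the two jump intervals, which is an interval, and the humans
    can be moved along flat ranges to the common pair (a, b). So all these edges have the same sheet
    value. *)
Lemma corner_even (i j : nat) : (S i < nA)%nat -> (S j < nB)%nat ->
  xorb (xorb (edge_fst i j) (edge_fst i (S j))) (xorb (edge_snd j i) (edge_snd j (S i))) = false.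
Proof.
  intros Hi Hj.
  pose proof (x_lt (S i) Hi) as Xv. pose proof (y_ge (S j) Hj) as Yv.
  pose proof (st_inc _ _ _ _ _ _ SA i ltac:(lia)) as Xi. pose proof (st_inc _ _ _ _ _ _ SB j ltac:(lia)) as Yj.
  pose proof (y_ge j ltac:(lia)) as Yv0.
  set (a := x (S i)) in *. set (b := y (S j)) in *.
  set (good := fun q => between (d i) (d (S i)) q /\ between (c j) (c (S j)) q).
  assert (Hgood : forall q1 q2, good q1 -> good q2 -> chord_on_sheet_b a b q1 = chord_on_sheet_b a b q2).
  { intros q1 q2 [G1 G2] [G3 G4]. apply tyb_iff. apply chord_corner; [lra|].
    intros q Hq. split.
    - apply (st_jump _ _ _ _ _ _ SA i); auto. eapply between_trans; [exact G1|exact G3|exact Hq].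
    - apply (st_jump _ _ _ _ _ _ SB j); auto. eapply between_trans; [exact G2|exact G4|exact Hq]. }
  assert (E1 : xorb (below i j) (below (S i) j) = true -> good (c j) /\ chord_on_sheet_b a (y j) (c j) = chord_on_sheet_b a b (c j)).
  { intros H. apply below_change_fst in H. split; [split; [auto|apply between_l]|].
    apply tyb_iff. apply chord_move_snd; [lra|lra| |].
    - apply (st_jump _ _ _ _ _ _ SA i); auto.
    - intros b' Hb'. apply (y_flat j); [lia|exact Hb']. }
  assert (E2 : xorb (below i (S j)) (below (S i) (S j)) = true -> good (c (S j))).
  { intros H. apply below_change_fst in H. split; [auto|apply between_r]. }
  assert (E3 : xorb (below i j) (below i (S j)) = true -> good (d i) /\ chord_on_sheet_b (x i) b (d i) = chord_on_sheet_b a b (d i)).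
  { intros H. apply below_change_snd in H. split; [split; [apply between_l|auto]|].
    apply tyb_iff. apply chord_move_fst; [lra|lra| |].
    - apply (st_jump _ _ _ _ _ _ SB j); auto.
    - intros a' Ha'. apply (x_flat i); [lia|exact Ha']. }
  assert (E4 : xorb (below (S i) j) (below (S i) (S j)) = true -> good (d (S i))).
  { intros H. apply below_change_snd in H. split; [apply between_r|auto]. }
  (* Without a common point no edge changes, and the value of t is arbitrary. *)
  assert (T : exists t : bool, forall q, good q -> chord_on_sheet_b a b q = t).
  { destruct (classic (exists q, good q)) as [[q0 H0]|Hn].
    - exists (chord_on_sheet_b a b q0). intros q Hq. apply Hgood; auto.
    - exists true. intros q Hq. exfalso. apply Hn. exists q. auto. }
  destruct T as [t Ht].
  assert (R1 : edge_fst i j = xorb (below i j) (below (S i) j) && t).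
  { unfold edge_fst. fold a. destruct (xorb (below i j) (below (S i) j)) eqn:Ex; auto.
    destruct (E1 eq_refl) as [K1 K2]. rewrite K2, (Ht _ K1). auto. }
  assert (R2 : edge_fst i (S j) = xorb (below i (S j)) (below (S i) (S j)) && t).
  { unfold edge_fst. fold a b. destruct (xorb (below i (S j)) (below (S i) (S j))) eqn:Ex; auto.
    rewrite (Ht _ (E2 eq_refl)). auto. }
  assert (R3 : edge_snd j i = xorb (below i j) (below i (S j)) && t).
  { unfold edge_snd. fold b. destruct (xorb (below i j) (below i (S j))) eqn:Ex; auto.
    destruct (E3 eq_refl) as [K1 K2]. rewrite K2, (Ht _ K1). auto. }
  assert (R4 : edge_snd j (S i) = xorb (below (S i) j) (below (S i) (S j)) && t).
  { unfold edge_snd. fold a b. destruct (xorb (below (S i) j) (below (S i) (S j))) eqn:Ex; auto.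
    rewrite (Ht _ (E4 eq_refl)). auto. }
  rewrite R1, R2, R3, R4.
  destruct (below i j), (below (S i) j), (below i (S j)), (below (S i) (S j)), t; auto.
Qed.

(** The side i = 0 carries no changes: [d 0] < (v - L) + L <= [y j] < [c j]. *)
Lemma below_first (j : nat) : (j < nB)%nat -> below O j = false.
Proof.
  intros Hj. unfold below. destruct (Rlt_dec (c j) (d O)); auto. exfalso.
  pose proof (st_pos _ _ _ _ _ _ SA) as Hn. pose proof (st_inc _ _ _ _ _ _ SA O Hn) as Hi.
  pose proof (st_inc _ _ _ _ _ _ SB j Hj) as Hj2.
  destruct (x_flat O (x O) Hn) as [K1 _]; [lra|].
  destruct (y_flat j (y j) Hj) as [K2 _]; [lra|].
  pose proof (y_ge j Hj). rewrite (st_lo _ _ _ _ _ _ SA) in K1. lra.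
Qed.

(** The last row carries no changes: [d i] < [x i] + L < v + L < [c (nB - 1)]. *)
Lemma below_last (i : nat) : (i < nA)%nat -> below i (nB - 1) = false.
Proof.
  intros Hi. unfold below. destruct (Rlt_dec (c (nB - 1)%nat) (d i)); auto. exfalso.
  pose proof (st_pos _ _ _ _ _ _ SB) as Hn. pose proof (st_inc _ _ _ _ _ _ SB (nB - 1)%nat ltac:(lia)) as Hj.
  pose proof (st_inc _ _ _ _ _ _ SA i Hi) as Hi2.
  destruct (x_flat i (x i) Hi) as [K1 _]; [lra|].
  destruct (y_flat (nB - 1) (y (S (nB - 1)))) as [K2 _]; [lia|lra|].
  replace (S (nB - 1)) with nB in K2 by lia. rewrite (st_hi _ _ _ _ _ _ SB) in K2.
  pose proof (x_lt i Hi). lra.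
Qed.

(* In the grid of pairs (i, j), the edges where [below] changes form curves whose
   [chord_on_sheet] value is constant. The parity of the number of crossed edges
   with value true is the same in all rows j; it is odd in the first one, where
   b = v and c O < d (nA - 1), and the last row has no such edges. *)
Lemma staircases_absurd : False.
Proof.
  pose proof (st_pos _ _ _ _ _ _ SA) as HnA. pose proof (st_pos _ _ _ _ _ _ SB) as HnB.
  set (m := (nA - 1)%nat).
  set (V := fun j => xsum (fun i => edge_fst i j) m).
  assert (V0 : V O = true).
  { unfold V. rewrite (xsum_ext _ (fun i => xorb (below i O) (below (S i) O))).
    - rewrite (xsum_telescope (fun i => below i O)). rewrite below_first by auto.
      unfold below. destruct (Rlt_dec (c O) (d m)) as [|Hn]; auto.
    - intros i Hi. unfold edge_fst. destruct (xorb (below i O) (below (S i) O)) eqn:Ex; auto.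
      apply below_change_fst in Ex. simpl. unfold chord_on_sheet_b.
      destruct (excluded_middle_informative _) as [|Hn]; auto. exfalso. apply Hn.
      rewrite (st_lo _ _ _ _ _ _ SB). apply chord_from_hull.
      + apply x_lt. unfold m in Hi. lia.
      + apply (st_jump _ _ _ _ _ _ SA i); auto. unfold m in Hi. lia.
      + pose proof (st_inc _ _ _ _ _ _ SB O HnB). rewrite (st_lo _ _ _ _ _ _ SB) in *.
        apply (y_flat O); auto. rewrite (st_lo _ _ _ _ _ _ SB). lra.
      + apply ahead_sheet. }
  assert (Vstep : forall j, (S j < nB)%nat -> V j = V (S j)).
  { intros j Hj.
    assert (H : xsum (fun i => xorb (xorb (edge_fst i j) (edge_fst i (S j))) (xorb (edge_snd j i) (edge_snd j (S i)))) m = false).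
    { rewrite (xsum_ext _ (fun _ => false)); [apply xsum_false|].
      intros i Hi. apply corner_even; auto. unfold m in Hi. lia. }
    rewrite (xsum_xorb (fun i => xorb (edge_fst i j) (edge_fst i (S j)))) in H.
    rewrite (xsum_xorb (fun i => edge_fst i j)) in H.
    rewrite (xsum_telescope (edge_snd j)) in H.
    assert (F0 : edge_snd j O = false).
    { unfold edge_snd. rewrite !below_first by lia. auto. }
    (* [below] may change on the side i = m, but never with value true: the first human can be moved
       along the last flat range to a = v, where [chord_to_hull] applies. *)
    assert (Fm : edge_snd j m = false).
    { unfold edge_snd. destruct (xorb (below m j) (below m (S j))) eqn:Ex; auto.
      apply below_change_snd in Ex. simpl. unfold chord_on_sheet_b.
      destruct (excluded_middle_informative _) as [Hty|]; auto. exfalso. revert Hty.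
      pose proof (st_inc _ _ _ _ _ _ SA m ltac:(lia)) as Hm.
      assert (Sm : S m = nA) by (unfold m; lia).
      assert (Hvy : v < y (S j)).
      { pose proof (y_ge j ltac:(lia)). pose proof (st_inc _ _ _ _ _ _ SB j ltac:(lia)). lra. }
      assert (Hah : Ahead (y (S j)) (d m)) by (apply (st_jump _ _ _ _ _ _ SB j); auto).
      assert (Hbe : forall a, x m <= a <= v -> Behind a (d m)).
      { intros a Ha. apply x_flat; [lia|]. rewrite Sm, (st_hi _ _ _ _ _ _ SA). auto. }
      rewrite Sm, (st_hi _ _ _ _ _ _ SA) in Hm.
      rewrite (chord_move_fst (x m) v); auto; [|lra].
      apply chord_to_hull; auto.
      - apply Hbe. lra.
      - apply behind_sheet. }
    rewrite F0, Fm in H. unfold V. destruct (xsum (fun i => edge_fst i j) m), (xsum (fun i => edge_fst i (S j)) m);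
      simpl in H; try discriminate; auto. }
  assert (Vall : forall j, (j < nB)%nat -> V j = true).
  { induction j as [|j IH]; intros Hj; auto. rewrite <- Vstep by auto. apply IH. lia. }
  assert (Vlast : V (nB - 1)%nat = false).
  { unfold V. rewrite (xsum_ext _ (fun _ => false)); [apply xsum_false|].
    intros i Hi. unfold edge_fst. unfold m in Hi. rewrite !below_last by lia. auto. }
  rewrite Vall in Vlast by lia. discriminate.
Qed.

End NoTrap.

(** * Local minima of the distance to the human *)

(** The squared distance has the same local minima and descents as the distance, and it is a monic
    quadratic in arc length along each edge. *)
Definition d2 (g : R -> pt) (h y : R) : R := dot (vsub (g y) (g h)) (vsub (g y) (g h)).

Definition dec (f : R -> R) (x y : R) : Prop :=
  forall a b, x <= a -> a < b -> b <= y -> f b < f a.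

Lemma dec_trans (f : R -> R) (x y z : R) : dec f x y -> dec f y z -> dec f x z.
Proof.
  intros H1 H2 a b Ha Hab Hb.
  destruct (Rle_dec b y); [apply H1; auto|]. destruct (Rle_dec y a); [apply H2; lra|].
  apply (Rlt_trans _ (f y)); [apply H2; lra|apply H1; lra].
Qed.

Lemma dec_sub (f : R -> R) (x y x' y' : R) : dec f x y -> x <= x' -> y' <= y -> dec f x' y'.
Proof. intros H H1 H2 a b Ha Hab Hb. apply H; lra. Qed.

Lemma left_lim_unique (p s : R -> R) (T q : R) :
  0 < T -> left_lim p T q -> cont_on s 0 T -> (forall t, 0 <= t < T -> p t = s t) -> q = s T.
Proof.
  intros HT Hq Hs E. apply NNPP. intros Hne.
  set (eps := Rabs (q - s T) / 2).
  assert (He : 0 < eps) by (unfold eps; assert (0 < Rabs (q - s T)) by (apply Rabs_pos_lt; lra); lra).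
  destruct (Hq eps He) as [d1 [Hd1 H1]].
  destruct (Hs T) with (eps := eps) as [d2' [Hd2 H2]]; [lra|auto|].
  set (t := Rmax 0 (T - Rmin d1 d2' / 2)).
  pose proof (Rmin_l d1 d2'). pose proof (Rmin_r d1 d2').
  assert (0 < Rmin d1 d2') by (apply Rmin_pos; auto).
  assert (Ht : 0 <= t < T /\ T - d1 < t /\ T - d2' < t).
  { unfold t, Rmax. destruct (Rle_dec 0 (T - Rmin d1 d2' / 2)); lra. }
  specialize (H1 t ltac:(lra) ltac:(lra)). specialize (H2 t ltac:(lra)).
  rewrite E in H1 by lra.
  specialize (H2 ltac:(apply Rabs_def1; lra)).
  assert (Rabs (q - s T) <= Rabs (s t - q) + Rabs (s t - s T)).
  { replace (q - s T) with (- (s t - q) + (s t - s T)) by ring.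
    eapply Rle_trans; [apply Rabs_triang|]. rewrite Rabs_Ropp. lra. }
  unfold eps in *. lra.
Qed.

Lemma unit_dot_bound (u v : pt) : dot u u = 1 -> dot v v = 1 -> -1 <= dot u v <= 1.
Proof.
  intros Hu Hv.
  assert ((fst u * fst u + snd u * snd u) * (fst v * fst v + snd v * snd v) = 1).
  { vec. rewrite Hu, Hv. ring. }
  vec. pose proof (pow2_ge_0 (fst u * snd v - snd u * fst v)). split; nra.
Qed.

Lemma orthogonal_units (D u v : pt) :
  dot u u = 1 -> dot v v = 1 -> 0 < dot D D -> dot D u = 0 -> dot D v = 0 ->
  u = v \/ u = vscale (-1) v.
Proof.
  intros Hu Hv HD H1 H2.
  assert (Hc : cross u v = 0).
  { assert (dot D D * cross u v = 0).
    { transitivity (dot D u * cross D v - dot D v * cross D u); [vec; ring|]. rewrite H1, H2. ring. }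
    apply Rmult_integral in H. destruct H; auto. lra. }
  assert (Hd : dot u v * dot u v = 1).
  { transitivity (dot u u * dot v v - cross u v * cross u v); [vec; ring|]. rewrite Hu, Hv, Hc. ring. }
  assert (Eu : u = vscale (dot u v) v).
  { assert (u = (fst u * dot v v, snd u * dot v v)) as -> by (rewrite Hv; apply pt_eq; simpl; ring).
    apply pt_eq; vec.
    - transitivity (fst u * (fst v * fst v + snd v * snd v)); [ring|].
      rewrite Hv. nra.
    - transitivity (snd u * (fst v * fst v + snd v * snd v)); [ring|].
      rewrite Hv. nra. }
  assert (dot u v = 1 \/ dot u v = -1) as [E|E].
  { assert ((dot u v - 1) * (dot u v + 1) = 0) by nra.
    apply Rmult_integral in H. destruct H; [left|right]; lra. }
  - left. rewrite Eu, E. apply pt_eq; vec; ring.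
  - right. rewrite Eu at 1. rewrite E. reflexivity.
Qed.

(** * One-sided derivatives and branches of stable positions *)

Section Local.
Variables (g : R -> pt) (L : R) (tp tm : R -> pt).
Hypothesis HL : pl_loop g L tp tm.

Let Ap (h s : R) : R := dot (vsub (g s) (g h)) (tp s).
Let Am (h s : R) : R := dot (vsub (g s) (g h)) (tm s).

Definition window (s e : R) : Prop :=
  0 < e < L / 4 /\
  (forall u, 0 <= u <= e ->
     g (s + u) = vadd (g s) (vscale u (tp s)) /\ g (s - u) = vadd (g s) (vscale (- u) (tm s))) /\
  (forall u, 0 < u < e ->
     tp (s + u) = tp s /\ tm (s + u) = tp s /\ tp (s - u) = tm s /\ tm (s - u) = tm s).

Lemma window_small (s e0 : R) : 0 < e0 -> exists e, window s e /\ e <= e0.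
Proof.
  intros He0. destruct (loop_window g L tp tm HL s) as [e [He [H1 H2]]].
  exists (Rmin e e0). pose proof (Rmin_l e e0). pose proof (Rmin_r e e0).
  assert (0 < Rmin e e0) by (apply Rmin_pos; lra).
  split; [|lra]. repeat split; try lra.
  - apply H1; lra.
  - apply H1; lra.
  - apply H2; lra.
  - apply H2; lra.
  - apply H2; lra.
  - apply H2; lra.
Qed.

Lemma d2_right (h s e u : R) : window s e -> 0 <= u <= e ->
  d2 g h (s + u) = d2 g h s + 2 * u * Ap h s + u * u.
Proof.
  intros [_ [H _]] Hu. unfold d2, Ap. destruct (H u Hu) as [-> _].
  transitivity (dot (vsub (g s) (g h)) (vsub (g s) (g h)) + 2 * u * dot (vsub (g s) (g h)) (tp s)
     + u * u * dot (tp s) (tp s)); [vec; ring|]. rewrite (pl_tp _ _ _ _ HL). ring.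
Qed.

Lemma d2_left (h s e u : R) : window s e -> 0 <= u <= e ->
  d2 g h (s - u) = d2 g h s - 2 * u * Am h s + u * u.
Proof.
  intros [_ [H _]] Hu. unfold d2, Am. destruct (H u Hu) as [_ ->].
  transitivity (dot (vsub (g s) (g h)) (vsub (g s) (g h)) - 2 * u * dot (vsub (g s) (g h)) (tm s)
     + u * u * dot (tm s) (tm s)); [vec; ring|]. rewrite (pl_tm _ _ _ _ HL). ring.
Qed.

Lemma A_right (h s e u : R) : window s e -> 0 < u < e ->
  Ap h (s + u) = Ap h s + u /\ Am h (s + u) = Ap h s + u.
Proof.
  intros [_ [H1 H2]] Hu. unfold Ap, Am. destruct (H2 u Hu) as (-> & -> & _).
  destruct (H1 u ltac:(lra)) as [-> _].
  assert (E : dot (vsub (vadd (g s) (vscale u (tp s))) (g h)) (tp s) = dot (vsub (g s) (g h)) (tp s) + u).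
  { transitivity (dot (vsub (g s) (g h)) (tp s) + u * dot (tp s) (tp s)); [vec; ring|].
    rewrite (pl_tp _ _ _ _ HL). ring. }
  auto.
Qed.

Lemma A_left (h s e u : R) : window s e -> 0 < u < e ->
  Ap h (s - u) = Am h s - u /\ Am h (s - u) = Am h s - u.
Proof.
  intros [_ [H1 H2]] Hu. unfold Ap, Am. destruct (H2 u Hu) as (_ & _ & -> & ->).
  destruct (H1 u ltac:(lra)) as [_ ->].
  assert (E : dot (vsub (vadd (g s) (vscale (- u) (tm s))) (g h)) (tm s) = dot (vsub (g s) (g h)) (tm s) - u).
  { transitivity (dot (vsub (g s) (g h)) (tm s) - u * dot (tm s) (tm s)); [vec; ring|].
    rewrite (pl_tm _ _ _ _ HL). ring. }
  auto.
Qed.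

(** [Am] and [Ap] are half the left and right derivatives of the squared distance. The weak
    inequalities suffice because the quadratic term u^2 makes a critical point a minimum from that
    side. *)
Lemma locmin_iff (h s : R) : IsLocMin (d2 g h) s <-> Am h s <= 0 <= Ap h s.
Proof.
  destruct (window_small s 1 ltac:(lra)) as [e [HW _]].
  assert (He : 0 < e) by apply HW.
  split.
  - intros [eps [Heps H]]. split.
    + apply Rnot_lt_le. intros Hn.
      set (u := Rmin (Rmin e (eps / 2)) (Am h s)).
      assert (Hu : 0 < u) by (repeat apply Rmin_pos; lra).
      assert (u <= e /\ u <= eps / 2 /\ u <= Am h s) as (U1 & U2 & U3).
      { unfold u. pose proof (Rmin_l (Rmin e (eps / 2)) (Am h s)). pose proof (Rmin_r (Rmin e (eps / 2)) (Am h s)).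
        pose proof (Rmin_l e (eps / 2)). pose proof (Rmin_r e (eps / 2)). lra. }
      specialize (H (s - u)). rewrite (d2_left h s e u) in H by (auto; lra).
      assert (Rabs (s - u - s) < eps) by (apply Rabs_def1; lra). specialize (H H0). nra.
    + apply Rnot_lt_le. intros Hn.
      set (u := Rmin (Rmin e (eps / 2)) (- Ap h s)).
      assert (Hu : 0 < u) by (repeat apply Rmin_pos; lra).
      assert (u <= e /\ u <= eps / 2 /\ u <= - Ap h s) as (U1 & U2 & U3).
      { unfold u. pose proof (Rmin_l (Rmin e (eps / 2)) (- Ap h s)). pose proof (Rmin_r (Rmin e (eps / 2)) (- Ap h s)).
        pose proof (Rmin_l e (eps / 2)). pose proof (Rmin_r e (eps / 2)). lra. }
      specialize (H (s + u)). rewrite (d2_right h s e u) in H by (auto; lra).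
      assert (Rabs (s + u - s) < eps) by (apply Rabs_def1; lra). specialize (H H0). nra.
  - intros [H1 H2]. exists e. split; auto. intros y Hy. apply Rabs_def2 in Hy.
    destruct (Rle_dec s y).
    + replace y with (s + (y - s)) by ring. rewrite (d2_right h s e) by (auto; lra). nra.
    + replace y with (s - (s - y)) by ring. rewrite (d2_left h s e) by (auto; lra). nra.
Qed.

Lemma dec_right (h s e w : R) : window s e -> w <= e -> Ap h s + w <= 0 -> dec (d2 g h) s (s + w).
Proof.
  intros HW Hw H a b Ha Hab Hb.
  replace a with (s + (a - s)) by ring. replace b with (s + (b - s)) by ring.
  rewrite !(d2_right h s e) by (auto; lra).
  assert ((b - a) * (2 * Ap h s + (b - s) + (a - s)) < 0) by nra. nra.
Qed.

Lemma dec_left (h s e w1 w2 : R) : window s e -> 0 <= w1 -> w2 <= e -> Am h s <= w1 ->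
  dec (d2 g h) (s - w2) (s - w1).
Proof.
  intros HW Hw1 Hw2 H a b Ha Hab Hb.
  replace a with (s - (s - a)) by ring. replace b with (s - (s - b)) by ring.
  rewrite !(d2_left h s e) by (auto; lra).
  assert ((b - a) * (2 * Am h s - (s - b) - (s - a)) < 0) by nra. nra.
Qed.

Lemma dec_ahead (h c m : R) : dec (d2 g h) c m ->
  (forall q, c <= q < m -> Ap h q < 0) /\ (forall q, c < q <= m -> Am h q <= 0).
Proof.
  intros H. split; intros q Hq.
  - apply Rnot_le_lt. intros Hn. destruct (window_small q (m - q) ltac:(lra)) as [e [HW He]].
    assert (0 < e) by apply HW.
    pose proof (H q (q + e) ltac:(lra) ltac:(lra) ltac:(lra)) as K.
    rewrite (d2_right h q e) in K by (auto; lra). nra.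
  - apply Rnot_lt_le. intros Hn. destruct (window_small q (Rmin (q - c) (Am h q))) as [e [HW He]].
    { apply Rmin_pos; lra. }
    pose proof (Rmin_l (q - c) (Am h q)). pose proof (Rmin_r (q - c) (Am h q)).
    assert (0 < e) by apply HW.
    pose proof (H (q - e) q ltac:(lra) ltac:(lra) ltac:(lra)) as K.
    rewrite (d2_left h q e) in K by (auto; lra). nra.
Qed.

Lemma human_step (h sg : R) : sg = 1 \/ sg = -1 -> exists e th, 0 < e /\ dot th th = 1 /\
  forall u, 0 <= u <= e -> g (h + sg * u) = vadd (g h) (vscale u th).
Proof.
  intros Hsg. destruct (window_small h 1 ltac:(lra)) as [e [[He [H1 _]] _]].
  destruct Hsg as [-> | ->].
  - exists e, (tp h). split; [lra|]. split; [apply (pl_tp _ _ _ _ HL)|].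
    intros u Hu. destruct (H1 u Hu) as [E _]. rewrite <- E. f_equal. ring.
  - exists e, (vscale (-1) (tm h)). split; [lra|].
    split; [rewrite <- (pl_tm _ _ _ _ HL h); vec; ring|].
    intros u Hu. destruct (H1 u Hu) as [_ E].
    replace (h + -1 * u) with (h - u) by ring. rewrite E. apply pt_eq; vec; ring.
Qed.

Lemma A_human (h s : R) (th : pt) (h' u : R) : g h' = vadd (g h) (vscale u th) ->
  Ap h' s = Ap h s - u * dot th (tp s) /\ Am h' s = Am h s - u * dot th (tm s).
Proof. intros E. unfold Ap, Am. rewrite E. split; vec; ring. Qed.

(** While the human walks by u, the half derivatives at q change linearly to am(u) and ap(u). The
    minimum moves left by am(u) if this is positive, right by -ap(u) if ap(u) is negative, and stays
    at q otherwise. *)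
Lemma stable_branch (h q sg e0 : R) : sg = 1 \/ sg = -1 -> 0 < e0 ->
  IsLocMin (d2 g h) q -> g h <> g q ->
  exists e r s, 0 < e <= e0 /\ 0 < r /\ s 0 = q /\ cont_on s 0 r /\ window q e /\
    forall u, 0 <= u <= r -> q - e < s u < q + e /\ IsLocMin (d2 g (h + sg * u)) (s u) /\
      (forall y, q - e < y < q + e -> IsLocMin (d2 g (h + sg * u)) y -> y = s u) /\
      (forall c, q - e <= c -> dec (d2 g (h + sg * u)) c (s u)).
Proof.
  intros Hsg He0 Hmin Hne. apply locmin_iff in Hmin. destruct Hmin as [Hm Hp].
  destruct (window_small q e0 He0) as [e [HW He]].
  assert (Hepos : 0 < e) by apply HW.
  destruct (human_step h sg Hsg) as (eh & th & Heh & Hth & Hmove).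
  set (kp := dot th (tp q)). set (km := dot th (tm q)).
  assert (Bp : -1 <= kp <= 1) by (apply unit_dot_bound; auto; apply (pl_tp _ _ _ _ HL)).
  assert (Bm : -1 <= km <= 1) by (apply unit_dot_bound; auto; apply (pl_tm _ _ _ _ HL)).
  (* Both signs at once would make q a local maximum. For small u this needs both derivatives to
     vanish initially; then both tangents are orthogonal to the nonzero chord, hence equal, and so
     are the two rates. *)
  assert (Hexcl : exists r0, 0 < r0 /\ forall u, 0 <= u <= r0 -> ~ (0 < Am h q - u * km /\ Ap h q - u * kp < 0)).
  { destruct (Rlt_dec (Am h q) 0) as [H1|H1].
    - exists (- Am h q). split; [lra|]. intros u Hu [K _]. nra.
    - destruct (Rlt_dec 0 (Ap h q)) as [H2|H2].
      + exists (Ap h q). split; [lra|]. intros u Hu [_ K]. nra.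
      + exists 1. split; [lra|]. intros u Hu [K1 K2].
        assert (Am h q = 0) by lra. assert (Ap h q = 0) by lra.
        destruct (orthogonal_units (vsub (g q) (g h)) (tp q) (tm q)) as [E|E]; auto.
        * apply (pl_tp _ _ _ _ HL).
        * apply (pl_tm _ _ _ _ HL).
        * apply dot_vsub_pos. auto.
        * unfold kp, km in *. rewrite E in *. lra.
        * apply (tangents_not_opposite g L tp tm HL q). rewrite E. apply pt_eq; vec; ring. }
  destruct Hexcl as [r0 [Hr0 Hexcl]].
  set (r := Rmin (Rmin eh (e / 2)) r0).
  assert (Hr : 0 < r) by (repeat apply Rmin_pos; lra).
  assert (r <= eh /\ r <= e / 2 /\ r <= r0) as (R1 & R2 & R3).
  { unfold r. pose proof (Rmin_l (Rmin eh (e / 2)) r0). pose proof (Rmin_r (Rmin eh (e / 2)) r0).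
    pose proof (Rmin_l eh (e / 2)). pose proof (Rmin_r eh (e / 2)). lra. }
  set (am := fun u => Am h q - u * km). set (ap := fun u => Ap h q - u * kp).
  set (s := fun u => q - Rmax (am u) 0 - Rmin (ap u) 0).
  exists e, r, s. split; [lra|]. split; [auto|]. split.
  { unfold s, am, ap, Rmax, Rmin. destruct (Rle_dec (Am h q - 0 * km) 0), (Rle_dec (Ap h q - 0 * kp) 0); lra. }
  split.
  { intros u Hu eps Heps. exists (eps / 2). split; [lra|]. intros u' Hu' Hd.
    assert (Da : Rabs (am u' - am u) < eps / 2).
    { unfold am. replace (Am h q - u' * km - (Am h q - u * km)) with (- km * (u' - u)) by ring.
      rewrite Rabs_mult. assert (Rabs (- km) <= 1) by (apply Rabs_le; lra).
      pose proof (Rabs_pos (u' - u)). nra. }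
    assert (Db : Rabs (ap u' - ap u) < eps / 2).
    { unfold ap. replace (Ap h q - u' * kp - (Ap h q - u * kp)) with (- kp * (u' - u)) by ring.
      rewrite Rabs_mult. assert (Rabs (- kp) <= 1) by (apply Rabs_le; lra).
      pose proof (Rabs_pos (u' - u)). nra. }
    apply Rabs_def2 in Da. apply Rabs_def2 in Db. unfold s.
    apply Rabs_def1; unfold Rmax, Rmin;
      destruct (Rle_dec (am u') 0), (Rle_dec (ap u') 0), (Rle_dec (am u) 0), (Rle_dec (ap u) 0); lra. }
  split; [auto|].
  intros u Hu.
  destruct (A_human h q th (h + sg * u) u (Hmove u ltac:(lra))) as [EAp EAm].
  fold kp in EAp. fold km in EAm. fold (ap u) in EAp. fold (am u) in EAm.
  assert (Xa : am u <= u) by (unfold am; nra).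
  assert (Xb : - u <= ap u) by (unfold ap; nra).
  pose proof (Hexcl u ltac:(lra)) as Hex. fold (am u) (ap u) in Hex.
  set (h' := h + sg * u) in *.
  assert (Cases : (0 < am u /\ 0 <= ap u /\ s u = q - am u) \/ (am u <= 0 /\ 0 <= ap u /\ s u = q) \/
                  (am u <= 0 /\ ap u < 0 /\ s u = q - ap u)).
  { unfold s, Rmax, Rmin. destruct (Rle_dec (am u) 0), (Rle_dec (ap u) 0).
    - destruct (Req_dec (ap u) 0); [right; left|right; right]; repeat split; lra.
    - right; left; repeat split; lra.
    - left. repeat split; lra.
    - left. repeat split; lra. }
  assert (Loc : forall y, q - e < y < q + e -> (IsLocMin (d2 g h') y <->
    (y < q /\ am u = q - y) \/ (y = q /\ am u <= 0 <= ap u) \/ (q < y /\ ap u = q - y))).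
  { intros y Hy. rewrite locmin_iff.
    destruct (Rtotal_order y q) as [Hlt|[->|Hgt]].
    - destruct (A_left h' q e (q - y) HW) as [E1 E2]; [lra|].
      replace (q - (q - y)) with y in * by ring. rewrite E1, E2, EAm. split; intros; lra.
    - rewrite EAp, EAm. split; intros; lra.
    - destruct (A_right h' q e (y - q) HW) as [E1 E2]; [lra|].
      replace (q + (y - q)) with y in * by ring. rewrite E1, E2, EAp. split; intros; lra. }
  assert (Hs : q - e < s u < q + e) by (destruct Cases as [C|[C|C]]; lra).
  split; [auto|]. split; [|split].
  - apply Loc; auto. destruct Cases as [C|[C|C]]; lra.
  - intros y Hy Hly. apply Loc in Hly; auto. destruct Cases as [C|[C|C]]; lra.
  - intros c Hc. destruct Cases as [C|[C|C]].
    + destruct C as (C1 & C2 & ->).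
      apply (dec_sub _ (q - e) (q - am u)); [apply (dec_left h' q e); auto; lra|lra|lra].
    + destruct C as (C1 & C2 & ->).
      apply (dec_sub _ (q - e) (q - 0)); [apply (dec_left h' q e); auto; lra|lra|lra].
    + destruct C as (C1 & C2 & ->). apply (dec_sub _ (q - e) (q - ap u)); try lra.
      apply (dec_trans _ _ q).
      * replace q with (q - 0) at 2 by ring. apply (dec_left h' q e); auto; lra.
      * replace (q - ap u) with (q + - ap u) by ring. apply (dec_right h' q e); auto; lra.
Qed.

(** Near an unstable q with a downward slope to its right, stable positions can appear only on the
    left edge, and only if the left slope at q vanishes. They then move away from q linearly at the
    rate k, the component of the human's velocity along [tm q]. *)
Lemma fold_up_branch (h q sg e0 : R) : sg = 1 \/ sg = -1 -> 0 < e0 -> Ap h q < 0 ->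
  exists e r k, 0 < e <= e0 /\ 0 < r < e /\ -1 <= k <= 1 /\ window q e /\
    forall u, 0 <= u <= r ->
      (forall y, q - e < y < q + e ->
         (IsLocMin (d2 g (h + sg * u)) y <-> Am h q = 0 /\ y = q + u * k /\ u * k < 0)) /\
      (Am h q = 0 -> u * k <= 0 -> forall c, q - e <= c -> dec (d2 g (h + sg * u)) c (q + u * k)).
Proof.
  intros Hsg He0 Hp.
  (* A nonzero left slope must stay nonzero on the whole window; the value 1 is a placeholder for
     the zero slope. *)
  set (e1 := if Req_EM_T (Am h q) 0 then 1 else Rabs (Am h q)).
  assert (He1 : 0 < e1).
  { unfold e1. destruct (Req_EM_T (Am h q) 0); [lra|apply Rabs_pos_lt; auto]. }
  destruct (window_small q (Rmin e0 (Rmin (- Ap h q / 3) (e1 / 3)))) as [e [HW He]].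
  { repeat apply Rmin_pos; lra. }
  assert (e <= e0 /\ e <= - Ap h q / 3 /\ e <= e1 / 3) as (B1 & B2 & B3).
  { pose proof (Rmin_l e0 (Rmin (- Ap h q / 3) (e1 / 3))). pose proof (Rmin_r e0 (Rmin (- Ap h q / 3) (e1 / 3))).
    pose proof (Rmin_l (- Ap h q / 3) (e1 / 3)). pose proof (Rmin_r (- Ap h q / 3) (e1 / 3)). lra. }
  assert (Hepos : 0 < e) by apply HW.
  destruct (human_step h sg Hsg) as (eh & th & Heh & Hth & Hmove).
  set (kp := dot th (tp q)). set (km := dot th (tm q)).
  assert (Bp : -1 <= kp <= 1) by (apply unit_dot_bound; auto; apply (pl_tp _ _ _ _ HL)).
  assert (Bm : -1 <= km <= 1) by (apply unit_dot_bound; auto; apply (pl_tm _ _ _ _ HL)).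
  set (r := Rmin eh (e / 2)).
  assert (Hr : 0 < r) by (apply Rmin_pos; lra).
  assert (r <= eh /\ r <= e / 2) as (R1 & R2) by (split; [apply Rmin_l|apply Rmin_r]).
  exists e, r, km. split; [lra|]. split; [lra|]. split; [auto|]. split; [auto|].
  intros u Hu.
  destruct (A_human h q th (h + sg * u) u (Hmove u ltac:(lra))) as [EAp EAm].
  fold kp in EAp. fold km in EAm. set (h' := h + sg * u) in *.
  assert (Xk : - u <= u * km <= u) by nra. assert (Xp : Ap h' q <= Ap h q + u) by nra.
  split.
  - intros y Hy. rewrite locmin_iff.
    destruct (Rtotal_order y q) as [Hlt|[->|Hgt]].
    + destruct (A_left h' q e (q - y) HW) as [E1 E2]; [lra|].
      replace (q - (q - y)) with y in * by ring. rewrite E1, E2, EAm.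
      unfold e1 in B3. destruct (Req_EM_T (Am h q) 0) as [E|E].
      * rewrite E. split; intros H; [split; [auto|]|]; lra.
      * split; [|intros [H _]; lra]. intros H. exfalso.
        unfold Rabs in B3. destruct (Rcase_abs (Am h q)); lra.
    + split; intros; lra.
    + destruct (A_right h' q e (y - q) HW) as [E1 E2]; [lra|].
      replace (q + (y - q)) with y in * by ring. rewrite E1, E2. split; intros; lra.
  - intros HA Hk c Hc. apply (dec_sub _ (q - e) (q - - (u * km))); try lra.
    apply (dec_left h' q e); auto; lra.
Qed.

Lemma fold_down_branch (h q sg e0 : R) : sg = 1 \/ sg = -1 -> 0 < e0 -> 0 < Am h q -> 0 <= Ap h q ->
  exists e r k, 0 < e <= e0 /\ 0 < r < e /\ -1 <= k <= 1 /\
    forall u, 0 <= u <= r ->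
      forall y, q - e < y < q + e ->
         (IsLocMin (d2 g (h + sg * u)) y <-> Ap h q = 0 /\ y = q + u * k /\ 0 < u * k).
Proof.
  intros Hsg He0 Hm Hp.
  set (e1 := if Req_EM_T (Ap h q) 0 then 1 else Rabs (Ap h q)).
  assert (He1 : 0 < e1).
  { unfold e1. destruct (Req_EM_T (Ap h q) 0); [lra|apply Rabs_pos_lt; auto]. }
  destruct (window_small q (Rmin e0 (Rmin (Am h q / 3) (e1 / 3)))) as [e [HW He]].
  { repeat apply Rmin_pos; lra. }
  assert (e <= e0 /\ e <= Am h q / 3 /\ e <= e1 / 3) as (B1 & B2 & B3).
  { pose proof (Rmin_l e0 (Rmin (Am h q / 3) (e1 / 3))). pose proof (Rmin_r e0 (Rmin (Am h q / 3) (e1 / 3))).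
    pose proof (Rmin_l (Am h q / 3) (e1 / 3)). pose proof (Rmin_r (Am h q / 3) (e1 / 3)). lra. }
  assert (Hepos : 0 < e) by apply HW.
  destruct (human_step h sg Hsg) as (eh & th & Heh & Hth & Hmove).
  set (kp := dot th (tp q)). set (km := dot th (tm q)).
  assert (Bp : -1 <= kp <= 1) by (apply unit_dot_bound; auto; apply (pl_tp _ _ _ _ HL)).
  assert (Bm : -1 <= km <= 1) by (apply unit_dot_bound; auto; apply (pl_tm _ _ _ _ HL)).
  set (r := Rmin eh (e / 2)).
  assert (Hr : 0 < r) by (apply Rmin_pos; lra).
  assert (r <= eh /\ r <= e / 2) as (R1 & R2) by (split; [apply Rmin_l|apply Rmin_r]).
  exists e, r, kp. split; [lra|]. split; [lra|]. split; [auto|].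
  intros u Hu.
  destruct (A_human h q th (h + sg * u) u (Hmove u ltac:(lra))) as [EAp EAm].
  fold kp in EAp. fold km in EAm. set (h' := h + sg * u) in *.
  assert (Xk : - u <= u * kp <= u) by nra. assert (Xp : Am h q - u <= Am h' q) by nra.
  intros y Hy. rewrite locmin_iff.
  destruct (Rtotal_order y q) as [Hlt|[->|Hgt]].
  - destruct (A_left h' q e (q - y) HW) as [E1 E2]; [lra|].
    replace (q - (q - y)) with y in * by ring. rewrite E1, E2. split; intros; lra.
  - split; intros; lra.
  - destruct (A_right h' q e (y - q) HW) as [E1 E2]; [lra|].
    replace (q + (y - q)) with y in * by ring. rewrite E1, E2, EAp.
    unfold e1 in B3. destruct (Req_EM_T (Ap h q) 0) as [E|E].
    + rewrite E. split; intros H; [split; [auto|]|]; lra.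
    + split; [|intros [H _]; lra]. intros H. exfalso.
      unfold Rabs in B3. destruct (Rcase_abs (Ap h q)); lra.
Qed.

End Local.

(** * Escaping positions form staircases *)

(* es_resp is [valid_response] for the squared distance, with [hpath] written out as
   h + sg * t. *)
Record escape_set (g : R -> pt) (L : R) (bad : R -> R -> Prop) : Prop := {
  es_range : forall h p, bad h p -> h < p < h + L;
  es_min : forall h p, bad h p -> IsLocMin (d2 g h) p;
  es_resp : forall h p sg T, bad h p -> sg = 1 \/ sg = -1 -> 0 < T ->
    exists pp : R -> R, pp 0 = p /\
      (forall t, 0 <= t <= T -> IsLocMin (d2 g (h + sg * t)) (pp t)) /\
      (forall t, 0 <= t < T -> right_cont pp T t) /\
      (forall t, 0 < t <= T -> exists q, left_lim pp t q /\
         (q = pp t \/ (~ IsLocMin (d2 g (h + sg * t)) q /\ descent (d2 g (h + sg * t)) q (pp t)))) /\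
      bad (h + sg * T) (pp T) }.

Section Escape.
Variables (g : R -> pt) (L : R) (tp tm : R -> pt).
Hypothesis HL : pl_loop g L tp tm.
Variable bad : R -> R -> Prop.
Hypothesis HB : escape_set g L bad.

Let Ap (h s : R) : R := dot (vsub (g s) (g h)) (tp s).
Let Am (h s : R) : R := dot (vsub (g s) (g h)) (tm s).

(** As long as [s t] is the only stable position in (lo, hi), the response is forced: right
    continuity keeps it in the interval, and a stable left limit permits no run. Only at time T may
    the branch end, and then the puppy may run from [s T]. *)
Lemma track_end (h p sg T lo hi : R) (s : R -> R) :
  bad h p -> sg = 1 \/ sg = -1 -> 0 < T -> lo < p < hi -> cont_on s 0 T ->
  (forall t, 0 <= t < T -> lo < s t < hi /\ IsLocMin (d2 g (h + sg * t)) (s t) /\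
     forall y, lo < y < hi -> IsLocMin (d2 g (h + sg * t)) y -> y = s t) ->
  exists r, bad (h + sg * T) r /\
    (r = s T \/ (~ IsLocMin (d2 g (h + sg * T)) (s T) /\ descent (d2 g (h + sg * T)) (s T) r)).
Proof.
  intros Hb Hsg HT Hp Hs Hu.
  destruct (es_resp _ _ _ HB h p sg T Hb Hsg HT) as (pp & P0 & Pm & Pr & Pl & Pe).
  assert (K : forall t, 0 <= t < T -> pp t = s t).
  { intros t Ht.
    apply (real_induction (fun t => pp t = s t) 0 t); try lra.
    - destruct (Hu 0) as (_ & _ & U); [lra|]. apply U; [lra|]. apply Pm. lra.
    - intros x Hx E. destruct (Hu x) as (U1 & _ & _); [lra|].
      destruct (Pr x ltac:(lra) (Rmin (s x - lo) (hi - s x))) as [del [Hdel Hc]]; [apply Rmin_pos; lra|].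
      exists del. split; auto. intros y Hy Hyt.
      specialize (Hc y ltac:(lra) ltac:(lra)). rewrite E in Hc.
      pose proof (Rmin_l (s x - lo) (hi - s x)). pose proof (Rmin_r (s x - lo) (hi - s x)).
      apply Rabs_def2 in Hc.
      destruct (Hu y) as (_ & _ & U); [lra|]. apply U; [lra|]. apply Pm. lra.
    - intros x Hx E. destruct (Pl x ltac:(lra)) as [q [Hq Hj]].
      assert (Eq : q = s x).
      { apply (left_lim_unique pp s x q); auto; [lra|]. eapply cont_on_sub; eauto; lra. }
      destruct Hj as [Hj|[Hj _]]; [lra|]. exfalso. apply Hj. rewrite Eq. apply Hu. lra. }
  destruct (Pl T ltac:(lra)) as [q [Hq Hj]].
  assert (Eq : q = s T) by (apply (left_lim_unique pp s T q); auto).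
  exists (pp T). split; auto. rewrite Eq in Hj. destruct Hj; auto.
Qed.

(** The infimum is attained: stable positions just above it would lie on one edge, where the
    increasing derivative has at most one zero, so they cannot accumulate. *)
Lemma min_exists (h : R) : (exists p, bad h p) -> exists m, bad h m /\ forall p, bad h p -> m <= p.
Proof.
  intros [p0 Hp0].
  set (E := fun z => bad h (- z)).
  assert (Hbd : bound E).
  { exists (- h). intros z Hz. pose proof (es_range _ _ _ HB _ _ Hz). lra. }
  assert (HE : exists z, E z) by (exists (- p0); unfold E; rewrite Ropp_involutive; auto).
  destruct (completeness E Hbd HE) as [z [Hub Hlub]].
  assert (Hlow : forall p, bad h p -> - z <= p).
  { intros p Hp. assert (- p <= z); [|lra]. apply Hub. unfold E. rewrite Ropp_involutive. auto. }
  assert (Happ : forall d, 0 < d -> exists p, bad h p /\ p < - z + d).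
  { intros d Hd. apply NNPP. intros Hn.
    assert (z <= z - d); [|lra]. apply Hlub. intros w Hw. apply Rnot_lt_le. intros Hlt.
    apply Hn. exists (- w). split; [auto|lra]. }
  exists (- z). split; auto. apply NNPP. intros Hnb.
  destruct (window_small g L tp tm HL (- z) 1 ltac:(lra)) as [e [HW _]].
  assert (He : 0 < e) by apply HW.
  assert (Hone : forall p, bad h p -> p < - z + e -> - z < p /\ p - - z = - Ap h (- z)).
  { intros p Hp Hpe. assert (- z < p).
    { destruct (Hlow p Hp) as [|E0]; auto. exfalso. apply Hnb. rewrite E0. auto. }
    split; auto.
    pose proof (es_min _ _ _ HB _ _ Hp) as Hm. apply (locmin_iff g L tp tm HL) in Hm.
    destruct (A_right g L tp tm HL h (- z) e (p - - z) HW) as [E1 E2]; [lra|].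
    replace (- z + (p - - z)) with p in * by ring. unfold Ap. lra. }
  destruct (Happ e He) as [p [Hp1 Hp2]]. destruct (Hone p Hp1 Hp2) as [H1 H2].
  destruct (Happ (p - - z)) as [p' [Hp1' Hp2']]; [lra|].
  destruct (Hone p' Hp1') as [H1' H2']; lra.
Qed.

Hypothesis Hne : forall h, exists p, bad h p.

Definition lowest (h m : R) : Prop := bad h m /\ forall p, bad h p -> m <= p.

Lemma lowest_exists : exists mn : R -> R, forall h, lowest h (mn h).
Proof.
  exists (fun h => proj1_sig (constructive_indefinite_description _ (min_exists h (Hne h)))).
  intros h. exact (proj2_sig (constructive_indefinite_description _ (min_exists h (Hne h)))).
Qed.

(* A puppy put at c would run up to the lowest escaping position. *)
Definition low (h c : R) : Prop :=
  tp c = tm c /\ h < c /\ exists m, lowest h m /\ c < m /\ dec (d2 g h) c m.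

Lemma lowest_unique (h m m' : R) : lowest h m -> lowest h m' -> m = m'.
Proof. intros [H1 H2] [H3 H4]. pose proof (H2 _ H3). pose proof (H4 _ H1). lra. Qed.

Lemma d2_self_min (h : R) : IsLocMin (d2 g h) h.
Proof.
  exists 1. split; [lra|]. intros y _. unfold d2.
  generalize (g h) (g y). intros a b. unfold dot, vsub. simpl.
  pose proof (Rle_0_sqr (fst b - fst a)). pose proof (Rle_0_sqr (snd b - snd a)).
  unfold Rsqr in *. lra.
Qed.

(* A puppy that follows its local minimum down to the human is caught there. *)
Lemma no_escape_near_human (h sg : R) : sg = 1 \/ sg = -1 ->
  exists e, 0 < e /\ forall u p, 0 < u < e -> bad (h + sg * u) p -> h + e <= p.
Proof.
  intros Hsg. destruct (window_small g L tp tm HL h 1 ltac:(lra)) as [e [HW _]].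
  assert (He : 0 < e) by apply HW. exists e. split; auto. intros u p Hu Hb.
  apply Rnot_lt_le. intros Hp.
  pose proof (es_range _ _ _ HB _ _ Hb) as [Hr _].
  pose proof (es_min _ _ _ HB _ _ Hb) as Hm. apply (locmin_iff g L tp tm HL) in Hm.
  destruct HW as [He1 [He2 He3]]. assert (HW : window g L tp tm h e) by (repeat split; auto; try apply He2; try apply He3; auto; lra).
  assert (A0 : forall w, dot (vsub (g h) (g h)) w = 0) by (intros; vec; ring).
  (* Walking up, the only stable position on the edge after h is the human's own. Walking down
     leaves a possible branch h - w k beyond the vertex h, treated below. *)
  destruct Hsg as [-> | ->].
  - destruct (A_right g L tp tm HL (h + 1 * u) h e (p - h) HW) as [E1 E2]; [lra|].
    replace (h + (p - h)) with p in * by ring.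
    destruct (A_human g tp tm h h (tp h) (h + 1 * u) u) as [E3 _].
    { destruct (He2 u ltac:(lra)) as [E _]. rewrite <- E. f_equal. ring. }
    rewrite E3, A0, (pl_tp _ _ _ _ HL) in E2. lra.
  - set (th := vscale (-1) (tm h)).
    assert (Hmv : forall w, 0 <= w <= e -> g (h + -1 * w) = vadd (g h) (vscale w th)).
    { intros w Hw. destruct (He2 w Hw) as [_ E]. replace (h + -1 * w) with (h - w) by ring.
      rewrite E. unfold th. apply pt_eq; vec; ring. }
    set (k := dot (tm h) (tp h)).
    assert (Bk : -1 <= k <= 1) by (apply unit_dot_bound; [apply (pl_tm _ _ _ _ HL)|apply (pl_tp _ _ _ _ HL)]).
    assert (HA : forall w, 0 <= w <= e -> dot (vsub (g h) (g (h + -1 * w))) (tp h) = w * k /\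
                 dot (vsub (g h) (g (h + -1 * w))) (tm h) = w).
    { intros w Hw. destruct (A_human g tp tm h h th (h + -1 * w) w (Hmv w Hw)) as [-> ->].
      rewrite !A0. unfold th. split.
      - unfold k. vec. ring.
      - transitivity (w * dot (tm h) (tm h)); [vec; ring|]. rewrite (pl_tm _ _ _ _ HL). ring. }
    assert (Loc : forall w y, 0 < w <= e -> h < y < h + e ->
       (IsLocMin (d2 g (h + -1 * w)) y <-> y = h - w * k)).
    { intros w y Hw Hy. rewrite (locmin_iff g L tp tm HL).
      destruct (A_right g L tp tm HL (h + -1 * w) h e (y - h) HW) as [E1 E2]; [lra|].
      replace (h + (y - h)) with y in * by ring. rewrite E1, E2.
      destruct (HA w ltac:(lra)) as [-> _]. split; intros; lra. }
    destruct (HA u ltac:(lra)) as [HA1 HA2].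
    assert (Hhp : h < p).
    { destruct (Rtotal_order p h) as [Hlt|[->|Hgt]]; auto; exfalso.
      - destruct (A_left g L tp tm HL (h + -1 * u) h e (h - p) HW) as [_ E2]; [lra|].
        replace (h - (h - p)) with p in * by ring. rewrite E2, HA2 in Hm. lra.
      - rewrite HA2 in Hm. lra. }
    apply (locmin_iff g L tp tm HL) in Hm. apply Loc in Hm; try lra.
    (* The human turns round and walks back to h; the branch shrinks to h, where the puppy is
       caught. *)
    destruct (track_end (h + -1 * u) p 1 u h (h + e) (fun t => h - (u - t) * k)) as [r [Hbr Hr2]]; auto; try lra.
    + apply (cont_on_pt). intros q _. apply derivable_continuous_pt. reg.
    + intros t Ht. replace (h + -1 * u + 1 * t) with (h + -1 * (u - t)) by ring.
      assert (Hk : 0 < - (u * k)) by lra. assert (k < 0) by nra.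
      assert (Hin : h < h - (u - t) * k < h + e) by (split; nra).
      split; [auto|]. split; [apply Loc; lra|]. intros y Hy Hly. apply Loc in Hly; lra.
    + replace (h + -1 * u + 1 * u) with h in * by ring.
      replace (h - (u - u) * k) with h in Hr2 by ring.
      pose proof (es_range _ _ _ HB _ _ Hbr).
      destruct Hr2 as [->|[Hr2 _]]; [lra|]. apply Hr2. apply d2_self_min.
Qed.

(* Take c slightly below the lower limit q0 of the lowest escaping positions as the
   human approaches h. If q0 is stable at h, it escapes and its branch persists. If
   not, the tracked puppy runs from q0 when the human arrives at h, necessarily
   upwards, and it passes through no other escaping position on its way. *)
Lemma low_one_sided (h sg : R) : sg = 1 \/ sg = -1 ->
  exists c e, 0 < e /\ forall u, 0 <= u < e -> low (h + sg * u) c.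
Proof.
  intros Hsg. destruct lowest_exists as [mn Hmn].
  pose proof (pl_pos _ _ _ _ HL) as HLp.
  assert (Hsg' : - sg = 1 \/ - sg = -1) by (destruct Hsg; lra).
  set (mm := fun u => mn (h + sg * u)).
  assert (Bmm : forall u, bad (h + sg * u) (mm u)) by (intros; apply Hmn).
  assert (Lmm : forall u p, bad (h + sg * u) p -> mm u <= p) by (intros u p; apply Hmn).
  assert (Hsu : forall u, 0 <= u -> - u <= sg * u <= u) by (intros; destruct Hsg as [-> | ->]; lra).
  (* Eventual lower bounds of [mm u] as u tends to 0 from above; their supremum q0 is the lower
     limit. *)
  set (E := fun x => exists e, 0 < e /\ forall u, 0 < u < e -> x <= mm u).
  assert (Hbd : bound E).
  { exists (h + 1 + L). intros x [e [He Hx]].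
    set (u := Rmin e 1 / 2).
    assert (0 < Rmin e 1) by (apply Rmin_pos; lra).
    pose proof (Rmin_l e 1). pose proof (Rmin_r e 1).
    specialize (Hx u ltac:(unfold u; lra)). pose proof (es_range _ _ _ HB _ _ (Bmm u)).
    pose proof (Hsu u ltac:(unfold u; lra)). unfold u in *. lra. }
  assert (HEne : exists x, E x).
  { exists (h - 1), 1. split; [lra|]. intros u Hu. pose proof (es_range _ _ _ HB _ _ (Bmm u)).
    pose proof (Hsu u ltac:(lra)). lra. }
  destruct (completeness E Hbd HEne) as [q0 [Hub Hlub]].
  assert (F1 : forall d, 0 < d -> exists e, 0 < e /\ forall u, 0 < u < e -> q0 - d < mm u).
  { intros d Hd. apply NNPP. intros Hn.
    assert (q0 <= q0 - d); [|lra]. apply Hlub. intros x [e [He Hx]].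
    apply Rnot_lt_le. intros Hlt. apply Hn. exists e. split; auto. intros u Hu. specialize (Hx u Hu). lra. }
  assert (F2 : forall d e, 0 < d -> 0 < e -> exists u, 0 < u < e /\ mm u < q0 + d).
  { intros d e Hd He. apply NNPP. intros Hn.
    assert (q0 + d <= q0); [|lra]. apply Hub. exists e. split; auto. intros u Hu.
    apply Rnot_lt_le. intros Hlt. apply Hn. exists u. auto. }
  assert (Fwd : forall q e0, bad h q -> 0 < e0 -> exists e r s, 0 < e <= e0 /\ 0 < r /\ s 0 = q /\ cont_on s 0 r /\
     window g L tp tm q e /\
     (forall u, 0 <= u <= r -> q - e < s u < q + e /\
        (forall y, q - e < y < q + e -> IsLocMin (d2 g (h + sg * u)) y -> y = s u) /\
        (forall c, q - e <= c -> dec (d2 g (h + sg * u)) c (s u)) /\ bad (h + sg * u) (s u))).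
  { intros q e0 Hq He0. pose proof (es_range _ _ _ HB _ _ Hq) as Hrq.
    destruct (stable_branch g L tp tm HL h q sg e0 Hsg He0) as (e & r & s & He & Hr & Hs0 & Hsc & HW & Hs).
    { apply (es_min _ _ _ HB). auto. }
    { apply (pl_inj _ _ _ _ HL). auto. }
    exists e, r, s. repeat (split; [now auto|]). intros u Hu.
    destruct (Hs u Hu) as (S1 & S2 & S3 & S4). split; [auto|]. split; [auto|]. split; [auto|].
    destruct (Req_dec u 0) as [->|Hu0].
    - rewrite Hs0. replace (h + sg * 0) with h by ring. auto.
    - destruct (track_end h q sg u (q - e) (q + e) s) as [r' [Hb' Hr']]; auto; try lra.
      + eapply cont_on_sub; eauto; lra.
      + intros t Ht. destruct (Hs t ltac:(lra)) as (T1 & T2 & T3 & _). auto.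
      + destruct Hr' as [->|[Hn _]]; auto. tauto. }
  (* If the lowest escaping position at h were below q0, its branch would give escaping positions
     below q0 for all small u. *)
  assert (G1 : q0 <= mn h).
  { apply Rnot_lt_le. intros Hlt. destruct (Hmn h) as [Hb _].
    destruct (Fwd (mn h) 1 Hb ltac:(lra)) as (e & r & s & He & Hr & Hs0 & Hsc & HW & Hs).
    set (d := (q0 - mn h) / 2). assert (Hd : 0 < d) by (unfold d; lra).
    destruct (F1 d Hd) as [e1 [He1 H1]].
    destruct (Hsc 0 ltac:(lra) d Hd) as [e2 [He2 H2]].
    set (u := Rmin (Rmin e1 e2) r / 2).
    assert (0 < Rmin (Rmin e1 e2) r) by (repeat apply Rmin_pos; lra).
    assert (u < e1 /\ u < e2 /\ u < r) as (U1 & U2 & U3).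
    { unfold u. pose proof (Rmin_l (Rmin e1 e2) r). pose proof (Rmin_r (Rmin e1 e2) r).
      pose proof (Rmin_l e1 e2). pose proof (Rmin_r e1 e2). lra. }
    assert (U0 : 0 < u) by (unfold u; lra).
    specialize (H1 u ltac:(lra)). specialize (H2 u ltac:(lra)). rewrite Rminus_0_r, Rabs_pos_eq in H2 by lra.
    specialize (H2 U2). rewrite Hs0 in H2. apply Rabs_def2 in H2.
    destruct (Hs u ltac:(lra)) as (_ & _ & _ & Hbu). apply Lmm in Hbu. unfold d in *. lra. }
  assert (G3 : h < q0).
  { destruct (no_escape_near_human h sg Hsg) as [e [He Hn]].
    destruct (F2 (e / 2) e ltac:(lra) He) as [u [Hu Hlt]].
    pose proof (Hn u (mm u) Hu (Bmm u)). lra. }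
  assert (G4 : q0 < h + L).
  { destruct (Hmn h) as [Hb _]. pose proof (es_range _ _ _ HB _ _ Hb). lra. }
  destruct (classic (IsLocMin (d2 g h) q0)) as [Hst|Hst].
  (* Some [mm u] near q0 lies on the branch through q0; walking back to h forces the puppy along
     this branch to q0. *)
  - assert (Hbq : bad h q0).
    { destruct (stable_branch g L tp tm HL h q0 sg 1 Hsg ltac:(lra) Hst) as (e & r & s & He & Hr & Hs0 & Hsc & HW & Hs).
      { apply (pl_inj _ _ _ _ HL). lra. }
      destruct (F1 e ltac:(lra)) as [e1 [He1 H1]].
      destruct (F2 e (Rmin r e1) ltac:(lra)) as [u [Hu Hlt]]; [apply Rmin_pos; lra|].
      pose proof (Rmin_l r e1). pose proof (Rmin_r r e1). specialize (H1 u ltac:(lra)).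
      destruct (track_end (h + sg * u) (mm u) (- sg) u (q0 - e) (q0 + e) (fun t => s (u - t)))
        as [r' [Hb' Hr']]; auto; try lra.
      - intros q Hq eps Heps. destruct (Hsc (u - q) ltac:(lra) eps Heps) as [d [Hd Hc]].
        exists d. split; auto. intros q' Hq' Hd'. apply Hc; [lra|].
        replace (u - q' - (u - q)) with (- (q' - q)) by ring. rewrite Rabs_Ropp. auto.
      - intros t Ht. replace (h + sg * u + - sg * t) with (h + sg * (u - t)) by ring.
        destruct (Hs (u - t) ltac:(lra)) as (T1 & T2 & T3 & _). auto.
      - replace (h + sg * u + - sg * u) with h in * by ring.
        rewrite Rminus_diag, Hs0 in Hr'. destruct Hr' as [->|[Hn _]]; [auto|tauto]. }
    assert (Eq : mn h = q0) by (destruct (Hmn h) as [_ Hl]; specialize (Hl _ Hbq); lra).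
    destruct (Fwd q0 ((q0 - h) / 2) Hbq ltac:(lra)) as (e & r & s & He & Hr & Hs0 & Hsc & HW & Hs).
    destruct (F1 e ltac:(lra)) as [e1 [He1 H1]].
    destruct (Hsc 0 ltac:(lra) (e / 2) ltac:(lra)) as [e2 [He2 H2]].
    (* Half a window below q0, so c is in the interior of an edge and, for small u, below [s u]. *)
    set (c := q0 - e / 2).
    set (ee := Rmin (Rmin e1 e2) (Rmin r (c - h))).
    assert (0 < c - h) by (unfold c; lra).
    assert (Hee : 0 < ee) by (repeat apply Rmin_pos; lra).
    assert (ee <= e1 /\ ee <= e2 /\ ee <= r /\ ee <= c - h) as (U1 & U2 & U3 & U4).
    { unfold ee. pose proof (Rmin_l (Rmin e1 e2) (Rmin r (c - h))). pose proof (Rmin_r (Rmin e1 e2) (Rmin r (c - h))).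
      pose proof (Rmin_l e1 e2). pose proof (Rmin_r e1 e2).
      pose proof (Rmin_l r (c - h)). pose proof (Rmin_r r (c - h)). lra. }
    exists c, ee. split; auto. intros u Hu. pose proof (Hsu u ltac:(lra)).
    destruct (Hs u ltac:(lra)) as (S1 & S2 & S3 & S4).
    assert (Em : mm u = s u).
    { destruct (Req_dec u 0) as [->|Hu0].
      - unfold mm. replace (h + sg * 0) with h by ring. rewrite Hs0. auto.
      - apply S2; [|apply (es_min _ _ _ HB); auto].
        specialize (H1 u ltac:(lra)). apply Lmm in S4. lra. }
    assert (Hsu2 : Rabs (s u - s 0) < e / 2).
    { apply H2; [lra|]. rewrite Rminus_0_r, Rabs_pos_eq; lra. }
    rewrite Hs0 in Hsu2. apply Rabs_def2 in Hsu2.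
    split; [|split; [lra|]].
    + destruct HW as [_ [_ HW3]]. destruct (HW3 (e / 2)) as (_ & _ & T1 & T2); [lra|].
      unfold c. rewrite T1, T2. auto.
    + exists (s u). split; [rewrite <- Em; apply Hmn|]. split; [unfold c; lra|].
      apply S3. unfold c. lra.
  - assert (Hst' := Hst). rewrite (locmin_iff g L tp tm HL) in Hst'.
    destruct (Rlt_dec (Ap h q0) 0) as [Hp|Hp].
    + destruct (fold_up_branch g L tp tm HL h q0 sg ((q0 - h) / 2) Hsg ltac:(lra) Hp)
        as (e & r & k & He & Hr & Hk & HW & Hs).
      destruct (F1 e ltac:(lra)) as [e1 [He1 H1]].
      destruct (F2 e (Rmin r e1) ltac:(lra)) as [u1 [Hu1 Hlt]]; [apply Rmin_pos; lra|].
      pose proof (Rmin_l r e1). pose proof (Rmin_r r e1). pose proof (H1 u1 ltac:(lra)) as H1u.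
      destruct (Hs u1 ltac:(lra)) as [Hs1 _].
      destruct (proj1 (Hs1 (mm u1) ltac:(lra)) (es_min _ _ _ HB _ _ (Bmm u1))) as (HA0 & Em1 & Hk1).
      assert (Hkneg : k < 0) by nra.
      (* An escaping puppy at [mm u1] follows the left branch while the human walks back; at u2 = 0
         the branch ends at the unstable q0 and the puppy has to run. *)
      assert (Back : forall u2, 0 <= u2 < u1 -> exists r', bad (h + sg * u2) r' /\
         (r' = q0 + u2 * k \/ (~ IsLocMin (d2 g (h + sg * u2)) (q0 + u2 * k) /\
            descent (d2 g (h + sg * u2)) (q0 + u2 * k) r'))).
      { intros u2 Hu2.
        destruct (track_end (h + sg * u1) (mm u1) (- sg) (u1 - u2) (q0 - e) (q0 + e) (fun t => q0 + (u1 - t) * k))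
          as [r' [Hb' Hr']]; auto; try lra.
        - apply cont_on_pt. intros q _. apply derivable_continuous_pt. reg.
        - intros t Ht. replace (h + sg * u1 + - sg * t) with (h + sg * (u1 - t)) by ring.
          destruct (Hs (u1 - t) ltac:(lra)) as [Hst1 _].
          assert (Hin : q0 - e < q0 + (u1 - t) * k < q0 + e) by (split; nra).
          split; [auto|]. split.
          + apply Hst1; auto. repeat split; auto. nra.
          + intros y Hy Hly. apply Hst1 in Hly; auto. lra.
        - replace (h + sg * u1 + - sg * (u1 - u2)) with (h + sg * u2) in * by ring.
          replace (u1 - (u1 - u2)) with u2 in Hr' by ring. exists r'. auto. }
      destruct (Back 0 ltac:(lra)) as [r' [Hb' Hr']].
      replace (h + sg * 0) with h in * by ring. replace (q0 + 0 * k) with q0 in Hr' by ring.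
      destruct (Hmn h) as [Hbm Hlm].
      assert (Hlr := Hlm _ Hb').
      assert (Hdec : q0 < r' /\ dec (d2 g h) q0 r').
      { destruct Hr' as [->|[_ [Hd|[Hd _]]]].
        - exfalso. apply Hst. apply (es_min _ _ _ HB). auto.
        - exact Hd.
        - lra. }
      (* [r'] is the lowest one, since no stable position lies strictly between q0 and [r'], where
         the distance strictly decreases. *)
      assert (Er : mn h = r').
      { destruct Hlr as [Hlt'|]; auto. exfalso.
        destruct (dec_ahead g L tp tm HL h q0 r' (proj2 Hdec)) as [Hd1 _].
        pose proof (es_min _ _ _ HB _ _ Hbm) as Hm. apply (locmin_iff g L tp tm HL) in Hm.
        specialize (Hd1 (mn h) ltac:(lra)). lra. }
      set (c := q0 - e / 2). assert (0 < c - h) by (unfold c; lra).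
      set (ee := Rmin (Rmin u1 (e / 2)) (c - h)).
      assert (Hee : 0 < ee) by (repeat apply Rmin_pos; lra).
      assert (ee <= u1 /\ ee <= e / 2 /\ ee <= c - h) as (U1 & U2 & U3).
      { unfold ee. pose proof (Rmin_l (Rmin u1 (e / 2)) (c - h)). pose proof (Rmin_r (Rmin u1 (e / 2)) (c - h)).
        pose proof (Rmin_l u1 (e / 2)). pose proof (Rmin_r u1 (e / 2)). lra. }
      assert (Hreg : tp c = tm c).
      { destruct HW as [_ [_ HW3]]. destruct (HW3 (e / 2)) as (_ & _ & T1 & T2); [lra|].
        unfold c. rewrite T1, T2. auto. }
      exists c, ee. split; auto. intros u Hu. pose proof (Hsu u ltac:(lra)).
      split; [auto|]. split; [lra|].
      destruct (Hs u ltac:(lra)) as [Hs2 Hs3].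
      assert (Huk : - u <= u * k <= 0) by nra.
      pose proof (Hs3 HA0 ltac:(lra) c ltac:(unfold c; lra)) as Hdc.
      destruct (Req_dec u 0) as [->|Hu0].
      * exists (mn h). replace (h + sg * 0) with h in * by ring. replace (q0 + 0 * k) with q0 in * by ring.
        split; [apply Hmn|]. split; [unfold c; lra|].
        apply (dec_trans _ _ q0); auto. rewrite Er. apply Hdec.
      * assert (Hukn : u * k < 0) by nra.
        assert (Hbu : bad (h + sg * u) (q0 + u * k)).
        { destruct (Back u ltac:(lra)) as [r2 [Hb2 Hr2]]. destruct Hr2 as [->|[Hn _]]; auto.
          exfalso. apply Hn. apply Hs2; auto. lra. }
        assert (Em : mm u = q0 + u * k).
        { pose proof (Lmm _ _ Hbu). pose proof (H1 u ltac:(lra)).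
          apply Hs2; [lra|]. apply (es_min _ _ _ HB). auto. }
        exists (q0 + u * k). split; [rewrite <- Em; apply Hmn|]. split; [unfold c; lra|auto].
    (* Here the run from q0 would go down to an escaping position below q0, contradicting
       [q0 <= mn h]. *)
    + exfalso. assert (Hm : 0 < Am h q0) by (unfold Ap, Am in *; lra).
      destruct (fold_down_branch g L tp tm HL h q0 sg 1 Hsg ltac:(lra) Hm ltac:(unfold Ap in *; lra))
        as (e & r & k & He & Hr & Hk & Hs).
      destruct (F1 e ltac:(lra)) as [e1 [He1 H1]].
      destruct (F2 e (Rmin r e1) ltac:(lra)) as [u1 [Hu1 Hlt]]; [apply Rmin_pos; lra|].
      pose proof (Rmin_l r e1). pose proof (Rmin_r r e1). pose proof (H1 u1 ltac:(lra)) as H1u.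
      destruct (proj1 (Hs u1 ltac:(lra) (mm u1) ltac:(lra)) (es_min _ _ _ HB _ _ (Bmm u1))) as (HA0 & Em1 & Hk1).
      assert (Hkpos : 0 < k) by nra.
      destruct (track_end (h + sg * u1) (mm u1) (- sg) u1 (q0 - e) (q0 + e) (fun t => q0 + (u1 - t) * k))
        as [r' [Hb' Hr']]; auto; try lra.
      * apply cont_on_pt. intros q _. apply derivable_continuous_pt. reg.
      * intros t Ht. replace (h + sg * u1 + - sg * t) with (h + sg * (u1 - t)) by ring.
        pose proof (Hs (u1 - t) ltac:(lra)) as Hst1.
        assert (Hin : q0 - e < q0 + (u1 - t) * k < q0 + e) by (split; nra).
        split; [auto|]. split.
        -- apply Hst1; auto. repeat split; auto. nra.
        -- intros y Hy Hly. apply Hst1 in Hly; auto. lra.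
      * replace (h + sg * u1 + - sg * u1) with h in * by ring.
        replace (q0 + (u1 - u1) * k) with q0 in Hr' by ring.
        destruct (Hmn h) as [_ Hlm]. specialize (Hlm _ Hb').
        destruct Hr' as [->|[_ [[Hlt' Hd]|[Hd _]]]].
        -- apply Hst. apply (es_min _ _ _ HB). auto.
        -- destruct (dec_ahead g L tp tm HL h q0 r' Hd) as [Hd1 _]. specialize (Hd1 q0 ltac:(lra)).
           unfold Ap in *. lra.
        -- lra.
Qed.

(** Both points run up to the same lowest position, so everything between them lies on one
    descent. *)
Lemma low_ahead (h c1 c2 q : R) : low h c1 -> low h c2 -> between c1 c2 q -> ahead g L tp tm h q.
Proof.
  assert (K : forall c c' q, low h c -> low h c' -> c <= q <= c' -> ahead g L tp tm h q).
  { intros c c' z (R1 & H1 & m & Hm & Hcm & Hd) (_ & _ & m' & Hm' & Hcm' & _) Hz.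
    pose proof (lowest_unique _ _ _ Hm Hm'). subst m'.
    pose proof (es_range _ _ _ HB _ _ (proj1 Hm)).
    destruct (dec_ahead g L tp tm HL h c m Hd) as [D1 D2].
    pose proof (D1 z ltac:(lra)) as E1.
    split; [lra|]. split; [lra|].
    (* A descent gives no left derivative at its starting point; since c is not a corner, the right
       one replaces it. *)
    destruct (Req_dec z c) as [->|Hne']; [rewrite <- R1; lra|]. apply D2. lra. }
  intros H1 H2 Hq. unfold between, Rmin, Rmax in Hq. destruct (Rle_dec c1 c2).
  - apply (K c1 c2); auto.
  - apply (K c2 c1); auto; lra.
Qed.

(** Compactness by real induction: a chain is extended past z by the point serving the right of z,
    and up to z by the one serving its left. *)
Lemma low_staircase (lo hi : R) : lo < hi ->
  exists n x d, staircase (ahead g L tp tm) lo hi n x d /\ low lo (d O).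
Proof.
  intros Hlh.
  set (chain := fun z (n : nat) (x d : nat -> R) => x O = lo /\ x n = z /\
     (forall i, (i < n)%nat -> x i < x (S i)) /\
     (forall i h, (i < n)%nat -> x i <= h <= x (S i) -> low h (d i))).
  assert (Ext : forall z w n x d c, chain z n x d -> z < w -> (forall h, z <= h <= w -> low h c) ->
     exists x' d', chain w (S n) x' d').
  { intros z w n x d c (C1 & C2 & C3 & C4) Hzw Hc.
    exists (fun i => if le_dec i n then x i else w), (fun i => if lt_dec i n then d i else c).
    split; [|split; [|split]].
    - destruct (le_dec 0 n); [auto|lia].
    - destruct (le_dec (S n) n); [lia|auto].
    - intros i Hi. destruct (le_dec i n); [|lia]. destruct (le_dec (S i) n).
      + apply C3. lia.
      + replace i with n by lia. lra.
    - intros i h Hi Hh. destruct (le_dec i n); [|lia].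
      destruct (le_dec (S i) n), (lt_dec i n); try lia.
      + apply (C4 i); auto.
      + apply Hc. replace i with n in Hh by lia. lra. }
  assert (Main : exists n x d, chain hi n x d).
  { apply (real_induction (fun z => exists n x d, chain z n x d) lo hi); try lra.
    - exists O, (fun _ => lo), (fun _ => 0). split; [auto|]. split; [auto|]. split; intros; lia.
    - intros z Hz (n & x & d & Hc).
      destruct (low_one_sided z 1 ltac:(lra)) as (c & e & He & Hl).
      exists e. split; auto. intros w Hw _.
      destruct (Ext z w n x d c Hc) as (x' & d' & Hc'); [lra| |exists (S n), x', d'; auto].
      intros h Hh. replace h with (z + 1 * (h - z)) by ring. apply Hl. lra.
    - intros z Hz Hb.
      destruct (low_one_sided z (-1) ltac:(lra)) as (c & e & He & Hl).
      set (w := Rmax lo (z - e / 2)).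
      assert (Hw : lo <= w < z /\ z - e < w).
      { unfold w, Rmax. destruct (Rle_dec lo (z - e / 2)); lra. }
      destruct (Hb w) as (n & x & d & Hc); [lra|].
      destruct (Ext w z n x d c Hc) as (x' & d' & Hc'); [lra| |exists (S n), x', d'; auto].
      intros h Hh. replace h with (z + -1 * (z - h)) by ring. apply Hl. lra. }
  destruct Main as (n & x & d & C1 & C2 & C3 & C4).
  assert (Hn : (0 < n)%nat).
  { destruct n; [|lia]. rewrite C1 in C2. lra. }
  exists n, x, d. split.
  - constructor; auto.
    + intros i h Hi Hh. pose proof (C4 i h Hi Hh). apply (low_ahead h (d i) (d i)); auto. apply between_l.
    + intros i q Hi Hq. pose proof (C3 i ltac:(lia)). pose proof (C3 (S i) ltac:(lia)).
      apply (low_ahead _ (d i) (d (S i))); auto.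
      * apply (C4 i); [lia|lra].
      * apply (C4 (S i)); [lia|lra].
  - apply (C4 O); auto. pose proof (C3 O Hn). lra.
Qed.

Lemma low_below (h c p : R) : low h c -> bad h p -> c < p.
Proof.
  intros (_ & _ & m & [_ Hm] & Hcm & _) Hp. specialize (Hm p Hp). lra.
Qed.

End Escape.

(** * Periods and the point farthest from the origin *)

Lemma period_nat (g : R -> pt) (L : R) : (forall s, g (s + L) = g s) ->
  forall (n : nat) s, g (s + INR n * L) = g s.
Proof.
  intros H n. induction n as [|n IH]; intros s.
  - simpl. f_equal. ring.
  - rewrite S_INR. replace (s + (INR n + 1) * L) with (s + INR n * L + L) by ring. rewrite H. apply IH.
Qed.

Lemma period_Z (g : R -> pt) (L : R) : (forall s, g (s + L) = g s) ->
  forall (z : Z) s, g (s + IZR z * L) = g s.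
Proof.
  intros H z s. destruct (Z_le_dec 0 z) as [Hz|Hz].
  - rewrite <- (Z2Nat.id z), <- INR_IZR_INZ by lia. apply period_nat. auto.
  - replace z with (- Z.of_nat (Z.to_nat (- z)))%Z by lia. rewrite opp_IZR, <- INR_IZR_INZ.
    rewrite <- (period_nat g L H (Z.to_nat (- z)) (s + _)). f_equal. ring.
Qed.

Lemma reduce_mod (L s : R) : 0 < L -> exists (z : Z) r, 0 <= r < L /\ s = r + IZR z * L.
Proof.
  intros HL. destruct (archimed (s / L)) as [A1 A2].
  exists (up (s / L) - 1)%Z, (s - (IZR (up (s / L)) - 1) * L).
  rewrite minus_IZR. split; [|ring].
  assert (E : s = s / L * L) by (field; lra). set (t := s / L) in *. nra.
Qed.

(** Expand |g x - g v|^2. The inequality is strict even if several points are farthest, because this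
    square is positive. *)
Lemma farthest_point (g : R -> pt) (L : R) (tp tm : R -> pt) : pl_loop g L tp tm ->
  exists v, forall x, v < x < v + L -> dot (vsub (g x) (g v)) (g v) < 0.
Proof.
  intros HL. pose proof (pl_pos _ _ _ _ HL) as HLp. pose proof (loop_continuous _ _ _ _ HL) as Hc.
  destruct (continuity_ab_maj (fun s => dot (g s) (g s)) 0 L) as [v [Hv _]]; [lra| |].
  { intros c _. apply continuity_pt_dot; auto. }
  exists v. intros x Hx.
  assert (Hm : dot (g x) (g x) <= dot (g v) (g v)).
  { destruct (reduce_mod L x HLp) as (z & r & Hr & ->).
    rewrite (period_Z g L (pl_per _ _ _ _ HL)). apply Hv. lra. }
  pose proof (loop_neq _ _ _ _ HL v x Hx) as Hp.
  assert (dot (vsub (g x) (g v)) (vsub (g x) (g v)) =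
    dot (g x) (g x) - dot (g v) (g v) - 2 * dot (vsub (g x) (g v)) (g v)) by (vec; ring).
  lra.
Qed.

(** * Reversal of the orientation *)

Lemma IsLocMin_reflect (f : R -> R) (c x : R) :
  IsLocMin f x <-> IsLocMin (fun y => f (c - y)) (c - x).
Proof.
  split; intros [e [He H]]; exists e; split; auto; intros y Hy.
  - replace (c - (c - x)) with x by ring. apply H.
    replace (c - y - x) with (- (y - (c - x))) by ring. rewrite Rabs_Ropp. auto.
  - specialize (H (c - y)). replace (c - (c - x)) with x in H by ring.
    replace (c - (c - y)) with y in H by ring. apply H.
    replace (c - y - (c - x)) with (- (y - x)) by ring. rewrite Rabs_Ropp. auto.
Qed.

Lemma descent_reflect (f : R -> R) (c q r : R) :
  descent f q r -> descent (fun y => f (c - y)) (c - q) (c - r).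
Proof.
  intros [[H1 H2]|[H1 H2]]; [right|left]; (split; [lra|]); intros x y Hx Hxy Hy; apply H2; lra.
Qed.

Lemma IsLocMin_ext (f h : R -> R) (x : R) : (forall y, f y = h y) -> IsLocMin f x -> IsLocMin h x.
Proof. intros E [e [He H]]. exists e. split; auto. intros y Hy. rewrite <- !E. auto. Qed.

Lemma descent_ext (f h : R -> R) (q r : R) : (forall y, f y = h y) -> descent f q r -> descent h q r.
Proof.
  intros E [[H1 H2]|[H1 H2]]; [left|right]; (split; [auto|]); intros x y Hx Hxy Hy; rewrite <- !E; auto.
Qed.

Section Mirror.
Variables (g : R -> pt) (L : R) (tp tm : R -> pt).
Hypothesis HL : pl_loop g L tp tm.

Let g' (s : R) : pt := g (- s).
Let tp' (s : R) : pt := vscale (-1) (tm (- s)).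
Let tm' (s : R) : pt := vscale (-1) (tp (- s)).

Lemma mirror_loop : pl_loop g' L tp' tm'.
Proof.
  constructor; unfold g', tp', tm'.
  - apply (pl_pos _ _ _ _ HL).
  - intros s. rewrite <- (pl_per _ _ _ _ HL (- (s + L))). f_equal. ring.
  - intros a b H E. apply (pl_inj _ _ _ _ HL (- b) (- a)); [lra|auto].
  - intros s. rewrite <- (pl_tm _ _ _ _ HL (- s)). vec. ring.
  - intros s. rewrite <- (pl_tp _ _ _ _ HL (- s)). vec. ring.
  - intros s. destruct (pl_lin _ _ _ _ HL (- s)) as [e [He H]]. exists e. split; auto.
    intros u Hu. destruct (H u Hu) as [E1 E2].
    replace (- (s + u)) with (- s - u) by ring. replace (- (s - u)) with (- s + u) by ring.
    rewrite E1, E2. split; apply pt_eq; vec; ring.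
Qed.

Lemma mirror_d2 (h y : R) : d2 g (- h) (L - y) = d2 g' h y.
Proof.
  unfold d2, g'. rewrite <- (pl_per _ _ _ _ HL (- y)). replace (- y + L) with (L - y) by ring. auto.
Qed.

Lemma mirror_min (h y : R) : IsLocMin (d2 g (- h)) (L - y) <-> IsLocMin (d2 g' h) y.
Proof.
  rewrite (IsLocMin_reflect _ L). replace (L - (L - y)) with y by ring.
  split; apply IsLocMin_ext; intros; rewrite mirror_d2; auto.
Qed.

Lemma mirror_ahead (h q : R) : ahead g' L tp' tm' h q -> behind g L tp tm (- h) (L - q).
Proof.
  intros (H1 & H2 & H3). unfold behind.
  destruct (tangent_per g L tp tm HL (- q)) as [E1 E2].
  replace (L - q) with (- q + L) by ring. rewrite (pl_per _ _ _ _ HL), E1, E2.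
  unfold g', tp', tm' in *. split; [lra|]. vec. lra.
Qed.

Variable bad : R -> R -> Prop.
Hypothesis HB : escape_set g L bad.
(** The shift by L puts the reflected puppy back into the strip above the reflected human. *)
Let bad' (h p : R) : Prop := bad (- h) (L - p).

Lemma mirror_escape : escape_set g' L bad'.
Proof.
  constructor; unfold bad'.
  - intros h p H. apply (es_range _ _ _ HB) in H. lra.
  - intros h p H. apply (es_min _ _ _ HB) in H. apply mirror_min. auto.
  - intros h p sg T Hb Hsg HT.
    destruct (es_resp _ _ _ HB (- h) (L - p) (- sg) T Hb) as (pp & P0 & Pm & Pr & Pl & Pe); auto.
    { lra. }
    assert (Eh : forall t, - h + - sg * t = - (h + sg * t)) by (intros; ring).
    exists (fun t => L - pp t). split; [rewrite P0; ring|]. split; [|split; [|split]].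
    + intros t Ht. apply mirror_min. replace (L - (L - pp t)) with (pp t) by ring. rewrite <- Eh. auto.
    + intros t Ht eps He. destruct (Pr t Ht eps He) as [d [Hd H]]. exists d. split; auto.
      intros s Hs Hs'. replace (L - pp s - (L - pp t)) with (- (pp s - pp t)) by ring. rewrite Rabs_Ropp. auto.
    + intros t Ht. destruct (Pl t Ht) as [q [Hq Hj]]. exists (L - q). split.
      * intros eps He. destruct (Hq eps He) as [d [Hd H]]. exists d. split; auto.
        intros s Hs Hs'. replace (L - pp s - (L - q)) with (- (pp s - q)) by ring. rewrite Rabs_Ropp. auto.
      * destruct Hj as [->|[Hn Hd]]; [auto|]. right. rewrite Eh in Hn, Hd. split.
        -- rewrite <- mirror_min. replace (L - (L - q)) with q by ring. auto.
        -- apply (descent_ext (fun y => d2 g (- (h + sg * t)) (L - y))); [intros; apply mirror_d2|].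
           apply descent_reflect. auto.
    + replace (L - (L - pp T)) with (pp T) by ring. rewrite <- Eh. auto.
Qed.

Hypothesis Hne : forall h, exists p, bad h p.

Lemma mirror_nonempty (h : R) : exists p, bad' h p.
Proof.
  destruct (Hne (- h)) as [p Hp]. exists (L - p). unfold bad'.
  replace (L - (L - p)) with p by ring. auto.
Qed.

Lemma high_staircase (lo hi : R) : lo < hi ->
  exists n x d, staircase (behind g L tp tm) lo hi n x d /\ forall p, bad hi p -> p < d (n - 1)%nat.
Proof.
  intros Hlh.
  destruct (low_staircase g' L tp' tm' mirror_loop bad' mirror_escape mirror_nonempty (- hi) (- lo))
    as (n & x & d & HS & Hlow); [lra|].
  pose proof (st_pos _ _ _ _ _ _ HS) as Hn.
  (* There are n + 1 breakpoints but n steps, hence the two different index reversals. *)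
  exists n, (fun i => - x (n - i)%nat), (fun i => L - d (n - 1 - i)%nat). split.
  - constructor; auto.
    + rewrite Nat.sub_0_r, (st_hi _ _ _ _ _ _ HS). ring.
    + rewrite Nat.sub_diag, (st_lo _ _ _ _ _ _ HS). ring.
    + intros i Hi. pose proof (st_inc _ _ _ _ _ _ HS (n - S i)%nat ltac:(lia)) as H.
      replace (S (n - S i)) with (n - i)%nat in H by lia. lra.
    + intros i h Hi Hh. rewrite <- (Ropp_involutive h). apply mirror_ahead.
      apply (st_flat _ _ _ _ _ _ HS (n - 1 - i)%nat); [lia|].
      replace (n - 1 - i)%nat with (n - S i)%nat by lia.
      replace (S (n - S i)) with (n - i)%nat by lia. lra.
    + intros i q Hi Hq.
      assert (K : ahead g' L tp' tm' (x (n - S i)%nat) (L - q)).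
      { replace (n - S i)%nat with (S (n - 1 - S i)) by lia.
        apply (st_jump _ _ _ _ _ _ HS); [lia|].
        replace (S (n - 1 - S i)) with (n - 1 - i)%nat by lia.
        unfold between, Rmin, Rmax in *.
        destruct (Rle_dec (L - d (n - 1 - i)%nat) (L - d (n - 1 - S i)%nat)),
          (Rle_dec (d (n - 1 - S i)%nat) (d (n - 1 - i)%nat)); lra. }
      apply mirror_ahead in K. replace (L - (L - q)) with q in K by ring. auto.
  - intros p Hp. rewrite Nat.sub_diag.
    assert (d O < L - p); [|lra].
    apply (low_below g' tp' tm' bad' (- hi)); auto.
    unfold bad'. rewrite Ropp_involutive. replace (L - (L - p)) with p by ring. auto.
Qed.

End Mirror.

(** One escaping pair yields one for every human position, by walking there, so both staircases
    exist. Any puppy position escaping at v lies above [c O] and below the last step of [d], which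
    gives the inequality that the parity argument needs. *)
Lemma no_escape (g : R -> pt) (L : R) (tp tm : R -> pt) (bad : R -> R -> Prop) (h p : R) :
  pl_loop g L tp tm -> escape_set g L bad -> ~ bad h p.
Proof.
  intros HL HB Hb. pose proof (pl_pos _ _ _ _ HL) as HLp.
  assert (Hne : forall h', exists p', bad h' p').
  { intros h'. destruct (Rtotal_order h h') as [Hlt|[<-|Hgt]].
    - destruct (es_resp _ _ _ HB h p 1 (h' - h) Hb) as (pp & _ & _ & _ & _ & He); auto; [lra|].
      replace (h + 1 * (h' - h)) with h' in He by ring. eauto.
    - eauto.
    - destruct (es_resp _ _ _ HB h p (-1) (h - h') Hb) as (pp & _ & _ & _ & _ & He); auto; [lra|].
      replace (h + -1 * (h - h')) with h' in He by ring. eauto. }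
  destruct (farthest_point g L tp tm HL) as [v Hv].
  destruct (lifted_angle_exists g L tp tm HL) as (phi & sigma & HP).
  destruct (tangent_angles_exist g L tp tm phi sigma HL HP) as (ap & am & HT).
  destruct (low_staircase g L tp tm HL bad HB Hne v (v + L)) as (nB & y & c & SB & Hc); [lra|].
  destruct (high_staircase g L tp tm HL bad HB Hne (v - L) v) as (nA & x & d & SA & Hd); [lra|].
  destruct (Hne v) as [q Hq].
  apply (staircases_absurd g L tp tm HL v Hv phi sigma ap am HP HT nA nB x d y c SA SB).
  pose proof (Hd q Hq). pose proof (low_below _ _ _ _ _ _ _ Hc Hq). lra.
Qed.

(** * The track as a closed curve *)

Lemma fl_unique (x : R) (z : Z) : IZR z <= x < IZR z + 1 -> fl x = IZR z.
Proof.
  intros H. unfold fl. rewrite <- (tech_up x (z + 1)); rewrite ?plus_IZR; lra.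
Qed.

Lemma lerp_inj (a b : pt) (s t : R) : a <> b -> lerp a b s = lerp a b t -> s = t.
Proof.
  intros Hab H. unfold lerp in H. injection H as H1 H2. apply NNPP. intros Hst.
  apply Hab, pt_eq.
  - assert ((s - t) * (fst b - fst a) = 0) by lra. apply Rmult_integral in H. lra.
  - assert ((s - t) * (snd b - snd a) = 0) by lra. apply Rmult_integral in H. lra.
Qed.

Lemma edist_sqr (a b : pt) : edist a b * edist a b = dot (vsub b a) (vsub b a).
Proof.
  unfold edist. rewrite sqrt_sqrt; [vec; ring|].
  pose proof (pow2_ge_0 (fst a - fst b)). pose proof (pow2_ge_0 (snd a - snd b)). lra.
Qed.

Lemma edist_ge0 (a b : pt) : 0 <= edist a b.
Proof. apply sqrt_pos. Qed.

Lemma edist_pos (a b : pt) : a <> b -> 0 < edist a b.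
Proof.
  intros H. assert (Hn : b <> a) by auto. apply dot_vsub_pos in Hn. rewrite <- edist_sqr in Hn.
  pose proof (edist_ge0 a b). nra.
Qed.

Section Track.
Variables (n : nat) (V : nat -> pt).
Hypothesis HS : simple_polygon n V.

Let L : R := perimeter n V.
Let vertex_pos (k : nat) : R := sum_len n V k.
Let elen (k : nat) : R := edge_len n V k.

Lemma vert_neq (k : nat) : vert n V k <> vert n V (S k).
Proof.
  destruct HS as (Hn & Hinj & _). unfold vert. intros E.
  apply Hinj in E; try (apply Nat.mod_upper_bound; lia).
  pose proof (Nat.mod_upper_bound k n ltac:(lia)).
  assert (S k mod n = S (k mod n) mod n)%nat as E2.
  { rewrite <- (Nat.add_1_r k), <- (Nat.add_1_r (k mod n)), Nat.Div0.add_mod_idemp_l. auto. }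
  rewrite E2 in E. clear E2. generalize dependent (k mod n)%nat. intros r E Hr.
  destruct (Nat.eq_dec (S r) n) as [E3|E3].
  - rewrite E3 in E. rewrite Nat.Div0.mod_same in E. lia.
  - rewrite Nat.mod_small in E by lia. lia.
Qed.

Lemma elen_pos (k : nat) : 0 < elen k.
Proof. apply edist_pos, vert_neq. Qed.

Lemma sum_len_incr (i k : nat) : (i < k)%nat -> vertex_pos i + elen i <= vertex_pos k.
Proof.
  intros H. induction H as [|k H IH]; unfold vertex_pos, elen in *; simpl.
  - lra.
  - pose proof (elen_pos k) as Hl. unfold elen in Hl. lra.
Qed.

Lemma n_pos : (0 < n)%nat.
Proof. destruct HS. lia. Qed.

Lemma perimeter_pos : 0 < L.
Proof.
  pose proof (sum_len_incr 0 n n_pos). pose proof (elen_pos 0). unfold vertex_pos, L, perimeter in *. simpl in *. lra.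
Qed.

Lemma sum_len_ge0 (k : nat) : 0 <= vertex_pos k.
Proof.
  destruct k; [unfold vertex_pos; simpl; lra|].
  pose proof (sum_len_incr 0 (S k) ltac:(lia)). pose proof (elen_pos 0). unfold vertex_pos in *. simpl in *. lra.
Qed.

Lemma locate_edge (m i k : nat) (w : R) : (i <= k < i + m)%nat -> 0 <= w < elen k ->
  locate n V i m (vertex_pos k - vertex_pos i + w) = lerp (vert n V k) (vert n V (S k)) (w / elen k).
Proof.
  revert i. induction m as [|m IH]; intros i Hk Hw; [lia|]. simpl. fold (elen i).
  destruct (Nat.eq_dec k i) as [->|Hne].
  - replace (vertex_pos i - vertex_pos i + w) with w by ring. destruct (Rlt_dec w (elen i)); [auto|lra].
  - pose proof (sum_len_incr i k ltac:(lia)).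
    destruct (Rlt_dec (vertex_pos k - vertex_pos i + w) (elen i)); [lra|].
    rewrite <- (IH (S i)); [|lia|auto]. f_equal. unfold vertex_pos, elen. simpl. ring.
Qed.

Lemma track_edge_open (k : nat) (w : R) (z : Z) : (k < n)%nat -> 0 <= w < elen k ->
  track n V (vertex_pos k + w + IZR z * L) = lerp (vert n V k) (vert n V (S k)) (w / elen k).
Proof.
  intros Hk Hw. unfold track. fold L. pose proof perimeter_pos as HLp.
  pose proof (sum_len_ge0 k). pose proof (sum_len_incr k n Hk) as Hi.
  fold (perimeter n V) in Hi. unfold vertex_pos at 2 in Hi. fold (perimeter n V) in Hi. fold L in Hi.
  assert (E : (vertex_pos k + w + IZR z * L) / L = IZR z + (vertex_pos k + w) / L) by (field; lra).
  assert (B : 0 <= (vertex_pos k + w) / L < 1).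
  { split; [apply Rmult_le_pos; [lra|left; apply Rinv_0_lt_compat; auto]|].
    apply (Rmult_lt_reg_r L); auto. unfold Rdiv. rewrite Rmult_assoc, Rinv_l; lra. }
  rewrite (fl_unique _ z) by (rewrite E; lra).
  rewrite <- (locate_edge n 0 k) by (auto; lia). f_equal. unfold vertex_pos at 3. simpl. ring.
Qed.

(** [z] counts laps. The far end of an edge is located as the start of the next one, which for the
    last edge belongs to lap z + 1. *)
Lemma track_edge (k : nat) (w : R) (z : Z) : (k < n)%nat -> 0 <= w <= elen k ->
  track n V (vertex_pos k + w + IZR z * L) = lerp (vert n V k) (vert n V (S k)) (w / elen k).
Proof.
  intros Hk Hw. destruct (Req_dec w (elen k)) as [->|]; [|apply track_edge_open; auto; lra].
  pose proof (elen_pos k) as Hl.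
  assert (L1 : forall a b : pt, lerp a b (elen k / elen k) = b).
  { intros. replace (elen k / elen k) with 1 by (field; lra). unfold lerp. apply pt_eq; simpl; ring. }
  assert (L0 : forall j (a b : pt), lerp a b (0 / elen j) = a).
  { intros. unfold Rdiv. rewrite Rmult_0_l. unfold lerp. apply pt_eq; simpl; ring. }
  rewrite L1. destruct (Nat.eq_dec (S k) n) as [E|E].
  - replace (vertex_pos k + elen k + IZR z * L) with (vertex_pos 0 + 0 + IZR (z + 1) * L).
    + rewrite track_edge_open; [|apply n_pos|pose proof (elen_pos 0); lra]. rewrite L0.
      unfold vert. rewrite E, Nat.Div0.mod_same, Nat.Div0.mod_0_l. auto.
    + assert (EL : L = vertex_pos k + elen k) by (unfold L, perimeter, vertex_pos, elen; rewrite <- E at 2; reflexivity).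
      rewrite plus_IZR. transitivity (L + IZR z * L); [unfold vertex_pos; simpl; ring|rewrite EL; ring].
  - replace (vertex_pos k + elen k + IZR z * L) with (vertex_pos (S k) + 0 + IZR z * L).
    + rewrite track_edge_open; [|lia|pose proof (elen_pos (S k)); lra]. apply L0.
    + unfold vertex_pos, elen. simpl. ring.
Qed.

Lemma edge_of_right (s : R) : exists k w z, (k < n)%nat /\ 0 <= w < elen k /\ s = vertex_pos k + w + IZR z * L.
Proof.
  destruct (reduce_mod L s perimeter_pos) as (z & r & Hr & ->).
  destruct (nat_crossing vertex_pos r n) as [k [Hk Hkr]].
  - unfold vertex_pos. simpl. lra.
  - apply Hr.
  - exists k, (r - vertex_pos k), z. split; [lia|]. unfold vertex_pos, elen in *. simpl in Hkr. lra.
Qed.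

(** A vertex is assigned to its incoming edge, to read off the left tangent. *)
Lemma edge_of_left (s : R) : exists k w z, (k < n)%nat /\ 0 < w <= elen k /\ s = vertex_pos k + w + IZR z * L.
Proof.
  destruct (edge_of_right s) as (k & w & z & Hk & Hw & ->).
  destruct (Req_dec w 0) as [->|Hw0]; [|exists k, w, z; repeat split; auto; lra].
  destruct k as [|k].
  - exists (n - 1)%nat, (elen (n - 1)), (z - 1)%Z. pose proof (elen_pos (n - 1)).
    pose proof n_pos. split; [lia|]. split; [lra|].
    assert (E : L = vertex_pos (n - 1) + elen (n - 1)).
    { unfold L, perimeter. replace n with (S (n - 1)) at 2 by lia. reflexivity. }
    rewrite minus_IZR, <- E. unfold vertex_pos. simpl. ring.
  - exists k, (elen k), z. pose proof (elen_pos k). split; [lia|]. split; [lra|].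
    unfold vertex_pos, elen. simpl. ring.
Qed.

Let edge_dir (k : nat) : pt := vscale (/ elen k) (vsub (vert n V (S k)) (vert n V k)).

Lemma edge_dir_norm (k : nat) : dot (edge_dir k) (edge_dir k) = 1.
Proof.
  pose proof (elen_pos k). pose proof (edist_sqr (vert n V k) (vert n V (S k))) as E.
  transitivity (/ elen k * / elen k * (elen k * elen k)); [|field; lra].
  unfold elen at 3 4. unfold edge_len. rewrite E. unfold edge_dir. vec. ring.
Qed.

Lemma track_move (k : nat) (w u : R) (z : Z) : (k < n)%nat -> 0 <= w <= elen k -> 0 <= w + u <= elen k ->
  track n V (vertex_pos k + w + IZR z * L + u) = vadd (track n V (vertex_pos k + w + IZR z * L)) (vscale u (edge_dir k)).
Proof.
  intros Hk H1 H2. replace (vertex_pos k + w + IZR z * L + u) with (vertex_pos k + (w + u) + IZR z * L) by ring.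
  rewrite !track_edge by auto. pose proof (elen_pos k). unfold edge_dir, lerp.
  apply pt_eq; vec; field; lra.
Qed.

Lemma right_tangent (s : R) : exists t, dot t t = 1 /\ exists e, 0 < e /\
  forall u, 0 <= u <= e -> track n V (s + u) = vadd (track n V s) (vscale u t).
Proof.
  destruct (edge_of_right s) as (k & w & z & Hk & Hw & ->).
  exists (edge_dir k). split; [apply edge_dir_norm|]. exists (elen k - w). split; [lra|].
  intros u Hu. apply track_move; auto; lra.
Qed.

Lemma left_tangent (s : R) : exists t, dot t t = 1 /\ exists e, 0 < e /\
  forall u, 0 <= u <= e -> track n V (s - u) = vadd (track n V s) (vscale (- u) t).
Proof.
  destruct (edge_of_left s) as (k & w & z & Hk & Hw & ->).
  exists (edge_dir k). split; [apply edge_dir_norm|]. exists w. split; [lra|].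
  intros u Hu. unfold Rminus. apply track_move; auto; lra.
Qed.

Lemma track_per (s : R) : track n V (s + L) = track n V s.
Proof.
  destruct (edge_of_right s) as (k & w & z & Hk & Hw & ->).
  replace (vertex_pos k + w + IZR z * L + L) with (vertex_pos k + w + IZR (z + 1) * L) by (rewrite plus_IZR; ring).
  rewrite !track_edge_open by auto. auto.
Qed.

Lemma track_inj (a b : R) : a < b < a + L -> track n V a <> track n V b.
Proof.
  destruct (edge_of_right a) as (j & w & z & Hj & Hw & ->).
  destruct (edge_of_right b) as (k & w' & z' & Hk & Hw' & ->).
  intros Hab E. pose proof perimeter_pos as HLp.
  rewrite !track_edge_open in E by auto.
  pose proof (elen_pos j). pose proof (elen_pos k).
  assert (B : forall i u, 0 < elen i -> 0 <= u < elen i -> 0 <= u / elen i < 1).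
  { intros i u Hi Hu. split; [apply Rmult_le_pos; [lra|left; apply Rinv_0_lt_compat; auto]|].
    apply (Rmult_lt_reg_r (elen i)); auto. unfold Rdiv. rewrite Rmult_assoc, Rinv_l; lra. }
  pose proof (B j w H Hw). pose proof (B k w' H0 Hw').
  (* Consecutive edges meet only at the far end of the earlier one, where the edge parameter is 1;
     the half-open parametrization excludes this value. *)
  assert (K : forall i i' u x, (i' < n)%nat -> 0 <= u / elen i < 1 ->
    x = lerp (vert n V i) (vert n V (S i)) (u / elen i) -> (S i mod n)%nat = i' -> x = V i' -> False).
  { intros i i' u x Hi' Hu Ex Ei Ex'.
    assert (u / elen i = 1); [|lra]. apply (lerp_inj (vert n V i) (vert n V (S i))); [apply vert_neq|].
    rewrite <- Ex, Ex'. subst i'. unfold lerp, vert. apply pt_eq; simpl; ring. }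
  destruct (Nat.eq_dec j k) as [->|Hne].
  - apply lerp_inj in E; [|apply vert_neq].
    assert (Ew : w = w') by (apply (Rmult_eq_reg_r (/ elen k)); [auto|apply Rgt_not_eq, Rinv_0_lt_compat; auto]).
    subst w'. assert (H3 : 0 < IZR (z' - z) * L < 1 * L) by (rewrite minus_IZR; lra).
    assert (0 < IZR (z' - z)) as H4 by nra. assert (IZR (z' - z) < 1) as H5 by nra.
    apply lt_IZR in H4. apply lt_IZR in H5. lia.
  - destruct HS as (_ & _ & Hs).
    destruct (Hs j k (lerp (vert n V j) (vert n V (S j)) (w / elen j)) Hj Hk Hne) as [[E1 E2]|[E1 E2]].
    + exists (w / elen j). split; [lra|auto].
    + exists (w' / elen k). split; [lra|auto].
    + apply (K j k w _ Hk ltac:(lra) eq_refl E1 E2).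
    + apply (K k j w' _ Hj ltac:(lra) E E1 E2).
Qed.

Lemma track_pl_loop : exists tp tm, pl_loop (track n V) L tp tm.
Proof.
  exists (fun s => proj1_sig (constructive_indefinite_description _ (right_tangent s))),
         (fun s => proj1_sig (constructive_indefinite_description _ (left_tangent s))).
  constructor.
  - apply perimeter_pos.
  - apply track_per.
  - apply track_inj.
  - intros s. apply (proj2_sig (constructive_indefinite_description _ (right_tangent s))).
  - intros s. apply (proj2_sig (constructive_indefinite_description _ (left_tangent s))).
  - intros s.
    destruct (proj2_sig (constructive_indefinite_description _ (right_tangent s))) as [_ [e1 [He1 H1]]].
    destruct (proj2_sig (constructive_indefinite_description _ (left_tangent s))) as [_ [e2 [He2 H2]]].
    exists (Rmin e1 e2). pose proof (Rmin_l e1 e2). pose proof (Rmin_r e1 e2).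
    split; [apply Rmin_pos; auto|]. intros u Hu. split; [apply H1; lra|apply H2; lra].
Qed.

End Track.

(** * The game *)

Lemma IsLocMin_shift (f : R -> R) (c x : R) :
  (forall y, f (y + c) = f y) -> IsLocMin f (x + c) <-> IsLocMin f x.
Proof.
  intros P. split; intros [e [He H]]; exists e; split; auto; intros y Hy.
  - rewrite <- (P x), <- (P y). apply H. replace (y + c - (x + c)) with (y - x) by ring. auto.
  - replace y with (y - c + c) by ring. rewrite !P. apply H.
    replace (y - c - x) with (y - (x + c)) by ring. auto.
Qed.

Lemma descent_shift (f : R -> R) (c q r : R) :
  (forall y, f (y + c) = f y) -> descent f (q + c) (r + c) -> descent f q r.
Proof.
  intros P [[H1 H2]|[H1 H2]]; [left|right]; (split; [lra|]); intros x y Hx Hxy Hy;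
    rewrite <- (P x), <- (P y); apply H2; lra.
Qed.

Lemma left_lim_shift (p : R -> R) (c t q : R) : left_lim p t q -> left_lim (fun s => p s - c) t (q - c).
Proof.
  intros H eps He. destruct (H eps He) as [d [Hd K]]. exists d. split; auto.
  intros s Hs Hst. replace (p s - c - (q - c)) with (p s - q) by ring. auto.
Qed.

(** b is a moving barrier, here the human's position; c bounds its speed. *)
Lemma left_lim_ge (p b : R -> R) (t q c : R) : 0 < t -> left_lim p t q -> 0 <= c ->
  (forall s, 0 <= s < t -> b t - c * (t - s) <= p s) -> b t <= q.
Proof.
  intros Ht Hq Hc Hb. apply Rnot_lt_le. intros Hlt.
  destruct (Hq ((b t - q) / 2) ltac:(lra)) as [d [Hd K]].
  set (w := Rmin (Rmin d t) ((b t - q) / 2 / (c + 1)) / 2).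
  assert (0 < (b t - q) / 2 / (c + 1)) by (apply Rdiv_lt_0_compat; lra).
  assert (0 < Rmin (Rmin d t) ((b t - q) / 2 / (c + 1))) by (repeat apply Rmin_pos; lra).
  assert (0 < w /\ w < d /\ w < t /\ w < (b t - q) / 2 / (c + 1)) as (W0 & W1 & W2 & W3).
  { unfold w. pose proof (Rmin_l (Rmin d t) ((b t - q) / 2 / (c + 1))).
    pose proof (Rmin_r (Rmin d t) ((b t - q) / 2 / (c + 1))).
    pose proof (Rmin_l d t). pose proof (Rmin_r d t). lra. }
  assert (c * w <= (b t - q) / 2).
  { assert ((c + 1) * w <= (c + 1) * ((b t - q) / 2 / (c + 1))) by (apply Rmult_le_compat_l; lra).
    replace ((c + 1) * ((b t - q) / 2 / (c + 1))) with ((b t - q) / 2) in * by (field; lra). lra. }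
  specialize (K (t - w) ltac:(lra) ltac:(lra)). specialize (Hb (t - w) ltac:(lra)).
  replace (t - (t - w)) with w in Hb by ring. apply Rabs_def2 in K. lra.
Qed.

Lemma d2_ge0 (g : R -> pt) (h y : R) : 0 <= d2 g h y.
Proof.
  unfold d2, dot. pose proof (Rle_0_sqr (fst (vsub (g y) (g h)))).
  pose proof (Rle_0_sqr (snd (vsub (g y) (g h)))). unfold Rsqr in *. lra.
Qed.

Lemma d2_zero (g : R -> pt) (h y : R) : g y = g h -> d2 g h y = 0.
Proof. intros E. unfold d2. rewrite E. vec. ring. Qed.

Lemma d2_zero_min (g : R -> pt) (h y : R) : g y = g h -> IsLocMin (d2 g h) y.
Proof.
  intros E. exists 1. split; [lra|]. intros z _. rewrite (d2_zero g h y E). apply d2_ge0.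
Qed.

Section Game.
Variables (n : nat) (V : nat -> pt).
Hypothesis HS : simple_polygon n V.

Let L : R := perimeter n V.
Let g : R -> pt := track n V.

Lemma tdist_d2 (h y : R) : tdist n V h y = sqrt (d2 g h y).
Proof. unfold tdist, edist. f_equal. unfold d2, g. vec. ring. Qed.

Lemma IsLocMin_tdist (h p : R) : IsLocMin (fun y => tdist n V h y) p <-> IsLocMin (d2 g h) p.
Proof.
  split; intros [e [He H]]; exists e; split; auto; intros y Hy; specialize (H y Hy); simpl in *.
  - rewrite !tdist_d2 in H. apply sqrt_le_0; auto using d2_ge0.
  - rewrite !tdist_d2. apply sqrt_le_1; auto using d2_ge0.
Qed.

Lemma descent_tdist (h q r : R) : descent (fun y => tdist n V h y) q r -> descent (d2 g h) q r.
Proof.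
  intros [[H1 H2]|[H1 H2]]; [left|right]; (split; [auto|]); intros x y Hx Hxy Hy;
    specialize (H2 x y Hx Hxy Hy); simpl in H2; rewrite !tdist_d2 in H2;
    apply sqrt_lt_0; auto using d2_ge0.
Qed.

Lemma d2_period (z : Z) (h y : R) : d2 g h (y + IZR z * L) = d2 g h y.
Proof. unfold d2. rewrite (period_Z g L); auto. apply track_per. auto. Qed.

Lemma hpath_eq (h sg T t : R) : sg = 1 \/ sg = -1 -> 0 < T -> hpath h (h + sg * T) t = h + sg * t.
Proof. intros [-> | ->] HT; unfold hpath; destruct (Rle_dec _ _); lra. Qed.

Lemma hpath_length (h sg T : R) : sg = 1 \/ sg = -1 -> 0 < T -> Rabs (h + sg * T - h) = T.
Proof.
  intros [-> | ->] HT.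
  - rewrite Rabs_pos_eq; lra.
  - rewrite Rabs_left; lra.
Qed.

(** The lap count z normalizes the puppy's lift to the strip without any statement about how
    [can_catch] behaves under translation by L. *)
Definition escaping (h p : R) : Prop :=
  h < p < h + L /\ IsLocMin (d2 g h) p /\ exists z : Z, ~ can_catch n V h (p + IZR z * L).

(** At both ends of the strip the distance is 0, a global minimum. A left limit there is stable,
    which means capture, and no strict descent can run through such a point. *)
Lemma escaping_in_range (h sg T : R) (pp : R -> R) : sg = 1 \/ sg = -1 ->
  h < pp 0 < h + L ->
  (forall t, 0 <= t < T -> right_cont pp T t) ->
  (forall t, 0 < t <= T -> exists q, left_lim pp t q /\
     (q = pp t \/ (~ IsLocMin (d2 g (h + sg * t)) q /\ descent (d2 g (h + sg * t)) q (pp t)))) ->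
  (forall t, 0 <= t <= T -> g (pp t) <> g (h + sg * t)) ->
  forall t, 0 <= t <= T -> h + sg * t < pp t < h + sg * t + L.
Proof.
  intros Hsg H0 Hr Hl Hc t0 Ht0.
  assert (PL : forall s, g (s + L) = g s) by (apply track_per; auto).
  assert (Sg : forall u, 0 <= u -> - u <= sg * u <= u) by (intros; destruct Hsg as [-> | ->]; lra).
  apply (real_induction (fun t => h + sg * t < pp t < h + sg * t + L) 0 t0); try lra.
  - intros x Hx [B1 B2].
    set (m := Rmin (pp x - (h + sg * x)) (h + sg * x + L - pp x) / 2).
    assert (0 < Rmin (pp x - (h + sg * x)) (h + sg * x + L - pp x)) by (apply Rmin_pos; lra).
    pose proof (Rmin_l (pp x - (h + sg * x)) (h + sg * x + L - pp x)).
    pose proof (Rmin_r (pp x - (h + sg * x)) (h + sg * x + L - pp x)).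
    destruct (Hr x ltac:(lra) m) as [d [Hd K]]; [unfold m; lra|].
    exists (Rmin d m). split; [apply Rmin_pos; unfold m; lra|]. intros y Hy Hyt.
    pose proof (Rmin_l d m). pose proof (Rmin_r d m).
    specialize (K y ltac:(lra) ltac:(lra)). apply Rabs_def2 in K.
    pose proof (Sg (y - x) ltac:(lra)). unfold m in *. lra.
  - intros x Hx Hb. destruct (Hl x ltac:(lra)) as [q [Hq Hj]].
    specialize (Hc x ltac:(lra)). set (hx := h + sg * x) in *.
    assert (Q1 : hx <= q).
    { apply (left_lim_ge pp (fun t => h + sg * t) x q 1); auto; try lra.
      intros s Hs. destruct (Hb s Hs). pose proof (Sg (x - s) ltac:(lra)). lra. }
    assert (Q2 : q <= hx + L).
    { apply Ropp_le_cancel.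
      apply (left_lim_ge (fun t => - pp t) (fun t => - (h + sg * t + L)) x (- q) 1); auto; try lra.
      - intros eps He. destruct (Hq eps He) as [d [Hd K]]. exists d. split; auto.
        intros s Hs Hs'. replace (- pp s - - q) with (- (pp s - q)) by ring. rewrite Rabs_Ropp. auto.
      - intros s Hs. destruct (Hb s Hs). pose proof (Sg (x - s) ltac:(lra)). lra. }
    assert (Hzero : forall z, z = hx \/ z = hx + L -> g z = g hx) by (intros z [-> | ->]; auto).
    destruct Hj as [->|[Hn Hd]].
    + split; apply Rnot_le_lt; intros Hle; apply Hc, Hzero; lra.
    + assert (Q1' : hx < q).
      { destruct Q1 as [|E]; auto. exfalso. apply Hn, d2_zero_min, Hzero. auto. }
      assert (Q2' : q < hx + L).
      { destruct Q2 as [|E]; auto. exfalso. apply Hn, d2_zero_min, Hzero. auto. }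
      pose proof (d2_ge0 g hx (pp x)).
      split; apply Rnot_le_lt; intros Hle.
      * assert (Hlt : pp x < hx) by (destruct Hle as [|E]; auto; exfalso; apply Hc, Hzero; auto).
        destruct Hd as [[Hd _]|[_ Hd]]; [lra|].
        specialize (Hd hx (pp x) ltac:(lra) ltac:(lra) ltac:(lra)).
        rewrite (d2_zero g hx hx) in Hd by auto. lra.
      * assert (Hlt : hx + L < pp x) by (destruct Hle as [|E]; auto; exfalso; apply Hc, Hzero; auto).
        destruct Hd as [[_ Hd]|[Hd _]]; [|lra].
        specialize (Hd (hx + L) (pp x) ltac:(lra) ltac:(lra) ltac:(lra)).
        rewrite (d2_zero g hx (hx + L)) in Hd by auto. lra.
Qed.

Lemma escaping_response (h p sg T : R) : escaping h p -> sg = 1 \/ sg = -1 -> 0 < T ->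
  exists pp : R -> R, pp 0 = p /\
    (forall t, 0 <= t <= T -> IsLocMin (d2 g (h + sg * t)) (pp t)) /\
    (forall t, 0 <= t < T -> right_cont pp T t) /\
    (forall t, 0 < t <= T -> exists q, left_lim pp t q /\
       (q = pp t \/ (~ IsLocMin (d2 g (h + sg * t)) q /\ descent (d2 g (h + sg * t)) q (pp t)))) /\
    escaping (h + sg * T) (pp T).
Proof.
  intros (Hr & Hm & z & Hz) Hsg HT.
  set (w := IZR z * L) in *.
  assert (P : forall h' y, d2 g h' (y + w) = d2 g h' y) by (intros; apply d2_period).
  assert (Hex : exists pp, valid_response n V h (h + sg * T) (p + w) pp /\
    (forall t, 0 <= t <= T -> ~ caught n V (h + sg * t) (pp t)) /\
    ~ can_catch n V (h + sg * T) (pp T)).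
  (* If every response to this walk led to capture or to a winning pair, the walk itself would win
     by [cc_move]. *)
  { apply NNPP. intros Hno. apply Hz. apply (cc_move n V h (p + w) (h + sg * T)).
    - apply IsLocMin_tdist, IsLocMin_shift; auto.
    - intros pp Hpp. rewrite hpath_length by auto. apply NNPP. intros Hn.
      apply Hno. exists pp. split; [auto|]. split.
      + intros t Ht Hct. apply Hn. left. exists t. rewrite hpath_eq by auto. auto.
      + intros Hct. apply Hn. auto. }
  destruct Hex as (pp & (V0 & V1 & V2 & V3) & Hc & Hnc).
  rewrite hpath_length in V1, V2, V3 by auto.
  set (pq := fun t => pp t - w).
  assert (Epq : forall t, pq t + w = pp t) by (intros; unfold pq; ring).
  assert (K0 : pq 0 = p) by (unfold pq; rewrite V0; ring).
  assert (K1 : forall t, 0 <= t <= T -> IsLocMin (d2 g (h + sg * t)) (pq t)).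
  { intros t Ht. specialize (V1 t Ht). rewrite hpath_eq in V1 by auto.
    apply IsLocMin_tdist in V1. rewrite <- Epq in V1. apply IsLocMin_shift in V1; auto. }
  assert (K2 : forall t, 0 <= t < T -> right_cont pq T t).
  { intros t Ht eps He. destruct (V2 t Ht eps He) as [d [Hd K]]. exists d. split; auto.
    intros s Hs Hs'. unfold pq. replace (pp s - w - (pp t - w)) with (pp s - pp t) by ring. auto. }
  assert (K3 : forall t, 0 < t <= T -> exists q, left_lim pq t q /\
       (q = pq t \/ (~ IsLocMin (d2 g (h + sg * t)) q /\ descent (d2 g (h + sg * t)) q (pq t)))).
  { intros t Ht. destruct (V3 t Ht) as [q [Hq Hj]]. exists (q - w). split; [apply left_lim_shift; auto|].
    assert (Eq : q - w + w = q) by ring.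
    destruct Hj as [->|[Hn Hd]]; [auto|]. right. rewrite hpath_eq in Hn, Hd by auto. split.
    - intros Hm'. apply Hn, IsLocMin_tdist. rewrite <- Eq. apply IsLocMin_shift; auto.
    - apply (descent_shift _ w); auto. rewrite Epq, Eq. apply descent_tdist. auto. }
  exists pq. split; [auto|]. split; [auto|]. split; [auto|]. split; [auto|].
  split; [|split].
  - apply (escaping_in_range h sg T pq); auto; try lra.
    intros t Ht E. apply (Hc t Ht). unfold caught. fold g. rewrite <- E, <- Epq.
    unfold w. rewrite (period_Z g L); auto. apply track_per. auto.
  - apply K1. lra.
  - exists z. fold w. rewrite Epq. auto.
Qed.

Lemma escaping_set : escape_set g L escaping.
Proof.
  constructor.
  - intros h p H. apply H.
  - intros h p H. apply H.
  - apply escaping_response.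
Qed.

End Game.

Theorem theorem14 (n : nat) (V : nat -> R * R) :
  simple_polygon n V ->
  forall h0 p0 p1 : R,
    settle (fun y => tdist n V h0 y) p0 p1 ->
    can_catch n V h0 p1.
Proof.
  intros HS h0 p0 p1 Hset. apply NNPP. intros Hn.
  destruct (track_pl_loop n V HS) as (tp & tm & HL).
  assert (Hm : IsLocMin (d2 (track n V) h0) p1).
  { apply IsLocMin_tdist. destruct Hset as [[H ->]|(_ & _ & H)]; auto. }
  (* r is the puppy's lead over the human modulo the perimeter; r = 0 means that it is already
     caught. *)
  destruct (reduce_mod (perimeter n V) (p1 - h0) (perimeter_pos n V HS)) as (z & r & Hr & E).
  assert (E1 : p1 = h0 + r + IZR z * perimeter n V) by lra.
  apply (no_escape _ _ _ _ (escaping n V) h0 (h0 + r) HL (escaping_set n V HS)).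
  split; [|split].
  - destruct (Req_dec r 0) as [->|]; [|lra]. exfalso. apply Hn, cc_now. unfold caught.
    rewrite E1, (period_Z _ _ (track_per n V HS)). f_equal. ring.
  - rewrite E1 in Hm. apply IsLocMin_shift in Hm; auto. intros; apply d2_period; auto.
  - exists z. rewrite <- E1. auto.
Qed.
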